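(* Let $(V,\sigma)$ be a braided vector space. Then the quadruple $(\overline{\mathcal{Y}(V)},\prec_\sigma,\succ_\sigma,\sigma_{BT})$ together with the map $i_V:V\to\overline{\mathcal{Y}(V)}$, $v\mapsto |\vee_v|$, is the free braided dendriform algebra on $(V,\sigma)$. More precisely, for any braided dendriform algebra $(D,\prec_D,\succ_D,\tau)$ and any homomorphism $\varphi:V\to D$ of braided vector spaces, there exists a unique homomorphism $\bar\varphi:\overline{\mathcal{Y}(V)}\to D$ of braided dendriform algebras such that $\varphi=\bar\varphi\circ i_V$.
   Context: Ground field $\mathbf{k}$ of characteristic $0$; all vector spaces, algebras and tensor products are over $\mathbf{k}$. Braidings. A braiding on a vector space $V$ is a linear map $\sigma\in\mathrm{End}(V\otimes V)$ with $(\sigma\otimes \mathrm{id})(\mathrm{id}\otimes\sigma)(\sigma\otimes \mathrm{id})=(\mathrm{id}\otimes\sigma)(\sigma\otimes \mathrm{id})(\mathrm{id}\otimes\sigma)$ on $V^{\otimes3}$ (invertibility is not required); $(V,\sigma)$ is then a braided vector space. A homomorphism $f:(V,\sigma)\to(V',\sigma')$ of braided vector spaces is a linear map with $(f\otimes f)\sigma=\sigma'(f\otimes f)$. For an operator on two adjacent tensor factors, the subscript $i$ (as in $\sigma_i$) means it acts on the $i$-th and $(i+1)$-th factors. For $w\in\mathfrak{S}_n$ with reduced expression $w=s_{i_1}\cdots s_{i_l}$ put $T^\sigma_w=\sigma_{i_1}\cdots\sigma_{i_l}$ on $V^{\otimes n}$; when $\sigma$ is the flip, $T_w(v_1\otimes\cdots\otimes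 v_n)=v_{w^{-1}(1)}\otimes\cdots\otimes v_{w^{-1}(n)}$. For $i,j\ge1$ let $\beta_{ij}=T^\sigma_{\chi_{ij}}:V^{\otimes i}\otimes V^{\otimes j}\to V^{\otimes j}\otimes V^{\otimes i}$, where $\chi_{ij}\in\mathfrak{S}_{i+j}$ sends $a\mapsto j+a$ for $1\le a\le i$ and $i+b\mapsto b$ for $1\le b\le j$; $\beta_{0i}=\beta_{i0}=\mathrm{id}$. Braided dendriform algebras. A dendriform algebra $(D,\prec,\succ)$ is a vector space with bilinear operations satisfying, with $*:=\prec+\succ$: $(x\prec y)\prec z=x\prec(y*z)$, $(x\succ y)\prec z=x\succ(y\prec z)$, $(x*y)\succ z=x\succ(y\succ z)$. A braided dendriform algebra $(D,\prec,\succ,\sigma)$ is a dendriform algebra with a braiding $\sigma$ on $D$ such that, for $\odot\in\{\prec,\succ\}$, $\sigma(\mathrm{id}\otimes\odot)=(\odot\otimes\mathrm{id})\sigma_2\sigma_1$ and $\sigma(\odot\otimes\mathrm{id})=(\mathrm{id}\otimes\odot)\sigma_1\sigma_2$. Homomorphisms are linear maps preserving $\prec,\succ$ and commuting with the braidings. Planar binary trees. $\mathcal{B}_n$ is the set of planar binary rooted trees with $n$ internal vertices (hence $n+1$ leaves), $\mathcal{B}_0=\{|\}$. The internal vertices of $Y\in\mathcal{B}_n$ are canonically ordered from left to right: the $i$-th vertex is the one located between the $i$-th and $(i+1)$-th leaves, $1\le i\le n$. Set $\mathcal{Y}(V)=\bigoplus_{n\ge0}\mathbf{k}\mathcal{B}_n\otimes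 V^{\otimes n}$, $\overline{\mathcal{Y}(V)}=\bigoplus_{n\ge1}\mathbf{k}\mathcal{B}_n\otimes V^{\otimes n}$; $Y\otimes(v_1\otimes\cdots\otimes v_n)$ is identified with the decorated tree $Y(v_1,\dots,v_n)$, whose $i$-th internal vertex is decorated by $v_i$. The grafting $Y\vee_v Y'$ is the tree whose root vertex is decorated by $v$, with left branch $Y$ and right branch $Y'$ (extended multilinearly). Operations on $\mathcal{Y}(V)$ are defined recursively: for decorated trees $Y=Y_1\vee_uY_2$ and $Y'=Y'_1\vee_vY'_2$, $$Y\prec_\sigma Y'=Y_1\vee_u(Y_2*_\sigma Y'),\qquad Y\succ_\sigma Y'=(Y*_\sigma Y_1')\vee_vY_2',$$ where $*_\sigma=\prec_\sigma+\succ_\sigma$ on $\overline{\mathcal{Y}(V)}$ and $|$ is a two-sided unit for $*_\sigma$; moreover, for $Y\ne|$, $Y\prec_\sigma|=Y$, $|\prec_\sigma Y=0$, $Y\succ_\sigma|=0$, $|\succ_\sigma Y=Y$. The braiding is $\sigma_{BT}(Y(v_1,\dots,v_m)\otimes Y'(v_{m+1},\dots,v_{m+n}))=(Y'\otimes Y)\beta_{mn}(v_1\otimes\cdots\otimes v_{m+n})$, where $(Y'\otimes Y)$ applied to an element of $V^{\otimes n}\otimes V^{\otimes m}$ means decorating $Y'$ by the first $n$ tensor factors and $Y$ by the last $m$ (for $m=0$ or $n=0$ it is the flip with $|$). *)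

(* Defs.v *)
From HB Require Import structures.
From mathcomp Require Import all_boot all_fingroup all_algebra.
From mathcomp Require Import boolp.
From mathcomp Require Import zify.

Set Implicit Arguments.
Unset Strict Implicit.
Unset Printing Implicit Defensive.

Import GRing.Theory.
Local Open Scope ring_scope.
Local Open Scope quotient_scope.
Local Notation repr := generic_quotient.repr.

Lemma linear_eq_on (k : fieldType) (M P : lmodType k) (f : M -> P) :
  linear f -> [/\ f 0 = 0, {morph f : x y / x + y}
    & forall a, {morph f : x / a *: x}].
Proof.
move=> lf; pose f' : {linear M -> P} :=
  HB.pack f (GRing.isLinear.Build _ _ _ _ f lf).
by split; [exact: (linear0 f') | exact: (linearD f') | exact: (linearZ_LR f')].
Qed.

Lemma linear_sum_on (k : fieldType) (M P : lmodType k) (f : M -> P) :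
  linear f -> forall (I : Type) (r : seq I) (F : I -> M),
  f (\sum_(i <- r) F i) = \sum_(i <- r) f (F i).
Proof.
move=> /linear_eq_on[f0 fD _] I r F.
by elim: r => [|i r IH]; rewrite ?big_nil // !big_cons fD IH.
Qed.

Section DirectSum.
Variables (k : fieldType) (I : choiceType) (M : I -> lmodType k).

(* Direct sum: the families of finite support. *)
Record dirsum := DirSum {
  ds_val :> forall i, M i;
  ds_finsupp : exists s : seq I, forall i, i \notin s -> ds_val i = 0 }.

Lemma dirsumP (x y : dirsum) : (forall i, x i = y i) -> x = y.
Proof.
case: x y => [x hx] [y hy] /= xy; have {xy} exy : x = y by apply: functional_extensionality_dep.
by subst y; congr DirSum; exact: Prop_irrelevance.
Qed.

HB.instance Definition _ := gen_eqMixin dirsum.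
HB.instance Definition _ := gen_choiceMixin dirsum.

Let zero_fin : exists s : seq I, forall i, i \notin s -> (0 : M i) = 0.
Proof. by exists [::]. Qed.
Definition ds_zero := DirSum zero_fin.

Let opp_fin (x : dirsum) :
  exists s : seq I, forall i, i \notin s -> - x i = 0.
Proof. by have [s xs] := ds_finsupp x; exists s => i /xs ->; rewrite oppr0. Qed.
Definition ds_opp x := DirSum (opp_fin x).

Let add_fin (x y : dirsum) :
  exists s : seq I, forall i, i \notin s -> x i + y i = 0.
Proof.
have [s xs] := ds_finsupp x; have [t yt] := ds_finsupp y; exists (s ++ t) => i.
by rewrite mem_cat negb_or => /andP[/xs -> /yt ->]; rewrite addr0.
Qed.
Definition ds_add x y := DirSum (add_fin x y).

Let scale_fin a (x : dirsum) :
  exists s : seq I, forall i, i \notin s -> a *: x i = 0.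
Proof. by have [s xs] := ds_finsupp x; exists s => i /xs ->; rewrite scaler0. Qed.
Definition ds_scale a x := DirSum (scale_fin a x).

Let ds_addA : associative ds_add.
Proof. by move=> x y z; apply: dirsumP => i /=; rewrite addrA. Qed.
Let ds_addC : commutative ds_add.
Proof. by move=> x y; apply: dirsumP => i /=; rewrite addrC. Qed.
Let ds_add0 : left_id ds_zero ds_add.
Proof. by move=> x; apply: dirsumP => i /=; rewrite add0r. Qed.
Let ds_addN : left_inverse ds_zero ds_opp ds_add.
Proof. by move=> x; apply: dirsumP => i /=; rewrite addNr. Qed.
HB.instance Definition _ :=
  GRing.isZmodule.Build dirsum ds_addA ds_addC ds_add0 ds_addN.

Let ds_scaleA a b x : ds_scale a (ds_scale b x) = ds_scale (a * b) x.
Proof. by apply: dirsumP => i /=; rewrite scalerA. Qed.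
Let ds_scale1 : left_id 1 ds_scale.
Proof. by move=> x; apply: dirsumP => i /=; rewrite scale1r. Qed.
Let ds_scaleDr : right_distributive ds_scale +%R.
Proof. by move=> a x y; apply: dirsumP => i /=; rewrite scalerDr. Qed.
Let ds_scaleDl x : {morph ds_scale^~ x : a b / a + b}.
Proof. by move=> a b; apply: dirsumP => i /=; rewrite scalerDl. Qed.
HB.instance Definition _ :=
  GRing.Zmodule_isLmodule.Build k dirsum ds_scaleA ds_scale1 ds_scaleDr ds_scaleDl.

Lemma ds_sumE (J : Type) (r : seq J) (F : J -> dirsum) i :
  (\sum_(j <- r) F j : dirsum) i = \sum_(j <- r) F j i.
Proof. by elim: r => [|j r IH]; rewrite ?big_nil // !big_cons -IH. Qed.

Definition din_val i (x : M i) : forall j, M j :=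
  fun j => if @eqP _ i j is ReflectT e then ecast j (M j) e x else 0.

Lemma din_valE i (x : M i) : din_val x i = x.
Proof. by rewrite /din_val; case: eqP => // e; rewrite eq_axiomK. Qed.

Lemma din_valN i j (x : M i) : i != j -> din_val x j = 0.
Proof. by rewrite /din_val; case: eqP. Qed.

Let din_fin i (x : M i) :
  exists s : seq I, forall j, j \notin s -> din_val x j = 0.
Proof. by exists [:: i] => j; rewrite inE eq_sym => /din_valN ->. Qed.
Definition din i (x : M i) : dirsum := DirSum (din_fin x).

Lemma dinE i (x : M i) : din x i = x. Proof. exact: din_valE. Qed.
Lemma dinN i j (x : M i) : i != j -> din x j = 0. Proof. exact: din_valN. Qed.

Let din_linear i : linear (@din i).
Proof.
move=> a x y; apply: dirsumP => j; have [<-|ij] := eqVneq i j.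
  by rewrite -[RHS]/(a *: din x i + din y i) !dinE.
by rewrite -[RHS]/(a *: din x j + din y j) !dinN // scaler0 addr0.
Qed.
HB.instance Definition _ i :=
  GRing.isLinear.Build k (M i) dirsum *:%R (@din i) (@din_linear i).

Definition ds_supp (x : dirsum) : seq I :=
  undup [seq i <- sval (cid (ds_finsupp x)) | x i != 0].

Lemma mem_ds_supp x i : (i \in ds_supp x) = (x i != 0).
Proof.
rewrite mem_undup mem_filter; case: cid => s xs /=.
by have [//|xi0] := boolP (x i == 0); apply: contraNT xi0 => /xs ->.
Qed.

Lemma ds_sum_widen (P : lmodType k) (f : forall i, M i -> P) x (s : seq I) :
  (forall i, f i 0 = 0) -> uniq s -> {subset ds_supp x <= s} ->
  \sum_(i <- ds_supp x) f i (x i) = \sum_(i <- s) f i (x i).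
Proof.
move=> f0 us xs; rewrite [RHS](bigID (mem (ds_supp x))) /= [X in _ + X]big1 ?addr0.
  rewrite -[RHS]big_filter; apply/perm_big/uniq_perm.
  - exact: undup_uniq.
  - exact: filter_uniq.
  - move=> i; rewrite mem_filter; have [/xs ->|] := boolP (i \in ds_supp x) => //.
by move=> i; rewrite mem_ds_supp negbK => /eqP ->.
Qed.

Lemma ds_sum_din x : x = \sum_(i <- ds_supp x) din (x i).
Proof.
apply: dirsumP => j; rewrite ds_sumE.
have [jx|] := boolP (j \in ds_supp x).
  rewrite (bigD1_seq j) ?undup_uniq //= din_valE big1 ?addr0 // => i ij.
  by rewrite din_valN.
rewrite mem_ds_supp negbK => /eqP xj; rewrite xj big1 // => i _.
by have [<-|ij] := eqVneq j i; rewrite ?dinE // dinN // eq_sym.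
Qed.

Variable P : lmodType k.

Definition dlift (f : forall i, M i -> P) (x : dirsum) : P :=
  \sum_(i <- ds_supp x) f i (x i).

Lemma dlift_linear f : (forall i, linear (f i)) -> linear (dlift f).
Proof.
move=> lf a x y; have f0 i : f i 0 = 0 by have [] := linear_eq_on (lf i).
pose s := undup (ds_supp x ++ ds_supp y ++ ds_supp (a *: x + y)).
rewrite /dlift !(@ds_sum_widen _ _ _ s) ?undup_uniq //; first last.
- by move=> i xi; rewrite /s mem_undup !mem_cat xi ?orbT.
- by move=> i xi; rewrite /s mem_undup !mem_cat xi ?orbT.
- by move=> i xi; rewrite /s mem_undup !mem_cat xi ?orbT.
by rewrite scaler_sumr -big_split; apply: eq_bigr => i _; exact: lf.
Qed.

Lemma dlift_din f i x : (forall i, linear (f i)) -> dlift f (@din i x) = f i x.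
Proof.
move=> lf; have f0 j : f j 0 = 0 by have [] := linear_eq_on (lf j).
rewrite /dlift (@ds_sum_widen _ _ _ [:: i]) // ?big_seq1 ?dinE // => j.
by rewrite mem_ds_supp inE; apply: contraNT => ji; rewrite dinN // eq_sym.
Qed.

Lemma dirsum_ext (f g : dirsum -> P) : linear f -> linear g ->
  (forall i x, f (@din i x) = g (@din i x)) -> f =1 g.
Proof.
move=> lf lg fg x; rewrite (ds_sum_din x) !linear_sum_on //.
by apply: eq_bigr => i _; rewrite fg.
Qed.

End DirectSum.

Arguments din {k I M} i x.

Section FreeModule.
Variable k : fieldType.

Definition free (S : choiceType) := dirsum (fun _ : S => k^o : lmodType k).
HB.instance Definition _ S := GRing.Lmodule.on (free S).

Definition fgen (S : choiceType) (s : S) : free S :=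
  din (M := fun _ : S => k^o) s (1 : k).

(* [flift], [dlift] and [tlift] extend a map by linearity through a chosen
   representation of their argument; they have the expected universal property
   when the map is (bi)linear. *)
Definition flift (S : choiceType) (P : lmodType k) (f : S -> P) : free S -> P :=
  dlift (fun s (a : k^o) => a *: f s).

Lemma flift_linear (S : choiceType) (P : lmodType k) (f : S -> P) :
  linear (flift f).
Proof. by apply: dlift_linear => s a b c; rewrite scalerDl scalerA. Qed.
HB.instance Definition _ (S : choiceType) (P : lmodType k) (f : S -> P) :=
  GRing.isLinear.Build k (free S) P *:%R (flift f) (flift_linear f).

Lemma flift_gen (S : choiceType) (P : lmodType k) (f : S -> P) s :
  flift f (fgen s) = f s.
Proof.
by rewrite /flift dlift_din ?scale1r // => t a b c; rewrite scalerDl scalerA.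
Qed.

Lemma free_ext (S : choiceType) (P : lmodType k) (f g : free S -> P) :
  linear f -> linear g -> (forall s, f (fgen s) = g (fgen s)) -> f =1 g.
Proof.
move=> lf lg fg; apply: dirsum_ext => // s a.
have -> : din s a = a *: fgen s :> free S.
  by rewrite /fgen -linearZ /= /GRing.scale /= mulr1.
by have [_ _ ->] := linear_eq_on lf; have [_ _ ->] := linear_eq_on lg; rewrite fg.
Qed.

End FreeModule.

Notation bilin f := (bilinear_for (GRing.Scale.Law.clone _ _ *:%R _)
  (GRing.Scale.Law.clone _ _ *:%R _) f).

Section Tensor.
Variables (k : fieldType) (V W : lmodType k).

Local Notation F := (free k (V * W)%type).
Local Notation "[< v , w >]" := (fgen k (v, w) : F).

(* The tensor product is the quotient of the free module on [V * W] by the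
   submodule [trel] generated by the bilinearity relations. *)
Inductive trel : F -> Prop :=
| trel0 : trel 0
| trelP a x y : trel x -> trel y -> trel (a *: x + y)
| trelL a v v' w :
    trel ([< a *: v + v', w >] - (a *: [< v, w >] + [< v', w >]))
| trelR a v w w' :
    trel ([< v, a *: w + w' >] - (a *: [< v, w >] + [< v, w' >])).

Let trelZ a x : trel x -> trel (a *: x).
Proof. by move=> xr; rewrite -[_ *: _]addr0; apply: trelP => //; exact: trel0. Qed.

Let trelD x y : trel x -> trel y -> trel (x + y).
Proof. by move=> xr yr; rewrite -[x]scale1r; apply: trelP. Qed.

Definition teq (x y : F) := `[< trel (x - y) >].

Let teq_equiv : equiv_class_of teq.
Proof.
split.
- by move=> x; apply/asboolP; rewrite subrr; exact: trel0.
- move=> x y; apply/asboolP/asboolP => /(trelZ (-1)); rewrite scaleN1r opprB //.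
- move=> y x z /asboolP xy /asboolP yz; apply/asboolP.
  by rewrite -(subrK y x) -addrA; apply: trelD.
Qed.

Canonical teq_equivRel := EquivRelPack teq_equiv.

Definition tensor := {eq_quot teq}.
HB.instance Definition _ := Choice.on tensor.
HB.instance Definition _ := EqQuotient.on tensor.

Lemma teqP (x y : F) : reflect (trel (x - y)) (x == y %[mod tensor]).
Proof. by rewrite piE; exact: asboolP. Qed.

Definition t_lin a (x y : tensor) : tensor := \pi_tensor (a *: repr x + repr y).

Lemma t_lin_pi a x y :
  t_lin a (\pi_tensor x) (\pi_tensor y) = \pi_tensor (a *: x + y).
Proof.
have rK z : trel (repr (\pi_tensor z) - z) by apply/teqP; rewrite reprK.
apply/eqP/teqP; rewrite opprD addrACA -scalerBr; exact: trelP.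
Qed.

Definition t_zero : tensor := \pi_tensor 0.
Definition t_add x y := t_lin 1 x y.
Definition t_scale a x := t_lin a x t_zero.
Definition t_opp x := t_scale (-1) x.

Let t_addpi x y : t_add (\pi_tensor x) (\pi_tensor y) = \pi_tensor (x + y).
Proof. by rewrite /t_add t_lin_pi scale1r. Qed.
Let t_scalepi a x : t_scale a (\pi_tensor x) = \pi_tensor (a *: x).
Proof. by rewrite /t_scale t_lin_pi addr0. Qed.
Let t_opppi x : t_opp (\pi_tensor x) = \pi_tensor (- x).
Proof. by rewrite /t_opp t_scalepi scaleN1r. Qed.

Let t_addA : associative t_add.
Proof.
elim/quotW=> x; elim/quotW=> y; elim/quotW=> z.
by rewrite (t_addpi y z) (t_addpi x y) !t_addpi addrA.
Qed.
Let t_addC : commutative t_add.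
Proof. by elim/quotW=> x; elim/quotW=> y; rewrite !t_addpi addrC. Qed.
Let t_add0 : left_id t_zero t_add.
Proof. by elim/quotW=> x; rewrite !t_addpi add0r. Qed.
Let t_addN : left_inverse t_zero t_opp t_add.
Proof. by elim/quotW=> x; rewrite t_opppi t_addpi addNr. Qed.
HB.instance Definition _ :=
  GRing.isZmodule.Build tensor t_addA t_addC t_add0 t_addN.

Let t_scaleA a b x : t_scale a (t_scale b x) = t_scale (a * b) x.
Proof. by elim/quotW: x => x; rewrite (t_scalepi b x) !t_scalepi scalerA. Qed.
Let t_scale1 : left_id 1 t_scale.
Proof. by elim/quotW=> x; rewrite t_scalepi scale1r. Qed.
Let t_scaleDr : right_distributive t_scale +%R.
Proof.
move=> a; elim/quotW=> x; elim/quotW=> y.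
change (t_scale a (t_add (\pi_tensor x) (\pi_tensor y)) =
  t_add (t_scale a (\pi_tensor x)) (t_scale a (\pi_tensor y))).
by rewrite t_addpi !t_scalepi t_addpi scalerDr.
Qed.
Let t_scaleDl x : {morph t_scale^~ x : a b / a + b}.
Proof.
move=> a b; elim/quotW: x => x; rewrite -[RHS]/(t_add _ _) !t_scalepi t_addpi.
by rewrite scalerDl.
Qed.
HB.instance Definition _ := GRing.Zmodule_isLmodule.Build k tensor
  t_scaleA t_scale1 t_scaleDr t_scaleDl.

Lemma tpi_linear : linear (\pi_tensor : F -> tensor).
Proof.
move=> a x y; by rewrite -[RHS]/(t_add (t_scale a _) _) t_scalepi t_addpi.
Qed.

Definition tpure (v : V) (w : W) : tensor := \pi_tensor [< v, w >].

Lemma tpure_linearl w : linear (tpure^~ w).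
Proof. by move=> a v v'; rewrite -tpi_linear; apply/eqP/teqP; exact: trelL. Qed.

Lemma tpure_linearr v : linear (tpure v).
Proof. by move=> a w w'; rewrite -tpi_linear; apply/eqP/teqP; exact: trelR. Qed.

Lemma tpure_bilin : bilin tpure.
Proof. by split; [exact: tpure_linearl | exact: tpure_linearr]. Qed.

HB.instance Definition _ :=
  bilinear_isBilinear.Build k V W tensor _ _ tpure tpure_bilin.

Lemma tensor_ext (P : lmodType k) (f g : tensor -> P) : linear f -> linear g ->
  (forall v w, f (tpure v w) = g (tpure v w)) -> f =1 g.
Proof.
move=> lf lg fg t; rewrite -[t]reprK.
apply: (@free_ext _ _ _ (f \o \pi_tensor) (g \o \pi_tensor)) => [|| [v w]].
- by move=> a x y /=; rewrite tpi_linear lf.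
- by move=> a x y /=; rewrite tpi_linear lg.
- exact: fg.
Qed.

Variable P : lmodType k.
Implicit Type f : V -> W -> P.

Definition tlift f (t : tensor) : P := flift (fun p => f p.1 p.2) (repr t).

Lemma tlift_pi f x : bilin f -> tlift f (\pi x) = flift (fun p => f p.1 p.2) x.
Proof.
move=> [fl fr]; have : trel (repr (\pi_tensor x) - x) by apply/teqP; rewrite reprK.
move=> xr; apply/eqP; rewrite -subr_eq0 /tlift -linearB /=; apply/eqP.
elim: xr => {x} [|a x y _ xr _ yr|a v v' w|a v w w'].
- by rewrite linear0.
- by rewrite linearP /= xr yr scaler0 addr0.
- by rewrite linearB linearP /= !flift_gen /= fl subrr.
- by rewrite linearB linearP /= !flift_gen /= fr subrr.
Qed.

Lemma tlift_linear f : bilin f -> linear (tlift f).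
Proof.
move=> bf a; elim/quotW=> x; elim/quotW=> y.
by rewrite -tpi_linear !tlift_pi // linearP.
Qed.

Lemma tlift_pure f v w : bilin f -> tlift f (tpure v w) = f v w.
Proof. by move=> bf; rewrite tlift_pi // flift_gen. Qed.

End Tensor.

Lemma dlift_param (k : fieldType) (A P : lmodType k) (I : choiceType)
    (M : I -> lmodType k) (f : A -> forall i, M i -> P) x :
  (forall i y, linear (fun a => f a i y)) -> linear (fun a => dlift (f a) x).
Proof.
move=> lf a u v; rewrite /dlift scaler_sumr -big_split.
by apply: eq_bigr => i _; exact: lf.
Qed.

Lemma flift_param (k : fieldType) (A P : lmodType k) (S : choiceType)
    (f : A -> S -> P) x :
  (forall s, linear (fun a => f a s)) -> linear (fun a => flift (f a) x).
Proof.
move=> lf; apply: dlift_param => s b a u v.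
by rewrite lf scalerDr !scalerA mulrC.
Qed.

Lemma tlift_param (k : fieldType) (A V W P : lmodType k) (f : A -> V -> W -> P) t :
  (forall v w, linear (fun a => f a v w)) -> linear (fun a => tlift (f a) t).
Proof. by move=> lf; apply: flift_param => p; exact: lf. Qed.

Notation "V ⊗ W" := (tensor V W) (at level 40, left associativity) : ring_scope.
Notation "v ⊗ₜ w" := (tpure v w) (at level 40, left associativity) : ring_scope.

Section TensorMaps.
Variable k : fieldType.

Lemma linear_comp_on (U V W : lmodType k) (f : V -> W) (g : U -> V) :
  linear f -> linear g -> linear (fun x => f (g x)).
Proof. by move=> lf lg a x y; rewrite lg lf. Qed.

Lemma linear_on (U V : lmodType k) (f : {linear U -> V}) : linear f.
Proof. by move=> a x y; rewrite linearP. Qed.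

Definition tmap (U U' V V' : lmodType k) (f : U -> U') (g : V -> V') :
  U ⊗ V -> U' ⊗ V' := tlift (fun u v => f u ⊗ₜ g v).

Section TmapLinear.
Variables (U U' V V' : lmodType k) (f : U -> U') (g : V -> V').
Hypotheses (lf : linear f) (lg : linear g).

Let tmap_bilin : bilin (fun u v => f u ⊗ₜ g v).
Proof.
split=> [v|u] a x y.
- by rewrite lf tpure_linearl.
- by rewrite lg tpure_linearr.
Qed.

Lemma tmap_linear : linear (tmap f g). Proof. exact: tlift_linear. Qed.
Lemma tmapE u v : tmap f g (u ⊗ₜ v) = f u ⊗ₜ g v. Proof. exact: tlift_pure. Qed.
End TmapLinear.

HB.instance Definition _ (U U' V V' : lmodType k)
    (f : {linear U -> U'}) (g : {linear V -> V'}) :=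
  GRing.isLinear.Build k (U ⊗ V) (U' ⊗ V') *:%R (tmap f g)
    (tmap_linear (linear_on f) (linear_on g)).

Definition tassoc (U V W : lmodType k) : (U ⊗ V) ⊗ W -> U ⊗ (V ⊗ W) :=
  tlift (fun t w => tlift (fun u v => u ⊗ₜ (v ⊗ₜ w)) t).

Definition tunassoc (U V W : lmodType k) : U ⊗ (V ⊗ W) -> (U ⊗ V) ⊗ W :=
  tlift (fun u t => tlift (fun v w => (u ⊗ₜ v) ⊗ₜ w) t).

Section Assoc.
Variables (U V W : lmodType k).

Let bilin_a (w : W) : bilin (fun (u : U) (v : V) => u ⊗ₜ (v ⊗ₜ w)).
Proof.
by split=> [v|u] a x y; rewrite tpure_linearl // tpure_linearr.
Qed.
Let bilin_u (u : U) : bilin (fun (v : V) (w : W) => (u ⊗ₜ v) ⊗ₜ w).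
Proof.
by split=> [w|v] a x y; rewrite tpure_linearr // tpure_linearl.
Qed.
Let bilin_A : bilin (fun (t : U ⊗ V) (w : W) => tlift (fun u v => u ⊗ₜ (v ⊗ₜ w)) t).
Proof.
split=> [w|t]; first exact: tlift_linear.
by apply: tlift_param => u v a x y; rewrite !tpure_linearr.
Qed.
Let bilin_U : bilin (fun (u : U) (t : V ⊗ W) => tlift (fun v w => (u ⊗ₜ v) ⊗ₜ w) t).
Proof.
split=> [t|u]; last exact: tlift_linear.
by apply: tlift_param => v w a x y; rewrite !tpure_linearl.
Qed.

HB.instance Definition _ := GRing.isLinear.Build k ((U ⊗ V) ⊗ W) (U ⊗ (V ⊗ W))
  *:%R (@tassoc U V W) (tlift_linear bilin_A).
HB.instance Definition _ := GRing.isLinear.Build k (U ⊗ (V ⊗ W)) ((U ⊗ V) ⊗ W)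
  *:%R (@tunassoc U V W) (tlift_linear bilin_U).

Lemma tassocE (u : U) (v : V) (w : W) : tassoc ((u ⊗ₜ v) ⊗ₜ w) = u ⊗ₜ (v ⊗ₜ w).
Proof. by rewrite /tassoc tlift_pure // tlift_pure. Qed.
Lemma tunassocE (u : U) (v : V) (w : W) : tunassoc (u ⊗ₜ (v ⊗ₜ w)) = (u ⊗ₜ v) ⊗ₜ w.
Proof. by rewrite /tunassoc tlift_pure // tlift_pure. Qed.
End Assoc.

End TensorMaps.

Section Braidings.
Variable k : fieldType.

Section OneSpace.
Variables (V : lmodType k) (s : V ⊗ V -> V ⊗ V).

(* The operators [s_1] and [s_2] on the third tensor power, the latter being
   bracketed to the left. *)
Definition brd1 : (V ⊗ V) ⊗ V -> (V ⊗ V) ⊗ V := tmap s idfun.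
Definition brd2 (t : (V ⊗ V) ⊗ V) : (V ⊗ V) ⊗ V :=
  tunassoc (tmap idfun s (tassoc t)).

Definition is_braiding := forall t, brd1 (brd2 (brd1 t)) = brd2 (brd1 (brd2 t)).
End OneSpace.

Definition is_braided_hom (V V' : lmodType k) (s : V ⊗ V -> V ⊗ V)
    (s' : V' ⊗ V' -> V' ⊗ V') (f : V -> V') :=
  forall t, tmap f f (s t) = s' (tmap f f t).

Section Dendriform.
Variable D : lmodType k.
Implicit Types (p s op : D -> D -> D) (tau : D ⊗ D -> D ⊗ D).

Definition is_dendriform p s :=
  [/\ forall x y z, p (p x y) z = p x (p y z + s y z),
      forall x y z, p (s x y) z = s x (p y z) &
      forall x y z, s (p x y + s x y) z = s x (s y z)].

(* [id ⊗ op], [op ⊗ id], [s_1] and [s_2] act on the third tensor power, so the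
   two identities are written on [(D ⊗ D) ⊗ D] with explicit reassociations. *)
Definition braid_compat tau op :=
  let m := tlift op in
  (forall t, tau (tmap idfun m (tassoc t)) = tmap m idfun (brd2 tau (brd1 tau t)))
  /\
  (forall t, tau (tmap m idfun t) = tmap idfun m (tassoc (brd1 tau (brd2 tau t)))).

Definition is_braided_dendriform (p s : {bilinear D -> D -> D})
    (tau : {linear D ⊗ D -> D ⊗ D}) :=
  [/\ is_dendriform p s, is_braiding tau, braid_compat tau p & braid_compat tau s].
End Dendriform.

Definition is_braided_dendriform_hom (D D' : lmodType k)
    (p s : D -> D -> D) (tau : D ⊗ D -> D ⊗ D)
    (p' s' : D' -> D' -> D') (tau' : D' ⊗ D' -> D' ⊗ D') (f : D -> D') :=
  [/\ {morph f : x y / p x y >-> p' x y}, {morph f : x y / s x y >-> s' x y} &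
      is_braided_hom tau tau' f].
End Braidings.

Section ReducedWords.
Variable n : nat.
Implicit Types (w : 'S_n) (i : nat) (r : seq nat).

(* [adj_perm i] is the simple transposition exchanging the (0-based) positions
   [i] and [i.+1]; it is the identity unless [i.+1 < n]. *)
Definition adj_perm i : 'S_n :=
  if (insub i, insub i.+1) is (Some a, Some b) then tperm a b else 1%g.

(* [i_1 ... i_l] |-> s_(i_1) o ... o s_(i_l), as a composition of functions:
   the product of permutations in the library is in diagrammatic order. *)
Definition word_perm r : 'S_n := foldr (fun i w => (w * adj_perm i)%g) 1%g r.

Definition is_word r := all (fun i => i.+1 < n)%N r.

Definition is_reduced_expr r w :=
  [/\ is_word r, word_perm r = w &
      forall r', is_word r' -> word_perm r' = w -> (size r <= size r')%N].

Definition ldescent w i :=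
  if (insub i, insub i.+1) is (Some a, Some b) then ((w^-1)%g b < (w^-1)%g a)%N
  else false.

(* A reduced expression of [w], obtained by stripping off leftmost letters. *)
Fixpoint red_word_rec (fuel : nat) w : seq nat :=
  if fuel is f.+1 then
    let i := find (ldescent w) (iota 0 n) in
    if (i < n)%N then i :: red_word_rec f (w * adj_perm i)%g else [::]
  else [::].

Definition red_word w := red_word_rec (n * n) w.

End ReducedWords.

Section ReducedWordsTheory.
Variable n : nat.
Implicit Types (w : 'S_n) (i : nat) (r : seq nat).

Let invs w : {set 'I_n * 'I_n} :=
  [set p : 'I_n * 'I_n | (p.1 < p.2)%N && ((w^-1)%g p.2 < (w^-1)%g p.1)%N].

Let adj_permP i : (i.+1 < n)%N ->
  exists a b : 'I_n, [/\ a = i :> nat, b = i.+1 :> nat, adj_perm n i = tperm a b &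
    forall w, ldescent w i = ((w^-1)%g b < (w^-1)%g a)%N].
Proof.
move=> lt_i; have lt_i' := ltnW lt_i.
exists (Ordinal lt_i'), (Ordinal lt_i); split=> //.
  by rewrite /adj_perm !insubT.
by move=> w; rewrite /ldescent !insubT.
Qed.

Let ldescent_lt w i : ldescent w i -> (i.+1 < n)%N.
Proof. by rewrite /ldescent; case: insub => // a; case: insubP. Qed.

Let invs_adj w i : (i.+1 < n)%N ->
  (#|invs (w * adj_perm n i)%g| + ldescent w i <= #|invs w| + ~~ ldescent w i)%N.
Proof.
move=> lt_i; have [a [b [ai bi -> ->]]] := adj_permP lt_i.
set s := tperm a b; have ab : (a < b)%N by rewrite ai bi.
have sK x : s (s x) = x by rewrite /s tpermK.
have uE x : ((w * s)^-1)%g x = (w^-1)%g (s x) by rewrite invMg tpermV permM.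
pose f (p : 'I_n * 'I_n) := (s p.1, s p.2).
have f_inj : injective f by move=> [x y] [x' y'] [] /perm_inj -> /perm_inj ->.
have sE x : s x = (if x == a then b else if x == b then a else x).
  by rewrite /s; case: tpermP => [->|->|/eqP/negPf -> /eqP/negPf -> //];
    rewrite ?eqxx //; case: eqP.
have s_lt (x y : 'I_n) : (x < y)%N -> (x, y) != (a, b) -> (s x < s y)%N.
  rewrite xpair_eqE !sE -!val_eqE /= ai bi.
  move=> xy; do 4?[case: ifPn] => /=; rewrite ?ai ?bi; lia.
have sub : f @: (invs (w * s)%g :\ (a, b)) \subset invs w :\ (a, b).
  apply/subsetP => _ /imsetP[[x y] + ->]; rewrite !inE /= !uE.
  move=> /and3P[ne xy uxy]; rewrite s_lt // uxy !andbT.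
  rewrite /f /= xpair_eqE; apply/negP => /andP[/eqP sa /eqP sb].
  by move: xy; rewrite -[x]sK -[y]sK sa sb /s tpermL tpermR ltnNge (ltnW ab).
have /subset_leq_card := sub; rewrite card_imset //.
rewrite (cardsD1 (a, b) (invs (w * s)%g)) (cardsD1 (a, b) (invs w)).
rewrite !inE /= !uE ab /= /s tpermL tpermR.
have : (w^-1)%g a != (w^-1)%g b.
  by apply/negP => /eqP/perm_inj e; move: ab; rewrite e ltnn.
rewrite -val_eqE /=; set u := (w^-1)%g.
move: #|_| #|_| => c d; move: (nat_of_ord (u a)) (nat_of_ord (u b)) => x y.
by case: ltngtP => //= _ _; lia.
Qed.

Let invs1 : #|invs 1%g| = 0%N.
Proof.
apply/eqP; rewrite cards_eq0; apply/eqP/setP => -[x y].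
by rewrite !inE /= invg1 !perm1; lia.
Qed.

Let word_invs r : is_word n r -> (#|invs (word_perm n r)| <= size r)%N.
Proof.
elim: r => [_|i r IH /= /andP[lt_i /IH]]; first by rewrite /= invs1.
by move: (invs_adj (word_perm n r) lt_i); case: ldescent => /=; lia.
Qed.

Let no_descent w : ~~ has (ldescent w) (iota 0 n) -> w = 1%g.
Proof.
move=> /hasPn nd; apply: invg_inj; rewrite invg1.
set u := (w^-1)%g.
have u_lt (a b : 'I_n) : b = a.+1 :> nat -> (u a < u b)%N.
  move=> ba; have lt_a : (a.+1 < n)%N by rewrite -ba.
  have := nd a; rewrite mem_iota /= ltn_ord => /(_ isT).
  have [a' [b' [ea eb _ ->]]] := adj_permP lt_a.
  have -> : a' = a by apply: val_inj.
  have -> : b' = b by apply: val_inj; rewrite /= eb ba.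
  rewrite -leqNgt leq_eqVlt => /orP[/eqP/val_inj/perm_inj e|//].
  by move: ba; rewrite e => /eqP; rewrite eqn_leq ltnn andbF.
have u_mono d (a b : 'I_n) : b = (a + d)%N :> nat -> (u a + d <= u b)%N.
  elim: d a b => [|d IH] a b ba.
    by have -> : b = a by [apply: val_inj; rewrite /= ba addn0]; rewrite addn0.
  have lt_c : (a + d < n)%N by have := ltn_ord b; rewrite ba; lia.
  have := IH a (Ordinal lt_c) erefl; have := u_lt (Ordinal lt_c) b.
  by rewrite /= ba addnS => /(_ erefl); lia.
apply/permP => a; apply: val_inj; rewrite perm1 /=; apply/eqP; rewrite eqn_leq.
have n0 : (0 < n)%N by exact: leq_ltn_trans (ltn_ord a).
have n1 : (n.-1 < n)%N by rewrite prednK.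
have := u_mono a (Ordinal n0) a erefl.
have := @u_mono (n.-1 - a)%N a (Ordinal n1).
have /= := ltn_ord (u (Ordinal n1)); have := ltn_ord a => lta ltu.
have e : n.-1 = (a + (n.-1 - a))%N by lia.
by move=> /(_ e) /=; lia.
Qed.

Let red_word_recP m w : (#|invs w| <= m)%N ->
  [/\ is_word n (red_word_rec m w), word_perm n (red_word_rec m w) = w &
      (size (red_word_rec m w) <= #|invs w|)%N].
Proof.
elim: m w => [|m IH] w le_m.
  have w1 : w = 1%g.
    apply: no_descent; apply/hasPn => i _; apply/negP => di.
    by have := invs_adj w (ldescent_lt di); rewrite di; lia.
  by rewrite w1.
rewrite /=; set i := find _ _.
have [lt_i|] := ltnP i n; last first.
  rewrite leqNgt -{1}(size_iota 0 n) -has_find => /no_descent w1.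
  by rewrite w1.
have di : ldescent w i.
  have : has (ldescent w) (iota 0 n) by rewrite has_find size_iota.
  by move=> /(nth_find 0%N); rewrite -/i nth_iota.
have lt_i' := ldescent_lt di; have := invs_adj w lt_i'; rewrite di addn1 addn0 => le_w.
have [|h1 h2 h3] := IH (w * adj_perm n i)%g; first by rewrite -ltnS (leq_trans le_w).
rewrite /= lt_i' h1 h2 -mulgA; split=> //; last exact: leq_ltn_trans h3 le_w.
have [a [b [_ _ -> _]]] := adj_permP lt_i'.
by rewrite tperm2 mulg1.
Qed.

Lemma red_wordP w : is_reduced_expr (red_word w) w.
Proof.
have [|h1 h2 h3] := @red_word_recP (n * n)%N w.
  by rewrite (leq_trans (max_card _)) // card_prod card_ord.
split=> // r wr rw; rewrite (leq_trans h3) // -rw; exact: word_invs.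
Qed.

End ReducedWordsTheory.

Section TensorPowers.
Variables (k : fieldType) (V : lmodType k).

Fixpoint tpow (n : nat) : lmodType k :=
  if n is m.+1 then (V ⊗ tpow m : lmodType k) else (k^o : lmodType k).

Fixpoint tcat2 (m n : nat) : tpow m -> tpow n -> tpow (m + n) :=
  match m return tpow m -> tpow n -> tpow (m + n) with
  | 0 => fun c y => (c : k) *: y
  | m'.+1 => fun x y => tlift (fun v x' => v ⊗ₜ tcat2 x' y) x
  end.

Lemma tcat2_bilin m n : bilin (@tcat2 m n).
Proof.
elim: m => [|m [IHl IHr]].
  split=> [y|c] a x z /=; first by rewrite scalerDl scalerA.
  by rewrite scalerDr !scalerA mulrC.
split=> [y|x].
  apply: tlift_linear; split=> [x'|v] a z t; first by rewrite tpure_linearl.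
  by rewrite [X in _ ⊗ₜ X](IHl y a) tpure_linearr.
by apply: tlift_param => v x' a z t; rewrite [X in _ ⊗ₜ X](IHr x' a) tpure_linearr.
Qed.

Lemma tcat2_cons m n v (x : tpow m) (y : tpow n) :
  @tcat2 m.+1 n (v ⊗ₜ x) y = v ⊗ₜ tcat2 x y.
Proof.
have [hl _] := @tcat2_bilin m n.
rewrite /= tlift_pure //; split=> [x'|u] a z t; first by rewrite tpure_linearl.
by rewrite [X in _ ⊗ₜ X](hl y a) tpure_linearr.
Qed.

Definition tcat (m n : nat) : tpow m ⊗ tpow n -> tpow (m + n) :=
  tlift (@tcat2 m n).

Lemma tcat_linear m n : linear (@tcat m n).
Proof. exact/tlift_linear/tcat2_bilin. Qed.

HB.instance Definition _ m n := GRing.isLinear.Build k (tpow m ⊗ tpow n)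
  (tpow (m + n)) *:%R (@tcat m n) (@tcat_linear m n).

Lemma tcatE m n (x : tpow m) (y : tpow n) : tcat (x ⊗ₜ y) = tcat2 x y.
Proof. exact/tlift_pure/tcat2_bilin. Qed.

Fixpoint tsplit (m n : nat) : tpow (m + n) -> tpow m ⊗ tpow n :=
  match m return tpow (m + n) -> tpow m ⊗ tpow n with
  | 0 => fun y => (1 : k^o) ⊗ₜ y
  | m'.+1 => fun x : V ⊗ tpow (m' + n) =>
      tlift (fun v z => tmap (tpure v : _ -> tpow m'.+1) idfun (tsplit z)) x
  end.

Let tsplit_bilin m n : linear (@tsplit m n) ->
  bilin (fun v z => tmap (tpure v : _ -> tpow m.+1) idfun (@tsplit m n z)).
Proof.
move=> IH; split=> [z|v].
  apply: tlift_param => x y a u v.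
  by rewrite tpure_linearl tpure_linearl.
apply: linear_comp_on => //; apply: tmap_linear; first exact: tpure_linearr.
exact: linear_on.
Qed.

Lemma tsplit_linear m n : linear (@tsplit m n).
Proof.
elim: m => [|m IH]; first exact: tpure_linearr.
exact/tlift_linear/tsplit_bilin.
Qed.

HB.instance Definition _ m n := GRing.isLinear.Build k (tpow (m + n))
  (tpow m ⊗ tpow n) *:%R (@tsplit m n) (@tsplit_linear m n).

Lemma tsplit_cons m n v (z : tpow (m + n)) :
  @tsplit m.+1 n (v ⊗ₜ z) =
  tmap (tpure v : _ -> tpow m.+1) idfun (@tsplit m n z).
Proof. by rewrite /= tlift_pure //; exact/tsplit_bilin/tsplit_linear. Qed.

Lemma tsplit_cat2 m n (x : tpow m) (y : tpow n) : tsplit (tcat2 x y) = x ⊗ₜ y.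
Proof.
elim: m x => [|m IH].
  move=> c /=; rewrite -[c in RHS]mulr1 -[_ * 1]/(c *: (1 : k^o)).
  have [_ _ ->] := linear_eq_on (tpure_linearr (1 : k^o : lmodType k) (W := tpow n)).
  by have [_ _ ->] := linear_eq_on (tpure_linearl (V := k^o : lmodType k) y).
apply: tensor_ext => [||v x].
- apply: (linear_comp_on (f := @tsplit m.+1 n)); first exact: (@tsplit_linear m.+1 n).
  exact: (@tcat2_bilin m.+1 n).1.
- exact: tpure_linearl.
rewrite tcat2_cons tsplit_cons IH tmapE //; exact: tpure_linearr.
Qed.

Lemma tcatK m n : cancel (@tcat m n) (@tsplit m n).
Proof.
move=> t; move: t; apply: tensor_ext => [||x y].
- by apply: (linear_comp_on (f := @tsplit m n)); apply: linear_on.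
- by move=> a x y.
by rewrite tcatE tsplit_cat2.
Qed.

Lemma tsplitK m n : cancel (@tsplit m n) (@tcat m n).
Proof.
elim: m => [|m IH] z.
  by rewrite tcatE /= scale1r.
move: z; apply: tensor_ext => [||v z].
- by apply: (linear_comp_on (f := @tcat m.+1 n)); [exact: tcat_linear | exact: (@tsplit_linear m.+1 n)].
- by move=> a x y.
rewrite tsplit_cons -[in RHS](IH z); move: (tsplit z).
apply: tensor_ext => [||x y].
- apply: (linear_comp_on (f := @tcat m.+1 n)); first exact: tcat_linear.
  by apply: tmap_linear; [exact: tpure_linearr | exact: linear_on].
- by apply: (linear_comp_on (f := tpure v)); [exact: tpure_linearr | exact: linear_on].
rewrite tmapE; [|exact: tpure_linearr|exact: linear_on].
by rewrite !tcatE tcat2_cons.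
Qed.

Definition tcast m n (e : m = n) : tpow m -> tpow n :=
  fun x => ecast n (tpow n) e x.

Let tcast_linear m n (e : m = n) : linear (tcast e).
Proof. by case: _ / e. Qed.
HB.instance Definition _ m n (e : m = n) :=
  GRing.isLinear.Build k (tpow m) (tpow n) *:%R (tcast e) (@tcast_linear m n e).

Section Operators.
Variable s : V ⊗ V -> V ⊗ V.

(* [brd_at i] applies [s] to the tensor factors at the (0-based) positions
   [i] and [i.+1]; it is the identity unless [i.+1 < n]. *)
Fixpoint brd_at (i n : nat) {struct i} : tpow n -> tpow n :=
  match i with
  | 0 => match n return tpow n -> tpow n with
         | m.+2 => fun t => tassoc (tmap s idfun (tunassoc t))
         | _ => idfun
         end
  | i'.+1 => match n return tpow n -> tpow n with
             | m.+1 => tmap idfun (@brd_at i' m)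
             | 0 => idfun
             end
  end.

(* The operator attached to [w] through one particular reduced expression of
   [w]; for a braiding [s] every reduced expression gives the same operator. *)
Definition T_w n (w : 'S_n) (x : tpow n) : tpow n :=
  foldr (fun i y => brd_at i y) x (red_word w).

Hypothesis ls : linear s.

Lemma brd_at_linear i n : linear (@brd_at i n).
Proof.
elim: i n => [|i IH] [|n] //=; last first.
  by apply: tmap_linear; [exact: linear_on | exact: IH].
case: n => [|n] //.
apply: (linear_comp_on (f := @tassoc k _ _ _)); first exact: linear_on.
apply: (linear_comp_on (f := tmap s idfun)); last exact: linear_on.
by apply: tmap_linear => //; exact: linear_on.
Qed.

Lemma T_w_linear n (w : 'S_n) : linear (T_w w).
Proof.
rewrite /T_w; elim: (red_word w) => [|i r IH] //= a x y.
by rewrite IH brd_at_linear.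
Qed.
End Operators.

Section BlockPermutation.
Variables i j : nat.

(* 1-based: [a |-> j + a] for [a <= i] and [i + b |-> b] for [b <= j]. *)
Definition chi_fun (a : 'I_(i + j)) : 'I_(i + j) :=
  cast_ord (addnC j i)
    (match split a with inl a' => rshift j a' | inr b => lshift i b end).

Lemma chi_fun_inj : injective chi_fun.
Proof.
move=> a b /cast_ord_inj; rewrite -[a]splitK -[b]splitK.
by case: (split a) => a'; case: (split b) => b'; rewrite !unsplitK => /eqP;
  rewrite ?eq_lrshift ?eq_rlshift // => /eqP; [move/rshift_inj|move/lshift_inj] => ->.
Qed.

Definition chi : 'S_(i + j) := perm chi_fun_inj.

Lemma chiE a : chi a = (if a < i then j + a else a - i)%N :> nat.
Proof.
rewrite permE /chi_fun; case: splitP => b -> //=.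
by rewrite addKn.
Qed.
End BlockPermutation.

(* [T_w] acts on [V^{⊗(i + j)} = V^{⊗(j + i)}], whose elements are read in
   [V^{⊗j} ⊗ V^{⊗i}]. *)
Definition beta (s : V ⊗ V -> V ⊗ V) (i j : nat) (t : tpow i ⊗ tpow j) :
  tpow j ⊗ tpow i :=
  tsplit (tcast (addnC i j) (T_w s (chi i j) (tcat t))).

Lemma beta_linear (s : V ⊗ V -> V ⊗ V) i j : linear s -> linear (@beta s i j).
Proof.
move=> ls a x y; rewrite /beta linearP T_w_linear //.
by rewrite -/(tcast _ _) !linearP.
Qed.
End TensorPowers.

(* [bt n] is the set of planar binary trees with [n] internal vertices; the
   size [m + n.+1] of [Node l r] reflects the left-to-right order of its internal
   vertices: those of [l], the root, those of [r]. *)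
Inductive bt : nat -> Type :=
| Leaf : bt 0
| Node m n of bt m & bt n : bt (m + n.+1).

HB.instance Definition _ n := gen_eqMixin (bt n).
HB.instance Definition _ n := gen_choiceMixin (bt n).

Section DecoratedTrees.
Variables (k : fieldType) (V : lmodType k).
Local Notation tpow := (@tpow k V).

(* The direct sum over [n >= d] of [k B_n ⊗ V^{⊗ n}]. *)
Definition tspace (d : nat) :=
  dirsum (fun n => free k (bt (d + n)) ⊗ tpow (d + n) : lmodType k).
HB.instance Definition _ d := GRing.Lmodule.on (tspace d).

Section Lift.
Variables (d : nat) (P : lmodType k).

Definition tdec n (Y : bt (d + n)) (x : tpow (d + n)) : tspace d :=
  din (M := fun n => free k (bt (d + n)) ⊗ tpow (d + n) : lmodType k) n
    (fgen k Y ⊗ₜ x).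

Lemma tdec_linear n (Y : bt (d + n)) : linear (tdec Y).
Proof.
by move=> a x y; rewrite /tdec tpure_linearr linearP.
Qed.

Definition tdlift (f : forall n, bt (d + n) -> tpow (d + n) -> P) : tspace d -> P :=
  dlift (fun n => tlift (fun c x => flift (fun Y => f n Y x) c)).

Let tdlift_bilin (f : forall n, bt (d + n) -> tpow (d + n) -> P) n :
  (forall n Y, linear (f n Y)) ->
  bilin (fun (c : free k (bt (d + n))) x => flift (fun Y => f n Y x) c).
Proof.
move=> lf; split=> [x|c]; first exact: flift_linear.
by apply: flift_param => Y; exact: lf.
Qed.

Lemma tdlift_linear f : (forall n Y, linear (f n Y)) -> linear (tdlift f).
Proof.
by move=> lf; apply: dlift_linear => n; apply: tlift_linear; exact: tdlift_bilin.
Qed.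

Lemma tdliftE f n (Y : bt (d + n)) x : (forall n Y, linear (f n Y)) ->
  tdlift f (tdec Y x) = f n Y x.
Proof.
move=> lf; rewrite /tdlift dlift_din => [|i].
  by rewrite tlift_pure ?flift_gen //; exact: tdlift_bilin.
by apply: tlift_linear; exact: tdlift_bilin.
Qed.

Lemma tspace_ext (f g : tspace d -> P) : linear f -> linear g ->
  (forall n (Y : bt (d + n)) x, f (tdec Y x) = g (tdec Y x)) -> f =1 g.
Proof.
move=> lf lg fg; apply: dirsum_ext => // n t; move: t; apply: tensor_ext.
- apply: (linear_comp_on (f := f)) => //; exact: linear_on.
- apply: (linear_comp_on (f := g)) => //; exact: linear_on.
move=> c x; move: c; apply: free_ext => [||Y]; last exact: fg.
- move=> a c c'; rewrite tpure_linearl linearP; exact: lf.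
- move=> a c c'; rewrite tpure_linearl linearP; exact: lg.
Qed.
End Lift.

Lemma tdlift_param d (A P : lmodType k)
    (f : A -> forall n, bt (d + n) -> tpow (d + n) -> P) z :
  (forall n Y x, linear (fun a => f a n Y x)) -> linear (fun a => tdlift (f a) z).
Proof.
move=> lf; apply: dlift_param => n t; apply: tlift_param => c x.
by apply: flift_param => Y; exact: lf.
Qed.

Definition yspace := tspace 0.
Definition ybar := tspace 1.
HB.instance Definition _ := GRing.Lmodule.on yspace.
HB.instance Definition _ := GRing.Lmodule.on ybar.

Definition ytree n (Y : bt n) (x : tpow n) : yspace := @tdec 0 n Y x.
Definition ybtree n (Y : bt n.+1) (x : tpow n.+1) : ybar := @tdec 1 n Y x.

Definition ylift (P : lmodType k) (f : forall n, bt n -> tpow n -> P) : yspace -> P :=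
  @tdlift 0 P f.
Definition yblift (P : lmodType k) (f : forall n, bt n.+1 -> tpow n.+1 -> P) :
  ybar -> P := @tdlift 1 P f.

Lemma ytree_linear n (Y : bt n) : linear (ytree Y).
Proof. exact: (@tdec_linear 0 n Y). Qed.
Lemma ybtree_linear n (Y : bt n.+1) : linear (ybtree Y).
Proof. exact: (@tdec_linear 1 n Y). Qed.

(* The inclusion of [ybar] in [yspace] and the projection with kernel [k |]. *)
Definition yincl : ybar -> yspace := yblift (fun n Y x => ytree Y x).
Definition yproj : yspace -> ybar :=
  ylift (fun n => if n is m.+1 then @ybtree m else fun _ _ => 0).

(* The grafting [Y \/_v Y'], extended linearly in [Y] and [Y']. *)
Definition ygraft (z : yspace) (v : V) (z' : yspace) : yspace :=
  ylift (fun m Y x => ylift (fun n Y' x' =>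
    ytree (Node Y Y') (tcat2 x (v ⊗ₜ x' : tpow n.+1))) z') z.

(* The decoration [x] of [Node l r] is split as [x_1 ⊗ u ⊗ x_2]. *)
Definition node_lift (P : lmodType k) m n (f : tpow m -> V -> tpow n -> P) :
    tpow (m + n.+1) -> P :=
  fun x => tlift (fun x1 w => tlift (fun u x2 => f x1 u x2) w) (@tsplit k V m n.+1 x).

(* [ystar2 Y Y' x x'] is the product [Y(x) * Y'(x')]. *)
Fixpoint ystar2 m (Y : bt m) : forall n, bt n -> tpow m -> tpow n -> yspace :=
  match Y in bt m return forall n, bt n -> tpow m -> tpow n -> yspace with
  | Leaf => fun n Y' c x' => (c : k) *: ytree Y' x'
  | Node p q l r =>
    fix aux n (Y' : bt n) : tpow (p + q.+1) -> tpow n -> yspace :=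
      match Y' in bt n return tpow (p + q.+1) -> tpow n -> yspace with
      | Leaf => fun x c => (c : k) *: ytree (Node l r) x
      | Node p' q' l' r' => fun x x' =>
          node_lift (fun x1 u x2 =>
            ygraft (ytree l x1) u (ystar2 r (Node l' r') x2 x')) x
        + node_lift (fun x1' v x2' =>
            ygraft (aux p' l' x x1') v (ytree r' x2')) x'
      end
  end.

(* The value [0] at [(|, |)], where the operations are not defined, is
   a placeholder. *)
Definition yprec2 m (Y : bt m) n (Y' : bt n) : tpow m -> tpow n -> yspace :=
  match Y in bt m return tpow m -> tpow n -> yspace with
  | Leaf => fun _ _ => 0
  | Node p q l r => fun x x' =>
      node_lift (fun x1 u x2 => ygraft (ytree l x1) u (ystar2 r Y' x2 x')) x
  end.

Definition ysucc2 m (Y : bt m) n (Y' : bt n) : tpow m -> tpow n -> yspace :=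
  match Y' in bt n return tpow m -> tpow n -> yspace with
  | Leaf => fun _ _ => 0
  | Node p' q' l' r' => fun x x' =>
      node_lift (fun x1' v x2' => ygraft (ystar2 Y l' x x1') v (ytree r' x2')) x'
  end.

Definition yext2 (f : forall m, bt m -> forall n, bt n -> tpow m -> tpow n -> yspace)
    (z z' : yspace) : yspace :=
  ylift (fun m Y x => ylift (fun n Y' x' => f m Y n Y' x x') z') z.

Definition ystar := yext2 ystar2.
Definition yprec := yext2 yprec2.
Definition ysucc := yext2 ysucc2.
End DecoratedTrees.

Section TreeProducts.
Variables (k : fieldType) (V : lmodType k).
Local Notation tpow := (@tpow k V).
Local Notation yspace := (@yspace k V).
Local Notation ybar := (@ybar k V).
Implicit Types (z : yspace) (v : V).

Lemma yspace_ext (P : lmodType k) (f g : yspace -> P) : linear f -> linear g ->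
  (forall n (Y : bt n) x, f (ytree Y x) = g (ytree Y x)) -> f =1 g.
Proof. by move=> lf lg fg; apply: tspace_ext => // n Y x; exact: fg. Qed.

Lemma ybar_ext (P : lmodType k) (f g : ybar -> P) : linear f -> linear g ->
  (forall n (Y : bt n.+1) x, f (ybtree Y x) = g (ybtree Y x)) -> f =1 g.
Proof. by move=> lf lg fg; apply: tspace_ext => // n Y x; exact: fg. Qed.

Lemma yliftE (P : lmodType k) (f : forall n, bt n -> tpow n -> P) n (Y : bt n) x :
  (forall n Y, linear (f n Y)) -> ylift f (ytree Y x) = f n Y x.
Proof. exact: (@tdliftE k V 0 P f n Y x). Qed.

Lemma ybliftE (P : lmodType k) (f : forall n, bt n.+1 -> tpow n.+1 -> P)
    n (Y : bt n.+1) x :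
  (forall n Y, linear (f n Y)) -> yblift f (ybtree Y x) = f n Y x.
Proof. exact: (@tdliftE k V 1 P f n Y x). Qed.

Lemma ylift_linear (P : lmodType k) (f : forall n, bt n -> tpow n -> P) :
  (forall n Y, linear (f n Y)) -> linear (ylift f).
Proof. exact: (@tdlift_linear k V 0). Qed.

Lemma yblift_linear (P : lmodType k) (f : forall n, bt n.+1 -> tpow n.+1 -> P) :
  (forall n Y, linear (f n Y)) -> linear (yblift f).
Proof. exact: (@tdlift_linear k V 1). Qed.

Lemma ylift_param (A P : lmodType k) (f : A -> forall n, bt n -> tpow n -> P) z :
  (forall n Y x, linear (fun a => f a n Y x)) -> linear (fun a => ylift (f a) z).
Proof. exact: (@tdlift_param k V 0). Qed.

Lemma yblift_param (A P : lmodType k) (f : A -> forall n, bt n.+1 -> tpow n.+1 -> P)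
    (z : ybar) :
  (forall n Y x, linear (fun a => f a n Y x)) -> linear (fun a => yblift (f a) z).
Proof. exact: (@tdlift_param k V 1). Qed.

Lemma yincl_linear : linear (@yincl k V).
Proof. by apply: yblift_linear => n Y; exact: ytree_linear. Qed.

Lemma yinclE n (Y : bt n.+1) (x : tpow n.+1) : yincl (ybtree Y x) = ytree Y x.
Proof. by rewrite /yincl ybliftE // => m Z; exact: ytree_linear. Qed.

Lemma yproj_linear : linear (@yproj k V).
Proof.
apply: ylift_linear => -[|n] Y; last exact: ybtree_linear.
by move=> a x y; rewrite scaler0 addr0.
Qed.

Let yproj_tree_linear n : forall Y : bt n,
  linear ((if n is m.+1 return bt n -> tpow n -> ybar then @ybtree k V m
           else fun _ _ => 0) Y).
Proof.
case: n => [|n] Y; last exact: ybtree_linear.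
by move=> a x y; rewrite scaler0 addr0.
Qed.

Lemma yprojS n (Y : bt n.+1) (x : tpow n.+1) : yproj (ytree Y x) = ybtree Y x.
Proof. by rewrite /yproj yliftE. Qed.

Lemma yproj0 (Y : bt 0) (x : tpow 0) : yproj (ytree Y x) = 0.
Proof. by rewrite /yproj yliftE. Qed.

Lemma yinclK : cancel (@yincl k V) (@yproj k V).
Proof.
apply: ybar_ext => [||n Y x]; last by rewrite yinclE yprojS.
- apply: linear_comp_on; [exact: yproj_linear|exact: yincl_linear].
- by move=> a x y.
Qed.

Section Graft.
Variable v : V.

Let inner_l z' m (Y : bt m) : linear (fun x : tpow m => ylift (fun n Y' x' =>
    ytree (Node Y Y') (tcat2 x (v ⊗ₜ x' : tpow n.+1))) z').
Proof.
apply: ylift_param => n Y' x'; apply: (linear_comp_on (f := ytree _)).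
  exact: ytree_linear.
exact: (@tcat2_bilin _ _ m n.+1).1.
Qed.

Let inner_r m (Y : bt m) (x : tpow m) n (Y' : bt n) :
  linear (fun x' => ytree (Node Y Y') (tcat2 x (v ⊗ₜ x' : tpow n.+1))).
Proof.
apply: (linear_comp_on (f := ytree _)); first exact: ytree_linear.
apply: (linear_comp_on (f := @tcat2 _ _ m n.+1 x)); last exact: tpure_linearr.
exact: (@tcat2_bilin _ _ m n.+1).2.
Qed.

Lemma ygraft_linearl z' : linear (fun z => ygraft z v z').
Proof. by apply: ylift_linear => m Y; exact: inner_l. Qed.

Lemma ygraft_linearr z : linear (ygraft z v).
Proof. by apply: ylift_param => m Y x; apply: ylift_linear => n Y'; exact: inner_r. Qed.

Lemma ygraftE m (Y : bt m) x n (Y' : bt n) x' :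
  ygraft (ytree Y x) v (ytree Y' x') =
  ytree (Node Y Y') (tcat2 x (v ⊗ₜ x' : tpow n.+1)).
Proof. by rewrite /ygraft yliftE // yliftE. Qed.
End Graft.

Lemma ygraft_linear z z' : linear (fun v => ygraft z v z').
Proof.
apply: ylift_param => m Y x; apply: ylift_param => n Y' x'.
apply: (linear_comp_on (f := ytree _)); first exact: ytree_linear.
apply: (linear_comp_on (f := @tcat2 _ _ m n.+1 x)).
  exact: (@tcat2_bilin _ _ m n.+1).2.
exact: tpure_linearl.
Qed.

Section NodeLift.
Variables (P : lmodType k) (m n : nat).
Implicit Type f : tpow m -> V -> tpow n -> P.

Definition trilinear f :=
  [/\ forall u y, linear (fun x => f x u y), forall x y, linear (fun u => f x u y)
    & forall x u, linear (f x u)].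

Let node_bilin f : trilinear f ->
  bilin (fun x1 (w : tpow n.+1) => tlift (fun u x2 => f x1 u x2) w).
Proof.
move=> [f1 f2 f3]; split=> [w|x1].
- by apply: tlift_param => u x2; exact: f1.
- by apply: tlift_linear; split=> [x2|u]; [exact: f2|exact: f3].
Qed.

Lemma node_lift_linear f : trilinear f -> linear (node_lift f).
Proof.
move=> tf; apply: (linear_comp_on (f := tlift _)).
  exact/tlift_linear/node_bilin.
exact: (@tsplit_linear _ _ m n.+1).
Qed.

Lemma node_liftE f x1 u x2 : trilinear f ->
  node_lift f (@tcat2 _ _ m n.+1 x1 (u ⊗ₜ x2)) = f x1 u x2.
Proof.
move=> tf; rewrite /node_lift tsplit_cat2 tlift_pure; last exact: node_bilin.
by case: tf => f1 f2 f3; rewrite tlift_pure.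
Qed.

Lemma node_lift_param (A : lmodType k) (f : A -> tpow m -> V -> tpow n -> P) x :
  (forall x1 u x2, linear (fun a => f a x1 u x2)) ->
  linear (fun a => node_lift (f a) x).
Proof.
by move=> lf; apply: tlift_param => x1 w; apply: tlift_param => u x2; exact: lf.
Qed.
End NodeLift.

Let linear_add (A B : lmodType k) (f g : A -> B) :
  linear f -> linear g -> linear (fun x => f x + g x).
Proof.
by move=> lf lg a x y; rewrite lf lg scalerDr addrACA.
Qed.

Let linear_scale (A B : lmodType k) (f : A -> B) (c : k) :
  linear f -> linear (fun x => c *: f x).
Proof. by move=> lf a x y; rewrite lf scalerDr !scalerA mulrC. Qed.

Let linear_scale0 (B : lmodType k) (b : B) :
  linear (fun c : k^o => (c : k) *: b).
Proof. by move=> a x y; rewrite scalerDl scalerA. Qed.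

Let trilin_l p q (l : bt p) (g : tpow q -> yspace) : linear g ->
  trilinear (fun x1 u x2 => ygraft (ytree l x1) u (g x2)).
Proof.
move=> lg; split=> [u y|x y|x u].
- by apply: (linear_comp_on (f := fun z => ygraft z u _));
    [exact: ygraft_linearl|exact: ytree_linear].
- exact: ygraft_linear.
- by apply: (linear_comp_on (f := ygraft _ u)); first exact: ygraft_linearr.
Qed.

Let trilin_r p q (r : bt q) (g : tpow p -> yspace) : linear g ->
  trilinear (fun x1 u x2 => ygraft (g x1) u (ytree r x2)).
Proof.
move=> lg; split=> [u y|x y|x u].
- by apply: (linear_comp_on (f := fun z => ygraft z u _)); first exact: ygraft_linearl.
- exact: ygraft_linear.
- by apply: (linear_comp_on (f := ygraft _ u)); [exact: ygraft_linearr|exact: ytree_linear].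
Qed.

Definition bilin2 m n (f : tpow m -> tpow n -> yspace) :=
  (forall x', linear (fun x => f x x')) /\ (forall x, linear (f x)).

Lemma ystar2_bilin m (Y : bt m) n (Y' : bt n) : bilin2 (ystar2 Y Y').
Proof.
elim: Y n Y' => {m} [|p q l _ r IHr] n Y'.
  split=> [x'|c] /=; first exact: linear_scale0.
  by apply: linear_scale; exact: ytree_linear.
elim: Y' => {n} [|p' q' l' [IHl1 IHl2] r' _].
  split=> [c|x] /=; last exact: linear_scale0.
  by apply: linear_scale; exact: ytree_linear.
have [IHr1 IHr2] := IHr _ (Node l' r').
split=> [x'|x].
- apply: linear_add.
  + by apply: node_lift_linear; apply: trilin_l; exact: IHr1.
  + apply: node_lift_param => x1 u x2.
    by apply: (linear_comp_on (f := fun z => ygraft z u _));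
      [exact: ygraft_linearl | exact: IHl1].
- apply: linear_add.
  + apply: node_lift_param => x1 u x2.
    by apply: (linear_comp_on (f := ygraft _ u));
      [exact: ygraft_linearr | exact: IHr2].
  + by apply: node_lift_linear; apply: trilin_r; exact: IHl2.
Qed.

Lemma yprec2_bilin m (Y : bt m) n (Y' : bt n) : bilin2 (yprec2 Y Y').
Proof.
case: Y => {m} [|p q l r]; first by split=> ? a x y; rewrite scaler0 addr0.
have [IHr1 IHr2] := ystar2_bilin r Y'; split=> [x'|x].
  by apply: node_lift_linear; apply: trilin_l; exact: IHr1.
apply: node_lift_param => x1 u x2.
by apply: (linear_comp_on (f := ygraft _ u)); [exact: ygraft_linearr | exact: IHr2].
Qed.

Lemma ysucc2_bilin m (Y : bt m) n (Y' : bt n) : bilin2 (ysucc2 Y Y').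
Proof.
case: Y' => {n} [|p q l r]; first by split=> ? a x y; rewrite scaler0 addr0.
have [IHl1 IHl2] := ystar2_bilin Y l; split=> [x'|x].
  apply: node_lift_param => x1 u x2.
  by apply: (linear_comp_on (f := fun z => ygraft z u _));
    [exact: ygraft_linearl | exact: IHl1].
by apply: node_lift_linear; apply: trilin_r; exact: IHl2.
Qed.

Section Ext2.
Variable f : forall m, bt m -> forall n, bt n -> tpow m -> tpow n -> yspace.
Hypothesis bf : forall m (Y : bt m) n (Y' : bt n), bilin2 (f Y Y').

Let lf m (Y : bt m) z' : linear (fun x => ylift (fun n Y' x' => f Y Y' x x') z').
Proof. by apply: ylift_param => n Y' x'; exact: (bf Y Y').1. Qed.

Lemma yext2_linearl z' : linear (fun z => yext2 f z z').
Proof. by apply: ylift_linear => m Y. Qed.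

Lemma yext2_linearr z : linear (yext2 f z).
Proof.
by apply: ylift_param => m Y x; apply: ylift_linear => n Y'; exact: (bf Y Y').2.
Qed.

Lemma yext2E m (Y : bt m) x n (Y' : bt n) x' :
  yext2 f (ytree Y x) (ytree Y' x') = f Y Y' x x'.
Proof. by rewrite /yext2 yliftE // yliftE // => i Z; exact: (bf Y Z).2. Qed.
End Ext2.

Lemma ystarT m (Y : bt m) (x : tpow m) n (Y' : bt n) (x' : tpow n) :
  ystar (ytree Y x) (ytree Y' x') = ystar2 Y Y' x x'.
Proof. exact/yext2E/ystar2_bilin. Qed.
Lemma yprecT m (Y : bt m) (x : tpow m) n (Y' : bt n) (x' : tpow n) :
  yprec (ytree Y x) (ytree Y' x') = yprec2 Y Y' x x'.
Proof. exact/yext2E/yprec2_bilin. Qed.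
Lemma ysuccT m (Y : bt m) (x : tpow m) n (Y' : bt n) (x' : tpow n) :
  ysucc (ytree Y x) (ytree Y' x') = ysucc2 Y Y' x x'.
Proof. exact/yext2E/ysucc2_bilin. Qed.

Lemma ystar_linearl z' : linear (fun z => ystar z z').
Proof. exact/yext2_linearl/ystar2_bilin. Qed.
Lemma ystar_linearr z : linear (ystar z).
Proof. exact/yext2_linearr/ystar2_bilin. Qed.
Lemma yprec_linearl z' : linear (fun z => yprec z z').
Proof. exact/yext2_linearl/yprec2_bilin. Qed.
Lemma yprec_linearr z : linear (yprec z).
Proof. exact/yext2_linearr/yprec2_bilin. Qed.
Lemma ysucc_linearl z' : linear (fun z => ysucc z z').
Proof. exact/yext2_linearl/ysucc2_bilin. Qed.
Lemma ysucc_linearr z : linear (ysucc z).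
Proof. exact/yext2_linearr/ysucc2_bilin. Qed.

Definition yunit : yspace := ytree Leaf (1 : k^o).

(* The next lemmas are the recursive equations of the operations: [yprec],
   [ysucc] and [ystar] satisfy them and are determined by them. *)
Lemma yprec_graft z1 v z2 z' : yprec (ygraft z1 v z2) z' = ygraft z1 v (ystar z2 z').
Proof.
move: z1; apply: yspace_ext => [||m Y x].
- apply: (linear_comp_on (f := fun z => yprec z z')); first exact: yprec_linearl.
  exact: ygraft_linearl.
- exact: ygraft_linearl.
move: z2; apply: yspace_ext => [||p Z w].
- apply: (linear_comp_on (f := fun z => yprec z z')); first exact: yprec_linearl.
  exact: ygraft_linearr.
- apply: (linear_comp_on (f := ygraft _ v)); first exact: ygraft_linearr.
  exact: ystar_linearl.
move: z'; apply: yspace_ext => [||n Y' x'].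
- exact: yprec_linearr.
- apply: (linear_comp_on (f := ygraft _ v)); first exact: ygraft_linearr.
  exact: ystar_linearr.
rewrite ygraftE yprecT ystarT /= node_liftE //; apply: trilin_l.
exact: (ystar2_bilin Z Y').1.
Qed.

Lemma ysucc_graft z z1 v z2 : ysucc z (ygraft z1 v z2) = ygraft (ystar z z1) v z2.
Proof.
move: z; apply: yspace_ext => [||n Y' x'].
- exact: ysucc_linearl.
- apply: (linear_comp_on (f := fun z => ygraft z v _)); first exact: ygraft_linearl.
  exact: ystar_linearl.
move: z1; apply: yspace_ext => [||m Y x].
- apply: (linear_comp_on (f := ysucc _)); first exact: ysucc_linearr.
  exact: ygraft_linearl.
- apply: (linear_comp_on (f := fun z => ygraft z v _)); first exact: ygraft_linearl.
  exact: ystar_linearr.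
move: z2; apply: yspace_ext => [||p Z w].
- apply: (linear_comp_on (f := ysucc _)); first exact: ysucc_linearr.
  exact: ygraft_linearr.
- exact: ygraft_linearr.
rewrite ygraftE ysuccT ystarT /= node_liftE //; apply: trilin_r.
exact: (ystar2_bilin Y' Y).2.
Qed.

Lemma ystar_unitl : left_id yunit (@ystar k V).
Proof.
apply: yspace_ext => [||n Y x]; first exact: ystar_linearr.
- by move=> a x y.
by rewrite ystarT /= scale1r.
Qed.

Lemma ystar_unitr : right_id yunit (@ystar k V).
Proof.
apply: yspace_ext => [||n Y x]; first exact: ystar_linearl.
- by move=> a x y.
rewrite ystarT; case: Y x => [|p q l r] x; last by rewrite /= scale1r.
have [_ _ h] := linear_eq_on (@ytree_linear k V 0 Leaf).
rewrite -[LHS]/((x : k) *: ytree Leaf ((1 : k^o) : tpow 0)) -h.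
by congr ytree; rewrite /GRing.scale /= mulr1.
Qed.

Lemma yprec_unitl z : yprec yunit z = 0.
Proof.
move: z; apply: (yspace_ext (g := fun=> 0)) => [||n Y x].
- exact: yprec_linearr.
- by move=> a x y; rewrite scaler0 addr0.
by rewrite yprecT.
Qed.

Lemma ysucc_unitr z : ysucc z yunit = 0.
Proof.
move: z; apply: (yspace_ext (g := fun=> 0)) => [||n Y x].
- exact: ysucc_linearl.
- by move=> a x y; rewrite scaler0 addr0.
by rewrite ysuccT.
Qed.

Let node_ind (Q : forall n, bt n -> Prop) :
  (forall p q (l : bt p) (r : bt q), Q _ (Node l r)) ->
  forall n (Y : bt n), (0 < n)%N -> Q n Y.
Proof. by move=> QN n [|p q l r]. Qed.

Lemma ybar_graft_ext (P : lmodType k) (f g : yspace -> P) : linear f -> linear g ->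
  (forall z u z', f (ygraft z u z') = g (ygraft z u z')) ->
  forall a : ybar, f (yincl a) = g (yincl a).
Proof.
move=> lf lg fg; apply: ybar_ext => [||n Y x].
- by apply: (linear_comp_on (f := f)) => //; exact: yincl_linear.
- by apply: (linear_comp_on (f := g)) => //; exact: yincl_linear.
rewrite yinclE; move: (isT : (0 < n.+1)%N) x; move: (n.+1) Y.
apply: node_ind => p q l r x.
rewrite -[x]/(x : tpow (p + q.+1)) -(@tsplitK _ V p q.+1 x); move: (tsplit _) => t.
have lY (h : yspace -> P) : linear h ->
    linear (fun t => h (ytree (Node l r) (@tcat k V p q.+1 t))).
  move=> lh; apply: (linear_comp_on (f := h)) => //.
  apply: (linear_comp_on (f := ytree _)); first exact: ytree_linear.
  exact: (@tcat_linear k V p q.+1).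
move: t; apply: tensor_ext; [exact: lY|exact: lY|move=> x1].
have lY1 (h : yspace -> P) : linear h ->
    linear (fun t : tpow q.+1 => h (ytree (Node l r) (@tcat k V p q.+1 (x1 ⊗ₜ t)))).
  by move=> lh; apply: (linear_comp_on (g := tpure x1) (lY h lh)); exact: tpure_linearr.
apply: tensor_ext; [exact: lY1|exact: lY1|move=> u x2].
by rewrite tcatE -!ygraftE.
Qed.

Lemma yprec_unitr (a : ybar) : yprec (yincl a) yunit = yincl a.
Proof.
move: a; apply: (ybar_graft_ext (g := idfun) (f := fun z => yprec z yunit)).
- exact: yprec_linearl.
- exact: linear_on.
by move=> z u z'; rewrite yprec_graft ystar_unitr.
Qed.

Lemma ysucc_unitl (a : ybar) : ysucc yunit (yincl a) = yincl a.
Proof.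
move: a; apply: (ybar_graft_ext (g := idfun) (f := fun z => ysucc yunit z)).
- exact: ysucc_linearr.
- exact: linear_on.
by move=> z u z'; rewrite ysucc_graft ystar_unitl.
Qed.

Lemma ystar_bar (a b : ybar) :
  ystar (yincl a) (yincl b) = yprec (yincl a) (yincl b) + ysucc (yincl a) (yincl b).
Proof.
move: a; apply: ybar_ext => [||m Y x].
- apply: (linear_comp_on (f := fun z => ystar z _)); [exact: ystar_linearl|exact: yincl_linear].
- apply: linear_add.
  + apply: (linear_comp_on (f := fun z => yprec z _)); [exact: yprec_linearl|exact: yincl_linear].
  + apply: (linear_comp_on (f := fun z => ysucc z _)); [exact: ysucc_linearl|exact: yincl_linear].
move: b; apply: ybar_ext => [||n Y' x'].
- apply: (linear_comp_on (f := ystar _)); [exact: ystar_linearr|exact: yincl_linear].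
- apply: linear_add.
  + apply: (linear_comp_on (f := yprec _)); [exact: yprec_linearr|exact: yincl_linear].
  + apply: (linear_comp_on (f := ysucc _)); [exact: ysucc_linearr|exact: yincl_linear].
rewrite !yinclE ystarT yprecT ysuccT.
move: (isT : (0 < m.+1)%N) x; move: (m.+1) Y; apply: node_ind => p q l r x.
move: (isT : (0 < n.+1)%N) x'; move: (n.+1) Y'; apply: node_ind => p' q' l' r' x'.
by [].
Qed.

Lemma yprojK_graft z u z' : yincl (yproj (ygraft z u z')) = ygraft z u z'.
Proof.
move: z; apply: (yspace_ext (f := fun z => yincl (yproj (ygraft z u _)))) => [||m Y x].
- apply: (linear_comp_on (f := @yincl k V)); first exact: yincl_linear.
  apply: (linear_comp_on (f := @yproj k V)); first exact: yproj_linear.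
  exact: ygraft_linearl.
- exact: ygraft_linearl.
move: z'; apply: (yspace_ext (f := fun z => yincl (yproj (ygraft _ u z)))) => [||n Y' x'].
- apply: (linear_comp_on (f := @yincl k V)); first exact: yincl_linear.
  apply: (linear_comp_on (f := @yproj k V)); first exact: yproj_linear.
  exact: ygraft_linearr.
- exact: ygraft_linearr.
rewrite ygraftE; move: (Node Y Y') (tcat2 _ _) => Z w.
have : (0 < m + n.+1)%N by rewrite addnS.
by case: (m + n.+1)%N Z w => // i Z w _; rewrite yprojS yinclE.
Qed.

(* The operations induced on [ybar]. *)
Definition bprec (a b : ybar) : ybar := yproj (yprec (yincl a) (yincl b)).
Definition bsucc (a b : ybar) : ybar := yproj (ysucc (yincl a) (yincl b)).

Lemma yincl_bprec a b : yincl (bprec a b) = yprec (yincl a) (yincl b).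
Proof.
rewrite /bprec.
apply: (ybar_graft_ext (f := fun z => yincl (yproj (yprec z (yincl b))))
  (g := fun z => yprec z (yincl b))).
- apply: (linear_comp_on (f := @yincl k V)); first exact: yincl_linear.
  apply: (linear_comp_on (f := @yproj k V)); first exact: yproj_linear.
  exact: yprec_linearl.
- exact: yprec_linearl.
by move=> z u z'; rewrite yprec_graft yprojK_graft.
Qed.

Lemma yincl_bsucc a b : yincl (bsucc a b) = ysucc (yincl a) (yincl b).
Proof.
rewrite /bsucc.
apply: (ybar_graft_ext (f := fun z => yincl (yproj (ysucc (yincl a) z)))
  (g := fun z => ysucc (yincl a) z)).
- apply: (linear_comp_on (f := @yincl k V)); first exact: yincl_linear.
  apply: (linear_comp_on (f := @yproj k V)); first exact: yproj_linear.
  exact: ysucc_linearr.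
- exact: ysucc_linearr.
by move=> z u z'; rewrite ysucc_graft yprojK_graft.
Qed.

Let bprec_bilin : bilin bprec.
Proof.
split=> [b|a].
- apply: (linear_comp_on (f := @yproj k V)); first exact: yproj_linear.
  apply: (linear_comp_on (f := fun z => yprec z _)); [exact: yprec_linearl|exact: yincl_linear].
- apply: (linear_comp_on (f := @yproj k V)); first exact: yproj_linear.
  apply: (linear_comp_on (f := yprec _)); [exact: yprec_linearr|exact: yincl_linear].
Qed.
HB.instance Definition _ :=
  bilinear_isBilinear.Build k ybar ybar ybar _ _ bprec bprec_bilin.

Let bsucc_bilin : bilin bsucc.
Proof.
split=> [b|a].
- apply: (linear_comp_on (f := @yproj k V)); first exact: yproj_linear.
  apply: (linear_comp_on (f := fun z => ysucc z _)); [exact: ysucc_linearl|exact: yincl_linear].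
- apply: (linear_comp_on (f := @yproj k V)); first exact: yproj_linear.
  apply: (linear_comp_on (f := ysucc _)); [exact: ysucc_linearr|exact: yincl_linear].
Qed.
HB.instance Definition _ :=
  bilinear_isBilinear.Build k ybar ybar ybar _ _ bsucc bsucc_bilin.

(* The inclusion of generators, [v |-> | \/_v |]. *)
Definition iV (v : V) : ybar := yproj (ygraft yunit v yunit).

Lemma iVE v :
  iV v = ybtree (Node Leaf Leaf) (v ⊗ₜ ((1 : k^o) : tpow 0) : tpow 1).
Proof. by rewrite /iV ygraftE /= scale1r yprojS. Qed.

Let iV_linear : linear iV.
Proof.
apply: (linear_comp_on (f := @yproj k V)); first exact: yproj_linear.
exact: ygraft_linear.
Qed.
HB.instance Definition _ := GRing.isLinear.Build k V ybar *:%R iV iV_linear.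

Section BraidingOnTrees.
Variable s : {linear V ⊗ V -> V ⊗ V}.

Definition sigmaBT2 (z z' : ybar) : ybar ⊗ ybar :=
  yblift (fun m Y x => yblift (fun n Y' x' =>
    tmap (ybtree Y') (ybtree Y) (@beta k V s m.+1 n.+1 (x ⊗ₜ x'))) z') z.

Let tmap_beta_linear m (Y : bt m.+1) n (Y' : bt n.+1) :
  linear (fun t => tmap (ybtree Y') (ybtree Y) (@beta k V s m.+1 n.+1 t)).
Proof.
apply: (linear_comp_on (f := tmap _ _)).
  by apply: tmap_linear; exact: ybtree_linear.
by apply: beta_linear; exact: linear_on.
Qed.

Let inner_l m (Y : bt m.+1) (z' : ybar) : linear (fun x => yblift (fun n Y' x' =>
  tmap (ybtree Y') (ybtree Y) (@beta k V s m.+1 n.+1 (x ⊗ₜ x'))) z').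
Proof.
apply: yblift_param => n Y' x'.
by apply: (linear_comp_on (g := fun x => x ⊗ₜ x') (tmap_beta_linear Y Y')); exact: tpure_linearl.
Qed.

Let inner_r m (Y : bt m.+1) (x : tpow m.+1) n (Y' : bt n.+1) :
  linear (fun x' => tmap (ybtree Y') (ybtree Y) (@beta k V s m.+1 n.+1 (x ⊗ₜ x'))).
Proof.
by apply: (linear_comp_on (g := tpure x) (tmap_beta_linear Y Y')); exact: tpure_linearr.
Qed.

Lemma sigmaBT2_bilin : bilin sigmaBT2.
Proof.
split=> [z'|z]; first by apply: yblift_linear => m Y; exact: inner_l.
by apply: yblift_param => m Y x; apply: yblift_linear => n Y'; exact: inner_r.
Qed.

Definition sigmaBT : ybar ⊗ ybar -> ybar ⊗ ybar := tlift sigmaBT2.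
HB.instance Definition _ := GRing.isLinear.Build k (ybar ⊗ ybar) (ybar ⊗ ybar) *:%R
  sigmaBT (tlift_linear sigmaBT2_bilin).

Lemma sigmaBTE m (Y : bt m.+1) x n (Y' : bt n.+1) x' :
  sigmaBT (ybtree Y x ⊗ₜ ybtree Y' x') =
  tmap (ybtree Y') (ybtree Y) (@beta k V s m.+1 n.+1 (x ⊗ₜ x')).
Proof.
rewrite /sigmaBT tlift_pure; last exact: sigmaBT2_bilin.
rewrite /sigmaBT2 ybliftE; last by move=> i Z; exact: inner_l.
by rewrite ybliftE // => i Z; exact: inner_r.
Qed.
End BraidingOnTrees.
End TreeProducts.

(* Main.v *)
Require Import Defs.
From HB Require Import structures.
From mathcomp Require Import all_boot all_fingroup all_algebra.
From mathcomp Require Import boolp zify.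

Set Implicit Arguments.
Unset Strict Implicit.
Unset Printing Implicit Defensive.

Import GRing.Theory.
Local Open Scope ring_scope.

(** A planar binary tree decorated by vectors of [V] is a monomial in two
    operations: writing [u] for [iV u], the tree with left branch [a], root [u]
    and right branch [b] is [(a > u) < b], where a factor that is the trivial
    tree is simply omitted. A morphism out of the tree algebra is therefore
    determined by its restriction to generators, and the same formula, read in
    a dendriform algebra [D], defines its value [ev_bar] on trees. That [ev_bar]
    respects the products is a double induction on grafts ([yev_mult]), of the
    same shape as the one giving associativity of [ystar] ([ystar_assoc]), from
    which the dendriform axioms on trees follow.

    The braidings are handled by one principle. In a product of two decorated
    trees, the trees that occur and their multiplicities do not depend on the
    decorations, which are merely concatenated ([bprec_sum], [bsucc_sum]).
    Hence every identity about [sigmaBT] reduces to an identity about the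
    braidings of the tensor powers of [V]. These are given a recursive form
    [cross], built from the operator [cross1] that moves one vector through a
    tensor: both are compatible with concatenation on either side ([cross1_cat],
    [cross_catr], [cross_catl]) and satisfy the Yang-Baxter equation
    ([cross_yb]), by inductions that use nothing but the Yang-Baxter equation
    for [sigma]. Compatibility with concatenation gives compatibility of
    [sigmaBT] with the products, and the Yang-Baxter equation for [cross] gives
    the one for [sigmaBT].

    It remains to recognise [beta] as [cross] ([betaE]). [beta] is defined from
    the reduced expression found by repeatedly stripping the first descent. For
    a block permutation this greedy procedure can be followed exactly: it
    carries the elements of the first block through the second one, one after
    the other ([red_word_chi]), which is the recursion defining [cross].

    Finally, evaluation commutes with the braidings because [tau] slides past
    the operations of [D] one at a time: first a generator past an evaluated
    tree ([ev_cross1]), then a whole tree past another one ([ev_cross]).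

    Computations in tensor products are carried out on elements, in the style of
    Sweedler's notation: in an expression [let⊗ (a, b) := t in F a b] the tensor
    [t] is thought of as a sum of terms [a ⊗ₜ b], over which [F a b] is summed. *)

(** * Computing with elements of tensor products *)
Notation "'let⊗' ( a , b ) ':=' t 'in' F" := (tlift (fun a b => F) t)
  (at level 200, a name, b name, F at level 200,
   format "'[v' 'let⊗'  ( a ,  b )  ':='  t  'in'  '/' F ']'") : ring_scope.

Section Sweedler.
Variable k : fieldType.
Implicit Types A B C D P Q : lmodType k.

Lemma bilinI A B P (f : A -> B -> P) :
  (forall b, linear (fun a => f a b)) -> (forall a, linear (fun b => f a b)) -> bilin f.
Proof. by []. Qed.

Lemma linearZ_on A B (f : A -> B) (lf : linear f) a x : f (a *: x) = a *: f x.
Proof. by have [_ _ ->] := linear_eq_on lf. Qed.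

Lemma linearD_on A B (f : A -> B) (lf : linear f) x y : f (x + y) = f x + f y.
Proof. by have [_ -> _] := linear_eq_on lf. Qed.

Lemma linear0_on A B (f : A -> B) (lf : linear f) : f 0 = 0.
Proof. by have [-> _ _] := linear_eq_on lf. Qed.

Lemma linear_id A : linear (fun x : A => x).
Proof. by []. Qed.

Lemma linear_addf A B (f g : A -> B) :
  linear f -> linear g -> linear (fun x => f x + g x).
Proof. by move=> lf lg a x y; rewrite lf lg scalerDr addrACA. Qed.

Lemma linear_scalef A B (c : k) (f : A -> B) :
  linear f -> linear (fun x => c *: f x).
Proof. by move=> lf a x y; rewrite lf scalerDr !scalerA mulrC. Qed.

Lemma linear_scalel A B (f : A -> k^o) (b : B) :
  linear f -> linear (fun x => (f x : k) *: b).
Proof. by move=> lf a x y; rewrite lf scalerDl scalerA. Qed.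

Lemma linear_sumf A B (I : Type) (r : seq I) (f : I -> A -> B) :
  (forall i, linear (f i)) -> linear (fun x => \sum_(i <- r) f i x).
Proof.
move=> lf a x y; rewrite scaler_sumr -big_split; apply: eq_bigr => i _; exact: lf.
Qed.

Lemma linear_zero A B : linear (fun _ : A => 0 : B).
Proof. by move=> a x y; rewrite scaler0 addr0. Qed.

Lemma tpure_l A B (b : B) : linear (fun a : A => a ⊗ₜ b).
Proof. exact: tpure_linearl. Qed.

Lemma tpure_r A B (a : A) : linear (fun b : B => a ⊗ₜ b).
Proof. exact: tpure_linearr. Qed.

Lemma tliftD A B P (f : A -> B -> P) t :
  tlift f t = \sum_(p <- ds_supp (generic_quotient.repr t))
     generic_quotient.repr t p *: f p.1 p.2.
Proof. by []. Qed.

(** As [tlift] is a finite sum over a chosen representative of the tensor, linear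
    maps commute with it, and two such sums can be added or exchanged. *)
Lemma tlift_comp A B P Q (L : P -> Q) (f : A -> B -> P) t :
  linear L -> L (tlift f t) = tlift (fun a b => L (f a b)) t.
Proof.
move=> lL; rewrite !tliftD linear_sum_on //; apply: eq_bigr => p _.
by have [_ _ ->] := linear_eq_on lL.
Qed.

Lemma eq_tlift A B P (f g : A -> B -> P) t :
  (forall a b, f a b = g a b) -> tlift f t = tlift g t.
Proof. by move=> fg; rewrite !tliftD; apply: eq_bigr => p _; rewrite fg. Qed.

Lemma tlift_tlift A B C D P (f : C -> D -> P) (g : A -> B -> C ⊗ D) t :
  bilin f -> tlift f (tlift g t) = tlift (fun a b => tlift f (g a b)) t.
Proof. by move=> bf; apply: tlift_comp; exact: tlift_linear. Qed.

Lemma tlift_swap A B C D P (f : A -> B -> C -> D -> P) t u :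
  (let⊗ (a, b) := t in let⊗ (c, d) := u in f a b c d) =
  (let⊗ (c, d) := u in let⊗ (a, b) := t in f a b c d).
Proof.
rewrite !tliftD; under eq_bigr do rewrite tliftD scaler_sumr.
rewrite exchange_big; apply: eq_bigr => p _; rewrite tliftD scaler_sumr.
by apply: eq_bigr => q _; rewrite !scalerA mulrC.
Qed.

Lemma tlift_add A B P (f g : A -> B -> P) t :
  (let⊗ (a, b) := t in f a b + g a b) = tlift f t + tlift g t.
Proof.
by rewrite !tliftD -big_split; apply: eq_bigr => p _; rewrite scalerDr.
Qed.

Lemma tlift_sum A B P (I : Type) (r : seq I) (f : I -> A -> B -> P) t :
  \sum_(i <- r) tlift (f i) t = tlift (fun a b => \sum_(i <- r) f i a b) t.
Proof.
rewrite tliftD; under eq_bigr do rewrite tliftD.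
by rewrite exchange_big; apply: eq_bigr => p _; rewrite scaler_sumr.
Qed.

(** Used from right to left to put an arbitrary tensor in the form that the
    previous rules apply to. *)
Lemma tlift_eta A B (t : A ⊗ B) : tlift (fun a b => a ⊗ₜ b) t = t.
Proof.
move: t; apply: tensor_ext => [||a b]; last by rewrite tlift_pure //; exact: tpure_bilin.
  by apply: tlift_linear; exact: tpure_bilin.
by [].
Qed.
End Sweedler.

Create HintDb lin.

#[export] Hint Extern 0 (GRing.linear_for _ (tpure _)) => (exact: tpure_r) : lin.
#[export] Hint Extern 0 (GRing.linear_for _ (fun x => tpure x _)) => (exact: tpure_l) : lin.
#[export] Hint Extern 5 (GRing.linear_for _ (GRing.Linear.sort _)) => (exact: linear_on) : lin.

(** The vector space [tpow n.+1] unfolds to [V ⊗ tpow n]. Giving names to the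
    constructor and to the case analysis keeps the length visible in types,
    which the inference of module structures relies on. *)
Section TensorPowers.
Variables (k : fieldType) (V : lmodType k).
Local Notation tpow := (@tpow k V).

Definition tcons n (v : V) (x : tpow n) : tpow n.+1 := v ⊗ₜ x.

Definition tcase n (P : lmodType k) (f : V -> tpow n -> P) (t : tpow n.+1) : P :=
  tlift f (t : V ⊗ tpow n).

Definition tscal (c : tpow 0) : k := c.

Lemma tcons_l n (x : tpow n) : linear (fun v => tcons v x).
Proof. exact: tpure_linearl. Qed.

Lemma tcons_r n v : linear (@tcons n v).
Proof. exact: tpure_linearr. Qed.

Lemma tcase_linear n (P : lmodType k) (f : V -> tpow n -> P) :
  bilin f -> linear (tcase f).
Proof. exact: tlift_linear. Qed.

Lemma tcase_param n (A P : lmodType k) (f : A -> V -> tpow n -> P) t :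
  (forall v x, linear (fun a => f a v x)) -> linear (fun a => tcase (f a) t).
Proof. exact: tlift_param. Qed.

Lemma tcase_cons n (P : lmodType k) (f : V -> tpow n -> P) v x :
  bilin f -> tcase f (tcons v x) = f v x.
Proof. exact: tlift_pure. Qed.

Lemma tcons_ext n (P : lmodType k) (f g : tpow n.+1 -> P) : linear f -> linear g ->
  (forall v x, f (tcons v x) = g (tcons v x)) -> f =1 g.
Proof. exact: tensor_ext. Qed.

Lemma tcat2_l m n (y : tpow n) : linear (fun x : tpow m => tcat2 x y).
Proof. exact: (@tcat2_bilin k V m n).1. Qed.

Lemma tcat2_r m n (x : tpow m) : linear (@tcat2 k V m n x).
Proof. exact: (@tcat2_bilin k V m n).2. Qed.

Lemma tcat2_scal n c (y : tpow n) : tcat2 (c : tpow 0) y = tscal c *: y.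
Proof. by []. Qed.

Lemma tcat2_tcons m n v (x : tpow m) (y : tpow n) :
  tcat2 (tcons v x) y = tcons v (tcat2 x y) :> tpow (m + n).+1.
Proof. exact: tcat2_cons. Qed.

Lemma tscal_linear : linear (tscal : tpow 0 -> k^o).
Proof. by []. Qed.
End TensorPowers.
#[export] Hint Extern 0 (GRing.linear_for _ (tcons _)) => (exact: tcons_r) : lin.
#[export] Hint Extern 0 (GRing.linear_for _ (fun x => tcons x _)) => (exact: tcons_l) : lin.
#[export] Hint Extern 0 (GRing.linear_for _ (tcat2 _)) => (exact: tcat2_r) : lin.
#[export] Hint Extern 0 (GRing.linear_for _ (fun x => tcat2 x _)) => (exact: tcat2_l) : lin.
(** [lin] proves that an expression built from [let⊗] and registered linear or
    multilinear maps is linear in its argument, by decomposing it as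
    a composition; the argument may occur only once, except in sums. *)
Ltac lin_step :=
  lazymatch goal with
  | |- forall _, _ => intro
  | |- bilinear_for _ _ _ => apply: bilinI => ?; cbv beta
  | |- GRing.linear_for _ (fun x => x) => exact: linear_id
  | |- GRing.linear_for _ (tlift _) => apply: tlift_linear
  | |- GRing.linear_for _ (tcase _) => apply: tcase_linear
  | |- GRing.linear_for _ (fun x => tlift (fun a b => @?F a b) (@?T x)) =>
      apply: (@linear_comp_on _ _ _ _ (tlift F) T); cbv beta; [apply: tlift_linear|]
  | |- GRing.linear_for _ (fun x => tcase (fun a b => @?F a b) (@?T x)) =>
      apply: (@linear_comp_on _ _ _ _ (tcase F) T); cbv beta; [apply: tcase_linear|]
  | |- GRing.linear_for _ (fun x => tlift (fun a b => @?F x a b) _) =>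
      apply: (@tlift_param _ _ _ _ _ F); cbv beta; intros
  | |- GRing.linear_for _ (fun x => tcase (fun a b => @?F x a b) _) =>
      apply: (@tcase_param _ _ _ _ _ F); cbv beta; intros
  | |- GRing.linear_for _ (fun x => GRing.add _ _) => apply: linear_addf
  | |- GRing.linear_for _ (fun x => bigop _ _ _) => apply: linear_sumf; intro
  | |- GRing.linear_for _ _ =>
      first [ solve [auto with lin nocore]
      | match goal with
        | |- GRing.linear_for _ (fun x => ?f (@?T x)) =>
            apply: (@linear_comp_on _ _ _ _ f T); cbv beta
        | |- GRing.linear_for _ (fun x => ?f (@?T x) ?b) =>
            apply: (@linear_comp_on _ _ _ _ (fun z => f z b) T); cbv beta
        | |- GRing.linear_for _ (fun x => ?f (@?T x) ?b ?c) =>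
            apply: (@linear_comp_on _ _ _ _ (fun z => f z b c) T); cbv beta
        | |- _ => exact: linear_on
        end ]
  end.
Ltac lin := solve [repeat lin_step].
(** One step of normalisation: evaluate [let⊗] on a pure tensor, or flatten
    nested ones. *)
Ltac let_simp := first [rewrite tlift_pure; last by lin | rewrite tlift_tlift; last by lin].
Ltac let_congr x y := apply: eq_tlift => x y.

(** * Braiding tensor powers *)
Section YangBaxter.
Variable k : fieldType.

(** The Yang-Baxter equation for three possibly different spaces, so that it can
    be stated and proved for pairs of tensor powers of different lengths. *)
Definition yb_eq (A B C : lmodType k) (f : A -> B -> B ⊗ A) (g : A -> C -> C ⊗ A)
    (h : B -> C -> C ⊗ B) := forall a b c,
  (let⊗ (b1, a1) := f a b in let⊗ (c1, a2) := g a1 c in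
   let⊗ (c2, b2) := h b1 c1 in (c2 ⊗ₜ b2) ⊗ₜ a2) =
  (let⊗ (c1, b1) := h b c in let⊗ (c2, a1) := g a c1 in
   let⊗ (b2, a2) := f a1 b1 in (c2 ⊗ₜ b2) ⊗ₜ a2).

(** Yang-Baxter under a continuation: this form allows rewriting in the middle of
    a longer sequence of crossings. *)
Lemma yb_eqE (A B C P : lmodType k) (f : A -> B -> B ⊗ A) (g : A -> C -> C ⊗ A)
    (h : B -> C -> C ⊗ B) (K : C -> B -> A -> P) a b c : yb_eq f g h ->
  (forall b a, linear (fun c => K c b a)) -> (forall c a, linear (fun b => K c b a)) ->
  (forall c b, linear (K c b)) ->
  (let⊗ (b1, a1) := f a b in let⊗ (c1, a2) := g a1 c in
   let⊗ (c2, b2) := h b1 c1 in K c2 b2 a2) =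
  (let⊗ (c1, b1) := h b c in let⊗ (c2, a1) := g a c1 in
   let⊗ (b2, a2) := f a1 b1 in K c2 b2 a2).
Proof.
move=> yb K1 K2 K3.
pose L t := let⊗ (cb, a) := t in let⊗ (c, b) := cb in K c b a.
have lL : linear L by rewrite /L; lin.
have LE c2 b2 a2 : L ((c2 ⊗ₜ b2) ⊗ₜ a2) = K c2 b2 a2 by rewrite /L; let_simp; let_simp.
have /(congr1 L) := yb a b c; rewrite !(tlift_comp _ _ lL) => e.
etransitivity; [etransitivity; [|exact: e]|]; let_congr x y; rewrite (tlift_comp _ _ lL);
  let_congr z t; rewrite (tlift_comp _ _ lL); let_congr u v; rewrite LE //.
Qed.
End YangBaxter.

Section Crossings.
Variables (k : fieldType) (V : lmodType k) (s : {linear V ⊗ V -> V ⊗ V}).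
Local Notation tpow := (@tpow k V).

(** Moves [v] from the left of a tensor to its right, one factor at a time. *)
Fixpoint cross1 n : V -> tpow n -> tpow n ⊗ V :=
  match n return V -> tpow n -> tpow n ⊗ V with
  | 0 => fun v a => a ⊗ₜ v
  | n'.+1 => fun v => tcase (fun w x =>
      let⊗ (w1, v1) := s (v ⊗ₜ w) in
      let⊗ (x1, v2) := cross1 v1 x in tcons w1 x1 ⊗ₜ v2)
  end.

Lemma cross1_bilin n : bilin (@cross1 n).
Proof. by elim: n => [|n [IHl IHr]]; apply: bilinI => /= [t|v]; lin. Qed.

Lemma cross1_l n x : linear (fun v => @cross1 n v x).
Proof. by have [h _] := @cross1_bilin n. Qed.
Lemma cross1_r n v : linear (@cross1 n v).
Proof. by have [_ h] := @cross1_bilin n. Qed.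
Hint Extern 0 (GRing.linear_for _ (cross1 _)) => (exact: cross1_r) : lin.
Hint Extern 0 (GRing.linear_for _ (fun x => cross1 x _)) => (exact: cross1_l) : lin.

Lemma cross1_nil v (a : tpow 0) : cross1 v a = a ⊗ₜ v.
Proof. by []. Qed.

Lemma cross1_cons n v w (x : tpow n) : cross1 v (tcons w x) =
  let⊗ (w1, v1) := s (v ⊗ₜ w) in
  let⊗ (x1, v2) := cross1 v1 x in tcons w1 x1 ⊗ₜ v2.
Proof. by rewrite /= tcase_cons //; lin. Qed.

Lemma cross1_cat m n v (x : tpow m) (y : tpow n) : cross1 v (tcat2 x y) =
  let⊗ (x1, v1) := cross1 v x in
  let⊗ (y1, v2) := cross1 v1 y in tcat2 x1 y1 ⊗ₜ v2.
Proof.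
elim: m v x => [|m IH] v x.
  rewrite cross1_nil tlift_pure; last by lin.
  rewrite tcat2_scal (linearZ_on (@cross1_r n v)).
  rewrite -{1}(tlift_eta (cross1 v y)).
  rewrite (tlift_comp (L := fun t => _ *: t)); last by apply: linear_scalef.
  let_congr y1 v1; rewrite tcat2_scal; exact/esym/(linearZ_on (tpure_l v1)).
move: x; apply: tcons_ext; [lin|lin|move=> w x].
rewrite tcat2_tcons !cross1_cons; let_simp; let_congr w1 v1; rewrite IH; let_simp; let_simp; let_congr x1 v2.
let_simp; let_simp; let_congr y1 v3; let_simp; rewrite ?tcat2_tcons //.
Qed.

(** The factors of the left tensor are moved through the right one starting with
    the last, so that each of them meets [y] alone. *)
Fixpoint cross_rec m n : tpow m -> tpow n -> tpow n ⊗ tpow m :=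
  match m return tpow m -> tpow n -> tpow n ⊗ tpow m with
  | 0 => fun c y => y ⊗ₜ c
  | m'.+1 => fun t y => tcase (fun v x =>
      let⊗ (y1, x1) := @cross_rec m' n x y in
      let⊗ (y2, v1) := cross1 v y1 in y2 ⊗ₜ tcons v1 x1) t
  end.

(** Sealed: since [tpow n.+1] is a tensor product, unification would otherwise
    unfold [cross] in search of a [let⊗]. *)
Fact cross_key : unit. Proof. exact: tt. Qed.
Definition cross m n := locked_with cross_key (@cross_rec m n).

Lemma crossE m n : @cross m n = @cross_rec m n.
Proof. exact: locked_withE. Qed.

Lemma cross_bilin m n : bilin (@cross m n).
Proof.
by rewrite crossE; elim: m => [|m [IHl IHr]]; apply: bilinI => /= [y|t]; lin.
Qed.

Lemma cross_l m n y : linear (fun x => @cross m n x y).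
Proof. by have [h _] := @cross_bilin m n. Qed.
Lemma cross_r m n x : linear (@cross m n x).
Proof. by have [_ h] := @cross_bilin m n. Qed.
Hint Extern 0 (GRing.linear_for _ (cross _)) => (exact: cross_r) : lin.
Hint Extern 0 (GRing.linear_for _ (fun x => cross x _)) => (exact: cross_l) : lin.

Lemma cross_nil n (a : tpow 0) (y : tpow n) : cross a y = y ⊗ₜ a.
Proof. by rewrite crossE. Qed.

Lemma cross_cons m n v (x : tpow m) (y : tpow n) : cross (tcons v x) y =
  let⊗ (y1, x1) := cross x y in
  let⊗ (y2, v1) := cross1 v y1 in y2 ⊗ₜ tcons v1 x1.
Proof.
have [lr lc] := @cross_bilin m n; move: lr lc; rewrite !crossE => lr lc.
by rewrite /= tcase_cons //; lin.
Qed.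

(** The two hexagon identities. The first one reorders independent crossings,
    hence the use of [tlift_swap] in its proof. *)
Lemma cross_catr m n p (x : tpow m) (y : tpow n) (z : tpow p) :
  cross x (tcat2 y z) =
  let⊗ (y1, x1) := cross x y in
  let⊗ (z1, x2) := cross x1 z in tcat2 y1 z1 ⊗ₜ x2.
Proof.
elim: m x => [|m IH] x; first by do 2!(rewrite !cross_nil; let_simp).
move: x; apply: tcons_ext; [lin|lin|move=> v x].
rewrite !cross_cons IH; let_simp; let_simp; let_congr y1 x1.
transitivity (let⊗ (y2, v1) := cross1 v y1 in
  let⊗ (z1, x2) := cross x1 z in let⊗ (z2, v2) := cross1 v1 z1 in
  tcat2 y2 z2 ⊗ₜ tcons v2 x2).
  rewrite tlift_swap; let_simp; let_congr z1 x2; let_simp; rewrite cross1_cat.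
  by let_simp; let_congr y2 v1; let_simp; let_congr z2 v2; let_simp.
let_simp; let_congr y2 v1; let_simp; rewrite cross_cons; let_simp; let_congr z1 x2.
by let_simp; let_congr z2 v2; let_simp.
Qed.

Lemma cross_catl m n p (x : tpow m) (y : tpow n) (z : tpow p) :
  cross (tcat2 x y) z =
  let⊗ (z1, y1) := cross y z in
  let⊗ (z2, x1) := cross x z1 in z2 ⊗ₜ tcat2 x1 y1.
Proof.
elim: m x => [|m IH] x.
  rewrite tcat2_scal (linearZ_on (@cross_l n p z)).
  rewrite -{1}(tlift_eta (cross y z)).
  rewrite (tlift_comp (L := fun t => _ *: t)); last by apply: linear_scalef.
  let_congr z1 y1; rewrite cross_nil; let_simp.
  by rewrite tcat2_scal (linearZ_on (tpure_r z1)).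
move: x; apply: tcons_ext; [lin|lin|move=> v x].
rewrite tcat2_tcons !cross_cons IH; let_simp; let_congr z1 y1; rewrite cross_cons; let_simp; let_simp; let_congr z2 x1.
by let_simp; let_simp; let_congr z3 v1; let_simp; rewrite ?tcat2_tcons.
Qed.

Hypothesis yb_s : yb_eq (fun u v => s (u ⊗ₜ v)) (fun u v => s (u ⊗ₜ v)) (fun u v => s (u ⊗ₜ v)).

(** The Yang-Baxter equation is extended from [V] to tensor powers one strand at
    a time: first the rightmost strand, then the middle one, then the leftmost.
    Each proof pushes the head factor of the tensor to the outside, exchanging
    independent crossings, then applies the previous case to it and the
    induction hypothesis to the rest. *)
Lemma cross1_yb n : yb_eq (fun u v => s (u ⊗ₜ v)) (@cross1 n) (@cross1 n).
Proof.
elim: n => [|n IH] u v z.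
  rewrite cross1_nil; let_simp; rewrite cross1_nil; let_simp; let_congr v1 u1.
  by rewrite cross1_nil; let_simp; rewrite cross1_nil; let_simp.
move: z; apply: tcons_ext; [lin|lin|move=> w x].
transitivity (let⊗ (v1, u1) := s (u ⊗ₜ v) in let⊗ (w1, u2) := s (u1 ⊗ₜ w) in
  let⊗ (w2, v2) := s (v1 ⊗ₜ w1) in let⊗ (x1, u3) := cross1 u2 x in
  let⊗ (x2, v3) := cross1 v2 x1 in (tcons w2 x2 ⊗ₜ v3) ⊗ₜ u3).
  let_congr v1 u1; rewrite cross1_cons; let_simp; let_congr w1 u2; rewrite [in RHS]tlift_swap; let_simp.
  by let_congr x1 u3; let_simp; rewrite cross1_cons; let_simp; let_congr w2 v2; let_simp; let_congr x2 v3; let_simp.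
rewrite (yb_eqE _ _ _ yb_s); [|lin..].
rewrite cross1_cons; let_simp; let_congr w1 v1.
transitivity (let⊗ (w2, u1) := s (u ⊗ₜ w1) in let⊗ (x1, v2) := cross1 v1 x in
  let⊗ (x2, u2) := cross1 u1 x1 in let⊗ (v3, u3) := s (u2 ⊗ₜ v2) in
  (tcons w2 x2 ⊗ₜ v3) ⊗ₜ u3).
  by let_congr w2 u1; rewrite (yb_eqE u1 v1 x IH (K := fun x v u => tcons w2 x ⊗ₜ v ⊗ₜ u)) //; lin.
rewrite tlift_swap; let_simp; let_congr x1 v2; let_simp; rewrite cross1_cons; let_simp; let_congr w2 u1.
by let_simp; let_congr x2 u2; let_simp.
Qed.

Lemma cross1_cross_yb m n : yb_eq (@cross1 m) (@cross1 n) (@cross m n).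
Proof.
elim: m => [|m IH] v y z.
  rewrite cross_nil; let_simp; rewrite cross1_nil; let_simp; let_congr z1 v1.
  by rewrite cross_nil; let_simp; rewrite cross1_nil; let_simp.
move: y; apply: tcons_ext; [lin|lin|move=> w y].
transitivity (let⊗ (w1, v1) := s (v ⊗ₜ w) in let⊗ (y1, v2) := cross1 v1 y in
  let⊗ (z1, v3) := cross1 v2 z in let⊗ (z2, y2) := cross y1 z1 in
  let⊗ (z3, w2) := cross1 w1 z2 in (z3 ⊗ₜ tcons w2 y2) ⊗ₜ v3).
  rewrite cross1_cons; let_simp; let_congr w1 v1; let_simp; let_congr y1 v2; let_simp; let_congr z1 v3.
  by rewrite cross_cons; let_simp; let_congr z2 y2; let_simp; let_congr z3 w2; let_simp.
transitivity (let⊗ (z1, y1) := cross y z in let⊗ (w1, v1) := s (v ⊗ₜ w) in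
  let⊗ (z2, v2) := cross1 v1 z1 in let⊗ (z3, w2) := cross1 w1 z2 in
  let⊗ (y2, v3) := cross1 v2 y1 in (z3 ⊗ₜ tcons w2 y2) ⊗ₜ v3).
  rewrite [RHS]tlift_swap; let_congr w1 v1.
  rewrite (yb_eqE v1 y z IH (K := fun z2 y2 v3 => let⊗ (z3, w2) := cross1 w1 z2 in
     (z3 ⊗ₜ tcons w2 y2) ⊗ₜ v3)); [|lin..].
  let_congr z1 y1; let_congr z2 v2; exact: tlift_swap.
rewrite cross_cons; let_simp; let_congr z1 y1.
rewrite (yb_eqE v w z1 (@cross1_yb n) (K := fun z3 w2 v2 =>
   let⊗ (y2, v3) := cross1 v2 y1 in (z3 ⊗ₜ tcons w2 y2) ⊗ₜ v3)); [|lin..].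
let_simp; let_congr z2 w1; let_simp; let_congr z3 v1; rewrite cross1_cons; let_simp; let_congr w2 v2.
by let_simp; let_congr y2 v3; let_simp.
Qed.

Lemma cross_yb m n p : yb_eq (@cross m n) (@cross m p) (@cross n p).
Proof.
elim: m => [|m IH] x y z.
  rewrite cross_nil; let_simp; rewrite cross_nil; let_simp; let_congr z1 y1.
  by rewrite cross_nil; let_simp; rewrite cross_nil; let_simp.
move: x; apply: tcons_ext; [lin|lin|move=> v x].
transitivity (let⊗ (y1, x1) := cross x y in let⊗ (z1, x2) := cross x1 z in
  let⊗ (y2, v1) := cross1 v y1 in let⊗ (z2, v2) := cross1 v1 z1 in
  let⊗ (z3, y3) := cross y2 z2 in (z3 ⊗ₜ y3) ⊗ₜ tcons v2 x2).
  rewrite cross_cons; let_simp; let_congr y1 x1; let_simp; rewrite [in RHS]tlift_swap; let_congr y2 v1.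
  let_simp; rewrite cross_cons; let_simp; let_congr z1 x2; let_simp; let_congr z2 v2; by let_simp.
transitivity (let⊗ (y1, x1) := cross x y in let⊗ (z1, x2) := cross x1 z in
  let⊗ (z2, y2) := cross y1 z1 in let⊗ (z3, v1) := cross1 v z2 in
  let⊗ (y3, v2) := cross1 v1 y2 in (z3 ⊗ₜ y3) ⊗ₜ tcons v2 x2).
  let_congr y1 x1; let_congr z1 x2; rewrite (yb_eqE v y1 z1 (@cross1_cross_yb n p)
    (K := fun z3 y3 v2 => (z3 ⊗ₜ y3) ⊗ₜ tcons v2 x2)) //; lin.
rewrite (yb_eqE x y z IH (K := fun z2 y2 x2 => let⊗ (z3, v1) := cross1 v z2 in
  let⊗ (y3, v2) := cross1 v1 y2 in (z3 ⊗ₜ y3) ⊗ₜ tcons v2 x2)); [|lin..].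
let_congr z1 y1; rewrite cross_cons; let_simp; let_congr z2 x1; let_simp.
rewrite [LHS]tlift_swap; let_congr z3 v1; let_simp; rewrite cross_cons; let_simp; let_congr y2 x2.
by let_simp; let_congr y3 v2; let_simp.
Qed.
End Crossings.

#[export] Hint Extern 0 (GRing.linear_for _ (cross1 _ _)) => (exact: cross1_r) : lin.
#[export] Hint Extern 0 (GRing.linear_for _ (fun x => cross1 _ x _)) => (exact: cross1_l) : lin.
#[export] Hint Extern 0 (GRing.linear_for _ (cross _ _)) => (exact: cross_r) : lin.
#[export] Hint Extern 0 (GRing.linear_for _ (fun x => cross _ x _)) => (exact: cross_l) : lin.

(** * The reduced expression of a block permutation *)
Section BlockWord.

(** The word [a + l - 1, ..., a], which as a composition of operators moves the
    factor at position [a] to the right by [l] positions. *)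
Fixpoint row_word a l := if l is l'.+1 then (a + l')%N :: row_word a l' else [::].

Fixpoint block_word a j r :=
  if r is r'.+1 then row_word a j ++ block_word a.+1 j r' else [::].

Lemma row_wordS a l : row_word a.+1 l = map S (row_word a l).
Proof. by elim: l => //= l ->. Qed.

Lemma block_wordS a j r : block_word a.+1 j r = map S (block_word a j r).
Proof. by elim: r a => //= r IH a; rewrite map_cat row_wordS IH. Qed.

Lemma row_word_rcons l : row_word 0 l.+1 = rcons (map S (row_word 0 l)) 0%N.
Proof. by elim: l => // l IH; rewrite -[LHS]/(l.+1 :: row_word 0 l.+1) [in LHS]IH. Qed.

(** The greedy algorithm selects the first descent. *)
Lemma find_iota (P : pred nat) n q : (q < n)%N -> P q ->
  (forall p, (p < q)%N -> ~~ P p) -> find P (iota 0 n) = q.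
Proof.
move=> qn Pq nP; have h : has P (iota 0 n).
  by apply/hasP; exists q => //; rewrite mem_iota.
have lt_n : (find P (iota 0 n) < n)%N by rewrite -[ltnRHS](size_iota 0 n) -has_find.
have := nth_find 0%N h; rewrite nth_iota // add0n => Pf.
have [lt|gt|//] := ltngtP (find P (iota 0 n)) q.
  by have := nP _ lt; rewrite Pf.
by have := before_find 0%N gt; rewrite nth_iota // add0n Pq.
Qed.

Section Descents.
Variables (n : nat) (w : 'S_n) (g : nat -> nat).
Hypothesis wg : forall p : 'I_n, (w^-1)%g p = g p :> nat.

Lemma ldescentE p : (p.+1 < n)%N -> ldescent w p = (g p.+1 < g p)%N.
Proof.
by move=> lt_p; have lt_p' := ltnW lt_p; rewrite /ldescent !insubT !wg.
Qed.

Lemma ldescentN p : (n <= p.+1)%N -> ldescent w p = false.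
Proof.
move=> le_p; rewrite /ldescent; case: insub => // a.
by rewrite insubF // ltnNge le_p.
Qed.

Lemma adj_permV q : (q.+1 < n)%N -> forall p : 'I_n,
  ((w * adj_perm n q)^-1)%g p =
  (if p == q :> nat then g q.+1 else if p == q.+1 :> nat then g q else g p) :> nat.
Proof.
move=> lt_q p; have lt_q' := ltnW lt_q; rewrite /adj_perm !insubT /=.
rewrite invMg tpermV permM wg; case: tpermP => [->|->|] /=.
- by rewrite eqxx.
- by rewrite eqxx gtn_eqF.
by move=> /eqP; rewrite -val_eqE /= => /negPf -> /eqP; rewrite -val_eqE /= => /negPf ->.
Qed.
End Descents.

(** The inverse of the permutation that is left of [chi i j] after stripping
    letters on the left: the elements below [a] are fixed, [a] crosses only the
    first [l] elements of the second block, and the later elements of the first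
    block cross all of it. If [0 < l], its first descent is [a + l - 1]. *)
Definition stripped i j a l p : nat :=
  if (p < a)%N then p else if (p < a + l)%N then (i + p - a)%N
  else if p == (a + l)%N then a
  else if (p <= a + j)%N then (i + p - a - 1)%N else (p - j)%N.

Ltac case_stripped := rewrite /stripped; repeat case: ifPn => ?; lia.

(** [r] is the number of elements of the first block after [a]. The stage where
    [a] has [l = 0] is also the one where [a.+1] has [l = j], so passing to the
    next row produces no letter. *)
Lemma red_word_rec_stripped j r l a fuel n (w : 'S_n) : (l <= j)%N ->
  n = (a + r.+1 + j)%N -> (l + r * j <= fuel)%N ->
  (forall p : 'I_n, (w^-1)%g p = stripped (a + r.+1) j a l p :> nat) ->
  red_word_rec fuel w = row_word a l ++ block_word a.+1 j r.
Proof.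
elim: r l a fuel w => [|r IHr] l.
  elim: l => [|l IHl] a fuel w le_l en fl wg.
    case: fuel fl => // fuel _ /=; rewrite hasNfind ?size_iota ?ltnn //.
    apply/hasPn => p; rewrite mem_iota add0n => /andP[_ lt_p].
    have [le_n|lt_n] := leqP n p.+1; first by rewrite ldescentN.
    by rewrite (ldescentE wg lt_n); case_stripped.
  case: fuel fl => [|fuel] fl; first by lia.
  have lt_n : ((a + l).+1 < n)%N by lia.
  rewrite /= (@find_iota _ _ (a + l)); first 1 last.
  - by lia.
  - by rewrite (ldescentE wg lt_n); case_stripped.
  - by move=> p lt_p; rewrite (ldescentE wg); case_stripped.
  have -> : (a + l < n)%N by lia.
  congr (_ :: _); apply: IHl; [lia|exact: en|lia|].
  move=> p; rewrite (adj_permV wg lt_n); have := ltn_ord p; case_stripped.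
elim: l => [|l IHl] a fuel w le_l en fl wg.
  rewrite /=; apply: IHr; [lia|lia|lia|].
  by move=> p; rewrite wg; have := ltn_ord p; case_stripped.
case: fuel fl => [|fuel] fl; first by lia.
have lt_n : ((a + l).+1 < n)%N by lia.
rewrite /= (@find_iota _ _ (a + l)); first 1 last.
- by lia.
- by rewrite (ldescentE wg lt_n); case_stripped.
- by move=> p lt_p; rewrite (ldescentE wg); case_stripped.
have -> : (a + l < n)%N by lia.
congr (_ :: _); apply: IHl; [lia|exact: en|lia|].
move=> p; rewrite (adj_permV wg lt_n); have := ltn_ord p; case_stripped.
Qed.

Lemma red_word_chi i j : (0 < i)%N -> red_word (chi i j) = block_word 0 j i.
Proof.
case: i => // i _; apply: (@red_word_rec_stripped j i j 0) => //; first by nia.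
move=> p; have := chiE ((chi i.+1 j)^-1%g p); rewrite permKV.
by move: ((chi i.+1 j)^-1%g p) => x; have := ltn_ord x; have := ltn_ord p; case_stripped.
Qed.
End BlockWord.

(** * The braiding of tensor powers is the recursive one *)
Notation tcast := Defs.tcast.

Section Casts.
Variables (k : fieldType) (V : lmodType k).
Local Notation tpow := (@tpow k V).

Lemma tcast_lin m n (e : m = n) : linear (@tcast k V m n e).
Proof. by case: n / e. Qed.

Lemma tcast_id m (e : m = m) (x : tpow m) : tcast e x = x.
Proof. by rewrite (eq_axiomK e). Qed.

Lemma tcast_comp m n p (e : m = n) (e' : n = p) (x : tpow m) :
  tcast e' (tcast e x) = tcast (etrans e e') x.
Proof. by case: p / e'; rewrite tcast_id; congr tcast; exact: eq_irrelevance. Qed.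

Lemma tcast_irr m n (e e' : m = n) (x : tpow m) : tcast e x = tcast e' x.
Proof. by congr tcast; exact: eq_irrelevance. Qed.

Lemma tcast_cons m n (e : m = n) (e' : m.+1 = n.+1) v (x : tpow m) :
  tcast e' (tcons v x) = tcons v (tcast e x).
Proof. by case: n / e e' => e'; rewrite tcast_id. Qed.

Lemma tcat2_scalr n (e : n = (n + 0)%N) (y : tpow n) (c : tpow 0) :
  tcat2 y c = tcast e (tscal c *: y).
Proof.
elim: n e y => [|n IH] e y.
  by rewrite tcast_id tcat2_scal; apply: mulrC.
move: y; apply: tcons_ext => [||v y].
- by lin.
- by apply: (linear_comp_on (f := tcast e)); [exact: tcast_lin|exact: linear_scalef].
have e' : n = (n + 0)%N by rewrite addn0.
rewrite tcat2_tcons (IH e') -(linearZ_on (tcons_r v)).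
by rewrite (@tcast_cons n (n + 0) e').
Qed.
End Casts.

#[export] Hint Extern 0 (GRing.linear_for _ (tcast _)) => (exact: tcast_lin) : lin.

Section Beta.
Variables (k : fieldType) (V : lmodType k) (s : {linear V ⊗ V -> V ⊗ V}).
Local Notation tpow := (@tpow k V).

Definition brd_word n (r : seq nat) (x : tpow n) : tpow n :=
  foldr (fun i y => brd_at s i y) x r.

Lemma brd_word_linear n r : linear (@brd_word n r).
Proof.
elim: r => [|i r IH] //; apply: (linear_comp_on (f := @brd_at k V s i n)) => //.
by apply: brd_at_linear; exact: linear_on.
Qed.
Hint Extern 0 (GRing.linear_for _ (brd_word _)) => (exact: brd_word_linear) : lin.

Lemma brd_word_cast m n (e : m = n) r x :
  brd_word r (tcast e x) = tcast e (brd_word r x).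
Proof. by case: n / e. Qed.

Lemma brd_word_cat n r1 r2 (x : tpow n) :
  brd_word (r1 ++ r2) x = brd_word r1 (brd_word r2 x).
Proof. exact: foldr_cat. Qed.

Lemma brd_at_cons n i v (x : tpow n) : brd_at s i.+1 (tcons v x) = tcons v (brd_at s i x).
Proof.
apply: (@tmapE k V V (tpow n) (tpow n) idfun (@brd_at k V s i n)).
- exact: linear_id.
- by apply: brd_at_linear; exact: linear_on.
Qed.

Lemma brd_at0 n v w (x : tpow n) : brd_at s 0 (tcons v (tcons w x)) =
  let⊗ (w1, v1) := s (v ⊗ₜ w) in tcons w1 (tcons v1 x).
Proof.
have -> : brd_at s 0 (tcons v (tcons w x)) =
  @tassoc k V V (tpow n) (tmap s idfun (tunassoc (v ⊗ₜ (w ⊗ₜ x)))) by [].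
rewrite tunassocE tmapE; [|exact: linear_on|exact: linear_on].
rewrite -{1}(tlift_eta (s (v ⊗ₜ w))) (tlift_comp (L := fun t => t ⊗ₜ idfun x)); last exact: tpure_l.
rewrite (tlift_comp (L := @tassoc k V V (tpow n))); last exact: linear_on.
by apply: eq_tlift => w1 v1; rewrite tassocE.
Qed.

Lemma brd_word_cons n r v (x : tpow n) :
  brd_word (map S r) (tcons v x) = tcons v (brd_word r x).
Proof.
elim: r => // i r IH.
by rewrite -[LHS]/(brd_at s i.+1 (brd_word (map S r) (tcons v x))) IH brd_at_cons.
Qed.

(** A row of letters performs the crossing of one vector; the cast records that
    the crossing vector now comes after [y1]. *)
Lemma brd_word_row j n v (y : tpow j) (x : tpow n) :
  brd_word (row_word 0 j) (tcons v (tcat2 y x) : tpow (j + n).+1) =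
  let⊗ (y1, v1) := cross1 s v y in
  tcast (addnS j n) (tcat2 y1 (tcons v1 x)).
Proof.
elim: j v y => [|j IH] v y.
  rewrite cross1_nil; rewrite tlift_pure; last by lin.
  by rewrite tcast_id !tcat2_scal (linearZ_on (tcons_r v)).
move: y; apply: tcons_ext; [by lin|by lin|move=> w y].
rewrite row_word_rcons -cats1 brd_word_cat tcat2_tcons [brd_word [:: _] _]brd_at0.
rewrite (tlift_comp _ _ (@brd_word_linear _ _)) cross1_cons; let_simp; let_congr w1 v1.
rewrite brd_word_cons IH; let_simp; rewrite (tlift_comp _ _ (tcons_r w1)); let_congr y1 v2; let_simp.
by rewrite tcat2_tcons (tcast_cons (addnS j n)).
Qed.

Lemma brd_word_block m n (x : tpow m) (y : tpow n) :
  brd_word (block_word 0 n m) (tcat2 x y) =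
  let⊗ (y1, x1) := cross s x y in tcast (addnC n m) (tcat2 y1 x1).
Proof.
elim: m x => [|m IH] x.
  rewrite cross_nil; rewrite tlift_pure; last by lin.
  rewrite (@tcat2_scalr _ _ _ (esym (addn0 n))) tcast_comp tcast_id.
  by rewrite tcat2_scal.
move: x; apply: tcons_ext; [by lin|by lin|move=> v x].
rewrite -[block_word 0 n m.+1]/(row_word 0 n ++ block_word 1 n m).
rewrite brd_word_cat block_wordS tcat2_tcons brd_word_cons IH.
rewrite (tlift_comp _ _ (tcons_r v)) (tlift_comp _ _ (@brd_word_linear _ _)).
rewrite cross_cons; let_simp; let_congr y1 x1; let_simp.
rewrite -(tcast_cons (addnC n m) (congr1 S (addnC n m))) brd_word_cast brd_word_row.
rewrite (tlift_comp _ _ (@tcast_lin _ _ _ _ _)); let_congr y2 v1; let_simp.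
by rewrite tcast_comp; apply: tcast_irr.
Qed.

Lemma betaE m n (x : tpow m.+1) (y : tpow n) : beta s (x ⊗ₜ y) = cross s x y.
Proof.
rewrite /beta tcatE /T_w red_word_chi // -/(brd_word _ _) brd_word_block.
rewrite (tlift_comp _ _ (@tcast_lin _ _ _ _ _)) (tlift_comp _ _ (@tsplit_linear _ _ _ _)).
rewrite -[RHS]tlift_eta; let_congr y1 x1.
by rewrite tcast_comp tcast_id tsplit_cat2.
Qed.
End Beta.

(** * Braided products on elements *)
Section ThreeFactors.
Variable k : fieldType.

Lemma bilin_on (A B P : lmodType k) (f : {bilinear A -> B -> P}) : bilin f.
Proof. by split=> [b|a] c x y; [exact: linearPl|exact: linearPr]. Qed.

Lemma bilin_l (A B P : lmodType k) (f : {bilinear A -> B -> P}) b :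
  linear (fun a => f a b).
Proof. by have [h _] := bilin_on f. Qed.

Lemma bilin_r (A B P : lmodType k) (f : {bilinear A -> B -> P}) a : linear (f a).
Proof. by have [_ h] := bilin_on f. Qed.

Lemma tensor3_ext (A B C P : lmodType k) (f g : (A ⊗ B) ⊗ C -> P) :
  linear f -> linear g ->
  (forall a b c, f ((a ⊗ₜ b) ⊗ₜ c) = g ((a ⊗ₜ b) ⊗ₜ c)) -> f =1 g.
Proof.
move=> lf lg fg; apply: tensor_ext => // t c; move: t.
by apply: tensor_ext => [||a b]; [lin|lin|exact: fg].
Qed.

Section Braiding.
Variables (D : lmodType k) (tau : {linear D ⊗ D -> D ⊗ D}).

Lemma brd1_linear : linear (brd1 tau).
Proof. by apply: tmap_linear; exact: linear_on. Qed.

Lemma brd2_linear : linear (brd2 tau).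
Proof.
have l : linear (tmap idfun tau : D ⊗ (D ⊗ D) -> _) by apply: tmap_linear; exact: linear_on.
rewrite /brd2; lin.
Qed.

Lemma brd1E a b c : brd1 tau ((a ⊗ₜ b) ⊗ₜ c) =
  let⊗ (x, y) := tau (a ⊗ₜ b) in (x ⊗ₜ y) ⊗ₜ c.
Proof.
rewrite /brd1 tmapE; [|exact: linear_on|exact: linear_on].
by rewrite -{1}(tlift_eta (tau _)) (tlift_comp _ _ (@tpure_l _ _ _ _)).
Qed.

Lemma brd2E a b c : brd2 tau ((a ⊗ₜ b) ⊗ₜ c) =
  let⊗ (x, y) := tau (b ⊗ₜ c) in (a ⊗ₜ x) ⊗ₜ y.
Proof.
rewrite /brd2 tassocE tmapE; [|exact: linear_on|exact: linear_on].
rewrite -{1}(tlift_eta (tau _)) (tlift_comp _ _ (@tpure_r _ _ _ _)).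
rewrite (tlift_comp (L := @tunassoc k _ _ _)); last exact: linear_on.
by let_congr x y; rewrite tunassocE.
Qed.

Let op a b := tau (a ⊗ₜ b).

Lemma is_braidingP : is_braiding tau <-> yb_eq op op op.
Proof.
have e1 a b c : brd1 tau (brd2 tau (brd1 tau ((a ⊗ₜ b) ⊗ₜ c))) =
  (let⊗ (b1, a1) := op a b in let⊗ (c1, a2) := op a1 c in
   let⊗ (c2, b2) := op b1 c1 in (c2 ⊗ₜ b2) ⊗ₜ a2).
  rewrite brd1E (tlift_comp _ _ brd2_linear) (tlift_comp _ _ brd1_linear); let_congr b1 a1.
  by rewrite brd2E (tlift_comp _ _ brd1_linear); let_congr c1 a2; rewrite brd1E.
have e2 a b c : brd2 tau (brd1 tau (brd2 tau ((a ⊗ₜ b) ⊗ₜ c))) =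
  (let⊗ (c1, b1) := op b c in let⊗ (c2, a1) := op a c1 in
   let⊗ (b2, a2) := op a1 b1 in (c2 ⊗ₜ b2) ⊗ₜ a2).
  rewrite brd2E (tlift_comp _ _ brd1_linear) (tlift_comp _ _ brd2_linear); let_congr b1 a1.
  by rewrite brd1E (tlift_comp _ _ brd2_linear); let_congr c1 a2; rewrite brd2E.
split=> [h a b c|h]; first by have := h ((a ⊗ₜ b) ⊗ₜ c); rewrite e1 e2.
have l1 := brd1_linear; have l2 := brd2_linear.
by apply: tensor3_ext => [||a b c]; [lin|lin|rewrite e1 e2].
Qed.

Section Compat.
Variable m : {bilinear D -> D -> D}.

(** [braid_compat] evaluated on pure tensors. *)
Definition crosses_product :=
  (forall a b c, tau (a ⊗ₜ m b c) = let⊗ (b1, a1) := tau (a ⊗ₜ b) in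
     let⊗ (c1, a2) := tau (a1 ⊗ₜ c) in m b1 c1 ⊗ₜ a2) /\
  (forall a b c, tau (m a b ⊗ₜ c) = let⊗ (c1, b1) := tau (b ⊗ₜ c) in
     let⊗ (c2, a1) := tau (a ⊗ₜ c1) in c2 ⊗ₜ m a1 b1).

Lemma braid_compatP : braid_compat tau m <-> crosses_product.
Proof.
have lm : linear (tlift m) by apply: tlift_linear; exact: bilin_on.
have mE a b : tlift m (a ⊗ₜ b) = m a b by rewrite tlift_pure //; exact: bilin_on.
have lid : linear (@idfun D) by exact: linear_on.
have l1 := brd1_linear; have l2 := brd2_linear.
have lmi : linear (tmap (tlift m) idfun : (D ⊗ D) ⊗ D -> _) by exact: tmap_linear.
have lim : linear (tmap idfun (tlift m) : D ⊗ (D ⊗ D) -> _) by exact: tmap_linear.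
have e1 a b c : tau (tmap idfun (tlift m) (tassoc ((a ⊗ₜ b) ⊗ₜ c))) = tau (a ⊗ₜ m b c).
  by rewrite tassocE tmapE // mE.
have e2 a b c : tau (tmap (tlift m) idfun ((a ⊗ₜ b) ⊗ₜ c)) = tau (m a b ⊗ₜ c).
  by rewrite tmapE // mE.
have f1 a b c : tmap (tlift m) idfun (brd2 tau (brd1 tau ((a ⊗ₜ b) ⊗ₜ c))) =
   let⊗ (b1, a1) := tau (a ⊗ₜ b) in
   let⊗ (c1, a2) := tau (a1 ⊗ₜ c) in m b1 c1 ⊗ₜ a2.
  rewrite brd1E (tlift_comp _ _ l2) (tlift_comp _ _ lmi); let_congr b1 a1.
  by rewrite brd2E (tlift_comp _ _ lmi); let_congr c1 a2; rewrite tmapE // mE.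
have f2 a b c : tmap idfun (tlift m) (tassoc (brd1 tau (brd2 tau ((a ⊗ₜ b) ⊗ₜ c)))) =
   let⊗ (c1, b1) := tau (b ⊗ₜ c) in
     let⊗ (c2, a1) := tau (a ⊗ₜ c1) in c2 ⊗ₜ m a1 b1.
  have la : linear (fun t : (D ⊗ D) ⊗ D => tmap idfun (tlift m) (tassoc t)) by lin.
  rewrite brd2E (tlift_comp _ _ l1) (tlift_comp _ _ la); let_congr b1 a1.
  by rewrite brd1E (tlift_comp _ _ la); let_congr c1 a2; rewrite tassocE tmapE // mE.
split=> [[h1 h2]|[h1 h2]]; split.
- by move=> a b c; rewrite -e1 h1 f1.
- by move=> a b c; rewrite -e2 h2 f2.
- by apply: tensor3_ext => [||a b c]; [lin|lin|rewrite e1 h1 f1].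
- by apply: tensor3_ext => [||a b c]; [lin|lin|rewrite e2 h2 f2].
Qed.
End Compat.
End Braiding.
End ThreeFactors.

(** * Products of decorated trees *)

#[export] Hint Extern 0 (GRing.linear_for _ (ytree _)) => (exact: ytree_linear) : lin.
#[export] Hint Extern 0 (GRing.linear_for _ (ybtree _)) => (exact: ybtree_linear) : lin.
#[export] Hint Extern 0 (GRing.linear_for _ (ygraft _ _)) => (exact: ygraft_linearr) : lin.
#[export] Hint Extern 0 (GRing.linear_for _ (fun x => ygraft x _ _)) => (exact: ygraft_linearl) : lin.
#[export] Hint Extern 0 (GRing.linear_for _ (fun x => ygraft _ x _)) => (exact: ygraft_linear) : lin.
#[export] Hint Extern 0 (GRing.linear_for _ (@yincl _ _)) => (exact: yincl_linear) : lin.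
#[export] Hint Extern 0 (GRing.linear_for _ (@yproj _ _)) => (exact: yproj_linear) : lin.
#[export] Hint Extern 0 (GRing.linear_for _ (@ystar _ _ _)) => (exact: ystar_linearr) : lin.
#[export] Hint Extern 0 (GRing.linear_for _ (fun x => @ystar _ _ x _)) => (exact: ystar_linearl) : lin.
#[export] Hint Extern 0 (GRing.linear_for _ (@yprec _ _ _)) => (exact: yprec_linearr) : lin.
#[export] Hint Extern 0 (GRing.linear_for _ (fun x => @yprec _ _ x _)) => (exact: yprec_linearl) : lin.
#[export] Hint Extern 0 (GRing.linear_for _ (@ysucc _ _ _)) => (exact: ysucc_linearr) : lin.
#[export] Hint Extern 0 (GRing.linear_for _ (fun x => @ysucc _ _ x _)) => (exact: ysucc_linearl) : lin.
#[export] Hint Extern 0 (GRing.linear_for _ (@bprec _ _ _)) => (exact: bilin_r) : lin.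
#[export] Hint Extern 0 (GRing.linear_for _ (fun x => @bprec _ _ x _)) => (exact: bilin_l) : lin.
#[export] Hint Extern 0 (GRing.linear_for _ (@bsucc _ _ _)) => (exact: bilin_r) : lin.
#[export] Hint Extern 0 (GRing.linear_for _ (fun x => @bsucc _ _ x _)) => (exact: bilin_l) : lin.

Section TreeSums.
Variables (k : fieldType) (V : lmodType k).
Local Notation tpow := (@tpow k V).
Local Notation yspace := (@yspace k V).

(** [x1], [u] and [x2] are the decorations of the left branch, the root and the
    right branch of a tree of the form [Node l r]. *)
Lemma tcat2_cons_ext (P : lmodType k) p q (f g : tpow (p + q.+1) -> P) :
  linear f -> linear g ->
  (forall (x1 : tpow p) u (x2 : tpow q),
     f (tcat2 x1 (tcons u x2)) = g (tcat2 x1 (tcons u x2))) -> f =1 g.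
Proof.
move=> lf lg fg x; rewrite -(@tsplitK _ V p q.+1 x); move: (tsplit _) => t.
have l (h : tpow (p + q.+1) -> P) : linear h -> linear (fun t => h (@tcat k V p q.+1 t)).
  move=> lh; apply: (linear_comp_on (f := h)) => //; exact: tcat_linear.
move: t; apply: tensor_ext; [exact: l|exact: l|move=> x1].
have l1 (h : tpow (p + q.+1) -> P) : linear h -> linear (fun w : tpow q.+1 => h (@tcat k V p q.+1 (x1 ⊗ₜ w))).
  by move=> lh; apply: (linear_comp_on (g := tpure x1) (l h lh)); exact: tpure_linearr.
by apply: tcons_ext => [||u x2]; [exact: l1|exact: l1|rewrite tcatE].
Qed.

Lemma node_lift_cat (P : lmodType k) p q (f : tpow p -> V -> tpow q -> P) x1 u x2 :
  trilinear f -> node_lift f (tcat2 x1 (tcons u x2)) = f x1 u x2.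
Proof. exact: node_liftE. Qed.

Lemma ygraft_tree (u : V) m (Y : bt m) x n (Y' : bt n) x' :
  ygraft (ytree Y x) u (ytree Y' x') = ytree (Node Y Y') (tcat2 x (tcons u x')).
Proof. exact: ygraftE. Qed.

Lemma tcat2_assoc m n p (x : tpow m) (y : tpow n) (z : tpow p) :
  tcat2 x (tcat2 y z) = tcast (esym (addnA m n p)) (tcat2 (tcat2 x y) z).
Proof.
elim: m x => [|m IH] x.
  by rewrite tcast_id !tcat2_scal (linearZ_on (tcat2_l z)).
move: x; apply: tcons_ext; [by lin|by lin|move=> v x].
by rewrite !tcat2_tcons IH -(tcast_cons _ (congr1 S (esym (addnA m n p)))); exact: tcast_irr.
Qed.

Lemma ytree_cast m n (e : m = n) (Z : bt m) (x : tpow n) :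
  ytree (ecast n (bt n) e Z) x = ytree Z (tcast (esym e) x).
Proof. by case: n / e x. Qed.

(** Grafting keeps the decorations in order, so that the new trees are the
    grafts of the old ones; the casts only account for the associativity of the
    addition of sizes. *)
Lemma graft_sum_right p q n (l : bt p) (r : seq (bt (q + n))) :
  exists r' : seq (bt (p + q.+1 + n)), forall (x : tpow (p + q.+1)) (x' : tpow n),
  node_lift (fun x1 u x2 =>
    ygraft (ytree l x1) u (\sum_(Z <- r) ytree Z (tcat2 x2 x'))) x =
  \sum_(Z <- r') ytree Z (tcat2 x x').
Proof.
have e : (p + (q + n).+1 = p + q.+1 + n)%N by rewrite -addnA.
exists [seq ecast n (bt n) e (Node l Z) | Z <- r] => x x'.
have tri : trilinear (fun (x1 : tpow p) u (x2 : tpow q) =>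
    ygraft (ytree l x1) u (\sum_(Z <- r) ytree Z (tcat2 x2 x'))).
  by split=> *; lin.
move: x; apply: tcat2_cons_ext; [exact: node_lift_linear|lin|move=> x1 u x2].
rewrite node_lift_cat // (linear_sum_on (ygraft_linearr _ _)) big_map.
apply: eq_bigr => Z _; rewrite ygraft_tree ytree_cast; congr ytree.
by rewrite -tcat2_tcons (tcat2_assoc x1 (tcons u x2) x'); exact: tcast_irr.
Qed.

Lemma graft_sum_left p q m (t : bt q) (r : seq (bt (m + p))) :
  exists r' : seq (bt (m + (p + q.+1))), forall (x : tpow m) (x' : tpow (p + q.+1)),
  node_lift (fun x1 u x2 =>
    ygraft (\sum_(Z <- r) ytree Z (tcat2 x x1)) u (ytree t x2)) x' =
  \sum_(Z <- r') ytree Z (tcat2 x x').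
Proof.
have e : (m + p + q.+1 = m + (p + q.+1))%N by rewrite addnA.
exists [seq ecast n (bt n) e (Node Z t) | Z <- r] => x x'.
have tri : trilinear (fun (x1 : tpow p) u (x2 : tpow q) =>
    ygraft (\sum_(Z <- r) ytree Z (tcat2 x x1)) u (ytree t x2)).
  by split=> *; lin.
move: x'; apply: tcat2_cons_ext; [exact: node_lift_linear|lin|move=> x1 u x2].
rewrite node_lift_cat // (linear_sum_on (ygraft_linearl _ _)) big_map.
apply: eq_bigr => Z _; rewrite ygraft_tree ytree_cast; congr ytree.
by rewrite tcat2_assoc tcast_comp; rewrite tcast_id.
Qed.

(** The operation [f] is given by a formal sum [r] of undecorated trees, whose
    decorations are obtained by concatenation. *)
Definition decoration_free m n (f : tpow m -> tpow n -> yspace) :=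
  exists r : seq (bt (m + n)), forall x x', f x x' = \sum_(Z <- r) ytree Z (tcat2 x x').

Lemma decoration_free_right p q n (l : bt p) (f : tpow q -> tpow n -> yspace) :
  decoration_free f -> decoration_free (fun (x : tpow (p + q.+1)) x' =>
    node_lift (fun x1 u x2 => ygraft (ytree l x1) u (f x2 x')) x).
Proof.
case=> r fr; have [r' h] := graft_sum_right l r; exists r' => x x'; rewrite -h.
by congr node_lift; do 3!apply: funext => ?; rewrite fr.
Qed.

Lemma decoration_free_left p q m (t : bt q) (f : tpow m -> tpow p -> yspace) :
  decoration_free f -> decoration_free (fun x (x' : tpow (p + q.+1)) =>
    node_lift (fun x1 u x2 => ygraft (f x x1) u (ytree t x2)) x').
Proof.
case=> r fr; have [r' h] := graft_sum_left t r; exists r' => x x'; rewrite -h.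
by congr node_lift; do 3!apply: funext => ?; rewrite fr.
Qed.

Lemma ystar2_free m (Y : bt m) n (Y' : bt n) : decoration_free (@ystar2 k V m Y n Y').
Proof.
elim: Y n Y' => {m} [|p q l _ r IHr] n Y'.
  exists [:: Y'] => c x'; rewrite big_seq1 tcat2_scal.
  by rewrite (linearZ_on (ytree_linear Y')).
elim: Y' => {n} [|p' q' l' IHl r' _].
  have e : (p + q.+1 = p + q.+1 + 0)%N by rewrite addn0.
  exists [:: ecast n (bt n) e (Node l r)] => x c.
  rewrite big_seq1 ytree_cast (@tcat2_scalr _ _ _ e) tcast_comp tcast_id.
  by rewrite (linearZ_on (ytree_linear _)).
have [r1 h1] := decoration_free_right l (IHr _ (Node l' r')).
have [r2 h2] := decoration_free_left r' IHl.
by exists (r1 ++ r2) => x x'; rewrite big_cat -h1 -h2.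
Qed.

Lemma yprec2_free m (Y : bt m) n (Y' : bt n) : decoration_free (@yprec2 k V m Y n Y').
Proof.
case: Y => {m} [|p q l r]; first by exists [::] => x x'; rewrite big_nil.
exact: decoration_free_right (ystar2_free r Y').
Qed.

Lemma ysucc2_free m (Y : bt m) n (Y' : bt n) : decoration_free (@ysucc2 k V m Y n Y').
Proof.
case: Y' => {n} [|p q l r]; first by exists [::] => x x'; rewrite big_nil.
exact: decoration_free_left (ystar2_free Y l).
Qed.

Section Bar.
Variables (m n : nat) (Y : bt m.+1) (Y' : bt n.+1).

Lemma bprec_sum : exists r : seq (bt (m.+1 + n.+1)), forall (x : tpow m.+1) (x' : tpow n.+1),
  bprec (ybtree Y x) (ybtree Y' x') =
  \sum_(Z <- r) @ybtree k V (m + n.+1) Z (tcat2 x x').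
Proof.
have [r h] := yprec2_free Y Y'; exists r => x x'.
rewrite /bprec !yinclE yprecT h (linear_sum_on (@yproj_linear _ _)).
by apply: eq_bigr => Z _; exact: (@yprojS k V (m + n.+1)).
Qed.

Lemma bsucc_sum : exists r : seq (bt (m.+1 + n.+1)), forall (x : tpow m.+1) (x' : tpow n.+1),
  bsucc (ybtree Y x) (ybtree Y' x') =
  \sum_(Z <- r) @ybtree k V (m + n.+1) Z (tcat2 x x').
Proof.
have [r h] := ysucc2_free Y Y'; exists r => x x'.
rewrite /bsucc !yinclE ysuccT h (linear_sum_on (@yproj_linear _ _)).
by apply: eq_bigr => Z _; exact: (@yprojS k V (m + n.+1)).
Qed.
End Bar.
End TreeSums.

(** * The braiding on decorated trees *)
Section TreeBraiding.
Variables (k : fieldType) (V : lmodType k) (s : {linear V ⊗ V -> V ⊗ V}).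
Local Notation tpow := (@tpow k V).
Local Notation ybar := (@ybar k V).

Lemma sigmaBT_tree m (Y : bt m.+1) (x : tpow m.+1) n (Y' : bt n.+1) (x' : tpow n.+1) :
  sigmaBT s (ybtree Y x ⊗ₜ ybtree Y' x') =
  let⊗ (y, z) := cross s x x' in ybtree Y' y ⊗ₜ ybtree Y z.
Proof. by rewrite sigmaBTE betaE. Qed.

Lemma sigmaBT_lin : linear (sigmaBT s).
Proof. exact: linear_on. Qed.

(** For an operation that concatenates decorations, compatibility with the
    braiding is the compatibility of [cross] with concatenation. *)
Lemma crosses_tree_sum (op : {bilinear ybar -> ybar -> ybar}) :
  (forall m (Y : bt m.+1) n (Y' : bt n.+1),
   exists r : seq (bt (m.+1 + n.+1)), forall (x : tpow m.+1) (x' : tpow n.+1),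
   op (ybtree Y x) (ybtree Y' x') =
   \sum_(Z <- r) @ybtree k V (m + n.+1) Z (tcat2 x x')) ->
  crosses_product (sigmaBT s) op.
Proof.
move=> opE; have ls := sigmaBT_lin; have l1 := bilin_l op; have l2 := bilin_r op.
(* It suffices to consider trees, in each of the three arguments. *)
have ext3 (f g : ybar -> ybar -> ybar -> ybar ⊗ ybar) :
    (forall b c, linear (fun a => f a b c)) -> (forall b c, linear (fun a => g a b c)) ->
    (forall a c, linear (fun b => f a b c)) -> (forall a c, linear (fun b => g a b c)) ->
    (forall a b, linear (f a b)) -> (forall a b, linear (g a b)) ->
    (forall m (X : bt m.+1) x n (Y : bt n.+1) y p (Z : bt p.+1) z,
       f (ybtree X x) (ybtree Y y) (ybtree Z z) = g (ybtree X x) (ybtree Y y) (ybtree Z z)) ->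
    forall a b c, f a b c = g a b c.
  move=> f1 g1 f2 g2 f3 g3 fg a b c.
  move: a; apply: ybar_ext => [||m X x] //; move: b; apply: ybar_ext => [||n Y y] //.
  by move: c; apply: ybar_ext => [||p Z z].
split.
  apply: (ext3 (fun a b c => sigmaBT s (a ⊗ₜ op b c))
    (fun a b c => let⊗ (b1, a1) := sigmaBT s (a ⊗ₜ b) in
       let⊗ (c1, a2) := sigmaBT s (a1 ⊗ₜ c) in op b1 c1 ⊗ₜ a2));
    [lin|lin|lin|lin|lin|lin|move=> m X x n Y y p Z z].
  have [r h] := opE _ Y _ Z.
  have l w1 : linear (fun w : ybar => sigmaBT s (w1 ⊗ₜ w)) by lin.
  rewrite h (linear_sum_on (l _)).
  transitivity (let⊗ (w, x1) := cross s x (tcat2 y z) in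
      (\sum_(W <- r) @ybtree k V (n + p.+1) W w) ⊗ₜ ybtree X x1).
    under eq_bigr => W _ do rewrite (@sigmaBT_tree _ X _ (n + p.+1) W).
    rewrite tlift_sum; congr tlift; apply: funext => w; apply: funext => x1.
    by rewrite (linear_sum_on (tpure_l _)).
  rewrite (cross_catr s x y z); let_simp; rewrite sigmaBT_tree; let_simp; let_congr y1 x1; let_simp; let_simp.
  by rewrite sigmaBT_tree; let_simp; let_congr z1 x2; let_simp; let_simp; rewrite h.
apply: (ext3 (fun a b c => sigmaBT s (op a b ⊗ₜ c))
  (fun a b c => let⊗ (c1, b1) := sigmaBT s (b ⊗ₜ c) in
     let⊗ (c2, a1) := sigmaBT s (a ⊗ₜ c1) in c2 ⊗ₜ op a1 b1));
  [lin|lin|lin|lin|lin|lin|move=> m X x n Y y p Z z].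
have [r h] := opE _ X _ Y.
  have l w1 : linear (fun w : ybar => sigmaBT s (w ⊗ₜ w1)) by lin.
  rewrite h (linear_sum_on (l _)).
  transitivity (let⊗ (z1, w) := cross s (tcat2 x y) z in
      ybtree Z z1 ⊗ₜ (\sum_(W <- r) @ybtree k V (m + n.+1) W w)).
    under eq_bigr => W _ do rewrite (@sigmaBT_tree (m + n.+1) W _ _ Z).
    rewrite tlift_sum; congr tlift; apply: funext => w; apply: funext => x1.
    by rewrite (linear_sum_on (tpure_r _)).
  rewrite (cross_catl s x y z); let_simp; rewrite sigmaBT_tree; let_simp; let_congr z1 y1; let_simp; let_simp.
  by rewrite sigmaBT_tree; let_simp; let_congr z2 x1; let_simp; let_simp; rewrite h.
Qed.

Lemma sigmaBT_yb : yb_eq (fun u v => s (u ⊗ₜ v)) (fun u v => s (u ⊗ₜ v)) (fun u v => s (u ⊗ₜ v)) ->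
  yb_eq (fun a b => sigmaBT s (a ⊗ₜ b)) (fun a b => sigmaBT s (a ⊗ₜ b)) (fun a b => sigmaBT s (a ⊗ₜ b)).
Proof.
move=> yb_s a b c; have ls := sigmaBT_lin.
move: a; apply: ybar_ext => [||m X x]; [lin|lin|].
move: b; apply: ybar_ext => [||n Y y]; [lin|lin|].
move: c; apply: ybar_ext => [||p Z z]; [lin|lin|].
transitivity (let⊗ (y1, x1) := cross s x y in let⊗ (z1, x2) := cross s x1 z in
  let⊗ (z2, y2) := cross s y1 z1 in (ybtree Z z2 ⊗ₜ ybtree Y y2) ⊗ₜ ybtree X x2).
  rewrite sigmaBT_tree; let_simp; let_congr y1 x1; let_simp; rewrite sigmaBT_tree; let_simp; let_congr z1 x2; let_simp.
  by rewrite sigmaBT_tree; let_simp; let_congr z2 y2; let_simp.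
rewrite (yb_eqE x y z (@cross_yb k V s yb_s m.+1 n.+1 p.+1) (K := fun z2 y2 x2 =>
  (ybtree Z z2 ⊗ₜ ybtree Y y2) ⊗ₜ ybtree X x2)); [|lin..].
rewrite sigmaBT_tree; let_simp; let_congr z1 y1; let_simp; rewrite sigmaBT_tree; let_simp; let_congr z2 x1; let_simp.
by rewrite sigmaBT_tree; let_simp; let_congr y2 x2; let_simp.
Qed.

Lemma sigmaBT_iV : is_braided_hom s (sigmaBT s) (@iV k V).
Proof.
have li : linear (@iV k V) by exact: linear_on.
have ls := sigmaBT_lin.
have lt : linear (tmap (@iV k V) (@iV k V)) by exact: tmap_linear.
have iVT v : iV v = ybtree (Node Leaf Leaf) (tcons v ((1 : k^o) : tpow 0)) by exact: iVE.
apply: tensor_ext => [||u v]; [lin|lin|].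
rewrite tmapE // !iVT sigmaBT_tree cross_cons cross_nil; let_simp; let_simp.
rewrite cross1_cons; let_simp; let_congr v1 u1; rewrite cross1_nil; do ?let_simp.
by rewrite !iVT.
Qed.
End TreeBraiding.

(** * Trees form a dendriform algebra *)
Section TreeDendriform.
Variables (k : fieldType) (V : lmodType k).
Local Notation tpow := (@tpow k V).
Local Notation yspace := (@yspace k V).
Local Notation ybar := (@ybar k V).
Local Notation yunit := (@yunit k V).
Local Notation "a * b" := (@ystar k V a b).

Lemma ytree_Leaf (c : tpow 0) : ytree Leaf c = tscal c *: yunit.
Proof.
rewrite -(linearZ_on (@ytree_linear k V 0 Leaf)); congr ytree.
exact/esym/(@mulr1 k).
Qed.

Lemma Node_ext (P : lmodType k) p q (l : bt p) (r : bt q) (f g : yspace -> P) :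
  linear f -> linear g ->
  (forall x1 u x2, f (ygraft (ytree l x1) u (ytree r x2)) =
                   g (ygraft (ytree l x1) u (ytree r x2))) ->
  forall x, f (ytree (Node l r) x) = g (ytree (Node l r) x).
Proof.
move=> lf lg fg; apply: tcat2_cons_ext; [lin|lin|move=> x1 u x2].
by rewrite -ygraft_tree.
Qed.

Lemma ygraft_ext (P : lmodType k) (f g : yspace -> P) : linear f -> linear g ->
  f yunit = g yunit ->
  (forall z u z', f (ygraft z u z') = g (ygraft z u z')) -> f =1 g.
Proof.
move=> lf lg fg1 fg; apply: yspace_ext => // n [x|p q l r].
  by rewrite ytree_Leaf (linearZ_on lf) (linearZ_on lg) fg1.
by apply: Node_ext.
Qed.

Lemma ystar_graft a u b c v d :
  ygraft a u b * ygraft c v d =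
  ygraft a u (b * ygraft c v d) + ygraft (ygraft a u b * c) v d.
Proof.
rewrite -(yprojK_graft a u b) -(yprojK_graft c v d) ystar_bar !yprojK_graft.
by rewrite yprec_graft ysucc_graft.
Qed.

(** The expansions of [(X * Y) * Z] and [X * (Y * Z)] for three grafts each have
    a part where the root comes from [X], one where it comes from [Y] and one
    where it comes from [Z]. The parts with root in [Y] are equal, those with root
    in [X] reduce to the right branch of [X], and those with root in [Z] to the
    left branch of [Z]: hence an induction on [X] with an inner induction on [Z],
    and mere case analysis on [Y]. *)
Lemma ystar_assoc : associative (@ystar k V).
Proof.
move=> X Y Z; move: X Y Z.
suff h m (X : bt m) x Y Z : (ytree X x * Y) * Z = ytree X x * (Y * Z).
  move=> X Y Z; apply/esym; move: X.
  by apply: yspace_ext => [||m X x]; [lin|lin|exact: h].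
elim: X x Y Z => {m} [|p q l _ r IHr] x Y Z.
  rewrite ytree_Leaf; move: (tscal x) => c.
  rewrite (linearZ_on (ystar_linearl Y)) (linearZ_on (ystar_linearl Z)).
  by rewrite (linearZ_on (ystar_linearl (Y * Z))) !ystar_unitl.
move: x; apply: (Node_ext (f := fun X => (X * Y) * Z) (g := fun X => X * (Y * Z)));
  [lin|lin|move=> x1 u x2].
move: (ytree l x1) (ytree r x2) (IHr x2) => {IHr x1 x2} a b IHb.
suff h m (Z0 : bt m) z Y0 :
    (ygraft a u b * Y0) * ytree Z0 z = ygraft a u b * (Y0 * ytree Z0 z).
  by move: Z; apply: yspace_ext => [||m Z z]; [lin|lin|exact: h].
elim: Z0 z Y0 => {m Y Z} [|p' q' l' IHl r' _] z Y.
  by rewrite ytree_Leaf !(linearZ_on (ystar_linearr _)) !ystar_unitr.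
move: z; apply: (Node_ext (f := fun Z => (_ * Y) * Z) (g := fun Z => _ * (Y * Z)));
  [lin|lin|move=> x1 v x2].
move: (ytree l' x1) (ytree r' x2) (IHl x1) => {IHl x1 x2} c d IHc.
move: Y; apply: (ygraft_ext (f := fun Y => (_ * Y) * _) (g := fun Y => _ * (Y * _)));
  [lin|lin|by rewrite ystar_unitr ystar_unitl|move=> e w f].
set E := ygraft e w f; set C := ygraft c v d; set X := ygraft a u b.
have XE : X * E = ygraft a u (b * E) + ygraft (X * e) w f by exact: ystar_graft.
have EC : E * C = ygraft e w (f * C) + ygraft (E * c) v d by exact: ystar_graft.
rewrite XE EC (linearD_on (ystar_linearl C)) (linearD_on (ystar_linearr X)).
rewrite (ystar_graft a u (b * E) c v d) (ystar_graft (X * e) w f c v d).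
rewrite (ystar_graft a u b e w (f * C)) (ystar_graft a u b (E * c) v d).
rewrite IHb EC (linearD_on (ystar_linearr b)) (linearD_on (ygraft_linearr u a)).
rewrite -/X -IHc XE (linearD_on (ystar_linearl c)) (linearD_on (ygraft_linearl v d)).
rewrite -!addrA; congr (_ + _); rewrite [RHS]addrCA; congr (_ + _).
by rewrite [LHS]addrCA.
Qed.

Lemma ybar_dendriform : is_dendriform (@bprec k V) (@bsucc k V).
Proof.
split=> x y z; apply: (can_inj (@yinclK k V)); rewrite ?(yincl_bprec, yincl_bsucc).
- rewrite (linearD_on (@yincl_linear k V)) yincl_bprec yincl_bsucc -ystar_bar.
  move: x; apply: (ybar_graft_ext (f := fun x => yprec (yprec x (yincl y)) (yincl z))
    (g := fun x => yprec x (yincl y * yincl z))); [lin|lin|move=> a u b].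
  by rewrite !yprec_graft ystar_assoc.
- move: y; apply: (ybar_graft_ext (f := fun y => yprec (ysucc (yincl x) y) (yincl z))
    (g := fun y => ysucc (yincl x) (yprec y (yincl z)))); [lin|lin|move=> a u b].
  by rewrite yprec_graft !ysucc_graft yprec_graft.
- rewrite (linearD_on (@yincl_linear k V)) yincl_bprec yincl_bsucc -ystar_bar.
  move: z; apply: (ybar_graft_ext (f := fun z => ysucc (yincl x * yincl y) z)
    (g := fun z => ysucc (yincl x) (ysucc (yincl y) z))); [lin|lin|move=> a u b].
  by rewrite !ysucc_graft ystar_assoc.
Qed.

End TreeDendriform.

(** * Evaluating trees in a dendriform algebra *)
Section Acts.
Variables (k : fieldType) (M : lmodType k) (op : M -> M -> M).

(** The actions on [M] of the element [c + b] of [k ⊕ M], that is, of the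
    algebra obtained from [M] by adding a unit. They treat uniformly the trivial
    tree, on which [c = 1] and [b = 0], and the other ones. *)
Definition ract (c : k^o) (b e : M) : M := (c : k) *: e + op e b.
Definition lact (c : k^o) (b e : M) : M := (c : k) *: e + op b e.
End Acts.

Section Evaluation.
Variables (k : fieldType) (V D : lmodType k).
Variables (precD succD : {bilinear D -> D -> D}) (phi : {linear V -> D}).
Hypothesis dend : is_dendriform precD succD.
Local Notation tpow := (@tpow k V).
Local Notation yspace := (@yspace k V).
Local Notation ybar := (@ybar k V).
Local Notation yunit := (@yunit k V).

(** The coefficient of the trivial tree. *)
Definition eps_tree n (Y : bt n) : tpow n -> k^o :=
  match Y in bt n return tpow n -> k^o with
  | Leaf => @tscal k V
  | Node _ _ _ _ => fun _ => 0
  end.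

(** [Node l r] with root [u] is [(l > u) < r]. The value [0] at the trivial tree
    is completed by [eps_tree]: together they form the value in [k ⊕ D]. *)
Fixpoint ev_tree n (Y : bt n) : tpow n -> D :=
  match Y in bt n return tpow n -> D with
  | Leaf => fun _ => 0
  | Node p q l r => node_lift (fun x1 u x2 =>
      ract precD (eps_tree r x2) (ev_tree r x2)
        (lact succD (eps_tree l x1) (ev_tree l x1) (phi u)))
  end.

Lemma eps_tree_linear n (Y : bt n) : linear (eps_tree Y).
Proof. by case: Y => [|p q l r] /=; [exact: tscal_linear|exact: linear_zero]. Qed.

Lemma ract_linear c b : linear (ract precD c b).
Proof.
apply: linear_addf; first exact: linear_scalef (@linear_id _ _).
exact: bilin_l.
Qed.

Lemma lact_linear c b : linear (lact succD c b).
Proof.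
apply: linear_addf; first exact: linear_scalef (@linear_id _ _).
exact: bilin_r.
Qed.

Lemma ract_linear_param (A : lmodType k) (c : A -> k^o) (b : A -> D) e :
  linear c -> linear b -> linear (fun x => ract precD (c x) (b x) e).
Proof.
move=> lc lb; apply: linear_addf; first exact: linear_scalel.
by apply: linear_comp_on lb; exact: bilin_r.
Qed.

Lemma lact_linear_param (A : lmodType k) (c : A -> k^o) (b : A -> D) e :
  linear c -> linear b -> linear (fun x => lact succD (c x) (b x) e).
Proof.
move=> lc lb; apply: linear_addf; first exact: linear_scalel.
by apply: (linear_comp_on (f := fun z => succD z e)) lb; exact: bilin_l.
Qed.

Lemma ev_tree_trilinear p q (l : bt p) (r : bt q) :
  linear (ev_tree l) -> linear (ev_tree r) ->
  trilinear (fun x1 u x2 => ract precD (eps_tree r x2) (ev_tree r x2)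
        (lact succD (eps_tree l x1) (ev_tree l x1) (phi u))).
Proof.
move=> ll lr; split=> [u y|x y|x u].
- apply: (linear_comp_on (f := ract _ _ _)); first exact: ract_linear.
  by apply: lact_linear_param => //; exact: eps_tree_linear.
- apply: (linear_comp_on (f := ract _ _ _)); first exact: ract_linear.
  apply: (linear_comp_on (f := lact _ _ _)); first exact: lact_linear.
  exact: linear_on.
- by apply: ract_linear_param => //; exact: eps_tree_linear.
Qed.

Lemma ev_tree_linear n (Y : bt n) : linear (ev_tree Y).
Proof.
elim: Y => {n} [|p q l IHl r IHr] /=; first exact: linear_zero.
exact/node_lift_linear/ev_tree_trilinear.
Qed.

Lemma ev_tree_node p q (l : bt p) (r : bt q) x1 u x2 :
  ev_tree (Node l r) (tcat2 x1 (tcons u x2)) =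
  ract precD (eps_tree r x2) (ev_tree r x2)
    (lact succD (eps_tree l x1) (ev_tree l x1) (phi u)).
Proof. by rewrite /= node_lift_cat //; apply: ev_tree_trilinear; exact: ev_tree_linear. Qed.

Definition yeps : yspace -> k^o := ylift eps_tree.
Definition yev : yspace -> D := ylift ev_tree.

Lemma yepsE n (Y : bt n) x : yeps (ytree Y x) = eps_tree Y x.
Proof. by rewrite /yeps yliftE // => m Z; exact: eps_tree_linear. Qed.

Lemma yevE n (Y : bt n) x : yev (ytree Y x) = ev_tree Y x.
Proof. by rewrite /yev yliftE // => m Z; exact: ev_tree_linear. Qed.

Lemma yeps_linear : linear yeps.
Proof. by apply: ylift_linear => m Z; exact: eps_tree_linear. Qed.

Lemma yev_linear : linear yev.
Proof. by apply: ylift_linear => m Z; exact: ev_tree_linear. Qed.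

Hint Extern 0 (GRing.linear_for _ yeps) => (exact: yeps_linear) : lin.
Hint Extern 0 (GRing.linear_for _ yev) => (exact: yev_linear) : lin.

Lemma yeps_unit : yeps yunit = 1.
Proof. by rewrite yepsE. Qed.

Lemma yev_unit : yev yunit = 0.
Proof. by rewrite yevE. Qed.

Definition yract z := ract precD (yeps z) (yev z).
Definition ylact z := lact succD (yeps z) (yev z).

Lemma yract_linear e : linear (fun z => yract z e).
Proof. by apply: ract_linear_param; lin. Qed.

Lemma ylact_linear e : linear (fun z => ylact z e).
Proof. by apply: lact_linear_param; lin. Qed.

Lemma yeps_graft a u b : yeps (ygraft a u b) = 0.
Proof.
move: a; apply: (yspace_ext (g := fun=> 0)) => [||m X x]; [lin|exact: linear_zero|].
move: b; apply: (yspace_ext (g := fun=> 0)) => [||n Y y]; [lin|exact: linear_zero|].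
by rewrite ygraft_tree yepsE.
Qed.

Lemma yev_graft a u b : yev (ygraft a u b) = yract b (ylact a (phi u)).
Proof.
move: a; apply: yspace_ext => [||m X x]; first by lin.
  apply: (linear_comp_on (f := yract b)); first exact: ract_linear.
  exact: ylact_linear.
move: b; apply: yspace_ext => [||n Y y]; [lin|exact: yract_linear|].
rewrite ygraft_tree yevE ev_tree_node.
by rewrite /yract /ylact !yepsE !yevE.
Qed.

Lemma precD_mul e b c : precD (precD e b) c = precD e (precD b c + succD b c).
Proof. by have [h _ _] := dend. Qed.
Lemma precD_succD e b c : precD (succD b e) c = succD b (precD e c).
Proof. by have [_ h _] := dend. Qed.
Lemma succD_mul e b c : succD (precD b c + succD b c) e = succD b (succD c e).
Proof. by have [_ _ h] := dend. Qed.

Local Notation "a * b" := (@ystar k V a b).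

(** The component in [D] of the product of the values of [a] and [b] in
    [k ⊕ D]. *)
Definition ev_prod a b : D := (yeps a : k) *: yev b + (yeps b : k) *: yev a +
  (precD (yev a) (yev b) + succD (yev a) (yev b)).

Definition ev_mult a b := yev (a * b) = ev_prod a b.

Lemma yeps_mult a b : yeps (a * b) = (yeps a : k) *: yeps b.
Proof.
move: a; apply: ygraft_ext => [|||a u a'].
- by lin.
- by apply: linear_scalel; lin.
- by rewrite ystar_unitl yeps_unit scale1r.
move: b; apply: ygraft_ext => [|||b v b'].
- by lin.
- by apply: linear_scalef; lin.
- by rewrite ystar_unitr yeps_graft scale0r.
rewrite ystar_graft (linearD_on yeps_linear).
by rewrite (yeps_graft a u) (yeps_graft _ v b') yeps_graft addr0 scale0r.
Qed.

(** Once evaluation is multiplicative on a pair, the dendriform axioms turn the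
    action of the product into the composition of the actions. *)
Lemma yract_mult a b e : ev_mult a b -> yract (a * b) e = yract b (yract a e).
Proof.
move=> h; rewrite /yract /ract yeps_mult h.
rewrite !(linearD_on (bilin_r precD _)) !(linearZ_on (bilin_r precD _)).
rewrite !(linearD_on (bilin_l precD _)) !(linearZ_on (bilin_l precD _)).
rewrite precD_mul (linearD_on (bilin_r precD _)) scalerDr scalerA mulrC -!addrA.
by congr (_ + _); rewrite addrCA.
Qed.

Lemma ylact_mult a b e : ev_mult a b -> ylact (a * b) e = ylact a (ylact b e).
Proof.
move=> h; rewrite /ylact /lact yeps_mult h.
rewrite !(linearD_on (bilin_r succD _)) !(linearZ_on (bilin_r succD _)).
rewrite !(linearD_on (bilin_l succD _)) !(linearZ_on (bilin_l succD _)).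
rewrite -succD_mul !(linearD_on (bilin_l succD _)) scalerDr scalerA -!addrA.
by congr (_ + _).
Qed.

Lemma yract_succD a d e : yract a (succD d e) = succD d (yract a e).
Proof.
rewrite /yract /ract precD_succD (linearD_on (bilin_r succD _)).
by rewrite (linearZ_on (bilin_r succD _)).
Qed.

Lemma yev_prec_step a u b Y : ev_mult b Y ->
  yev (ygraft a u (b * Y)) = yract Y (yev (ygraft a u b)).
Proof. by move=> h; rewrite !yev_graft yract_mult. Qed.

Lemma yev_succ_step X c v d : ev_mult X c ->
  yev (ygraft (X * c) v d) = ylact X (yev (ygraft c v d)) .
Proof.
move=> h; rewrite !yev_graft ylact_mult //.
have lr : linear (yract d) by exact: ract_linear.
have e w : ylact X w = (yeps X : k) *: w + succD (yev X) w by [].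
by rewrite !e (linearD_on lr) (linearZ_on lr) yract_succD.
Qed.

(** Multiplicativity on two grafts [a] and [b] reduces to that on the right
    branch of [a] and [b] (terms with root in [a]) and on [a] and the left
    branch of [b] (terms with root in [b]). *)
Lemma yev_mult a b : ev_mult a b.
Proof.
have [lP rP] := (bilin_l precD, bilin_r precD).
have [lS rS] := (bilin_l succD, bilin_r succD).
have l1 b' : linear (fun a => ev_prod a b').
  apply: linear_addf; apply: linear_addf.
  - by apply: linear_scalel; lin.
  - by apply: linear_scalef; lin.
  - by lin.
  - by lin.
have l2 a' : linear (ev_prod a').
  apply: linear_addf; apply: linear_addf.
  - by apply: linear_scalef; lin.
  - by apply: linear_scalel; lin.
  - by lin.
  - by lin.
move: a; apply: yspace_ext => [||m X x]; [lin|exact: l1|].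
elim: X x b => {m} [|p q l _ r IHr] x b.
  rewrite ytree_Leaf (linearZ_on (ystar_linearl _)) ystar_unitl /ev_prod.
  rewrite !(linearZ_on yev_linear) (linearZ_on yeps_linear) yeps_unit yev_unit scaler0.
  rewrite (linear0_on (bilin_l precD _)) (linear0_on (bilin_l succD _)).
  by rewrite scaler0 !addr0 /GRing.scale /= mulr1.
move: x; apply: (Node_ext (f := fun X => yev (X * b)) (g := fun X => ev_prod X b)); [lin|exact: l1|move=> x1 u x2].
move: (ytree l x1) (ytree r x2) (IHr x2) => {IHr x1 x2} a a' IH.
move: b; apply: yspace_ext => [||m Z z]; [lin|exact: l2|].
elim: Z z => {m} [|p' q' l' IHl r' _] z.
  rewrite ytree_Leaf (linearZ_on (ystar_linearr _)) ystar_unitr /ev_prod.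
  rewrite !(linearZ_on yev_linear) (linearZ_on yeps_linear) yeps_unit yev_unit.
  rewrite yeps_graft scale0r add0r scaler0.
  rewrite (linear0_on (bilin_r precD _)) (linear0_on (bilin_r succD _)).
  by rewrite !addr0 /GRing.scale /= mulr1.
move: z; apply: (Node_ext (f := fun Z => yev (_ * Z)) (g := ev_prod _)); [lin|exact: l2|move=> x1 v x2].
move: (ytree l' x1) (ytree r' x2) (IHl x1) => {IHl x1 x2} c d IHc.
rewrite ystar_graft (linearD_on yev_linear) (yev_prec_step _ _ (IH _)) (yev_succ_step _ _ IHc).
by rewrite /ev_prod /yract /ylact /ract /lact !yeps_graft !scale0r !add0r.
Qed.

Definition ev_bar (a : ybar) : D := yev (yincl a).

Lemma ev_bar_linear : linear ev_bar.
Proof. rewrite /ev_bar; lin. Qed.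

Lemma ev_bar_tree n (Y : bt n.+1) x : ev_bar (ybtree Y x) = ev_tree Y x.
Proof. by rewrite /ev_bar yinclE yevE. Qed.

Lemma yeps_bar (a : ybar) : yeps (yincl a) = 0.
Proof.
move: a; apply: (ybar_graft_ext (g := fun=> 0)) => [||z u z'].
- by lin.
- exact: linear_zero.
- exact: yeps_graft.
Qed.

Lemma ev_bar_prec a b : ev_bar (bprec a b) = precD (ev_bar a) (ev_bar b).
Proof.
have lP := bilin_l precD; rewrite /ev_bar yincl_bprec; move: a.
apply: (ybar_graft_ext (f := fun z => yev (yprec z (yincl b)))
  (g := fun z => precD (yev z) (yev (yincl b)))) => [||z u z'].
- by lin.
- by lin.
rewrite yprec_graft (yev_prec_step _ _ (yev_mult _ _)).
by rewrite /yract /ract yeps_bar scale0r add0r.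
Qed.

Lemma ev_bar_succ a b : ev_bar (bsucc a b) = succD (ev_bar a) (ev_bar b).
Proof.
have rS := bilin_r succD; rewrite /ev_bar yincl_bsucc; move: b.
apply: (ybar_graft_ext (f := fun z => yev (ysucc (yincl a) z))
  (g := fun z => succD (yev (yincl a)) (yev z))) => [||z u z'].
- by lin.
- by lin.
rewrite ysucc_graft (yev_succ_step _ _ (yev_mult _ _)).
by rewrite /ylact /lact yeps_bar scale0r add0r.
Qed.

Lemma ev_bar_iV v : ev_bar (iV v) = phi v.
Proof.
rewrite /ev_bar /iV yprojK_graft yev_graft /yract /ylact /ract /lact.
rewrite yeps_unit yev_unit (linear0_on (bilin_r precD _)) (linear0_on (bilin_l succD _)).
by rewrite !addr0 !scale1r.
Qed.

Lemma yspace_split z : z = (yeps z : k) *: yunit + yincl (yproj z).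
Proof.
move: z; apply: (ygraft_ext (f := fun z => z)) => [|||a u b].
- by lin.
- by apply: linear_addf; [apply: linear_scalel; lin|lin].
- by rewrite yeps_unit scale1r yproj0 (linear0_on (@yincl_linear k V)) addr0.
- by rewrite yeps_graft scale0r add0r yprojK_graft.
Qed.

(** The tree algebra is generated by the image of [iV]. *)
Lemma yproj_graft a u b : yproj (ygraft a u b) =
  ract (@bprec k V) (yeps b) (yproj b) (lact (@bsucc k V) (yeps a) (yproj a) (iV u)).
Proof.
apply: (can_inj (@yinclK k V)); have li := @yincl_linear k V.
have iVu : yincl (iV u) = ygraft yunit u yunit by exact: yprojK_graft.
have es : yincl (lact (@bsucc k V) (yeps a) (yproj a) (iV u)) = ygraft a u yunit.
  rewrite /lact (linearD_on li) (linearZ_on li) yincl_bsucc iVu.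
  rewrite -{1}(ystar_unitl yunit) -ysucc_graft -(linearZ_on (ysucc_linearl _)).
  by rewrite -(linearD_on (ysucc_linearl _)) -yspace_split ysucc_graft ystar_unitr.
rewrite yprojK_graft /ract (linearD_on li) (linearZ_on li) yincl_bprec es.
rewrite -{1}(ystar_unitr yunit) -yprec_graft -(linearZ_on (yprec_linearr _)).
by rewrite -(linearD_on (yprec_linearr _)) -yspace_split yprec_graft ystar_unitl.
Qed.

Lemma ev_bar_unique (psi : {linear ybar -> D}) :
  {morph psi : x y / bprec x y >-> precD x y} ->
  {morph psi : x y / bsucc x y >-> succD x y} ->
  (forall v, phi v = psi (iV v)) -> psi =1 ev_bar.
Proof.
move=> psiP psiS psiV.
suff h n (Y : bt n) x : psi (yproj (ytree Y x)) = ev_tree Y x.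
  by apply: ybar_ext => [||n Y x]; [lin|exact: ev_bar_linear|rewrite ev_bar_tree -h yprojS].
elim: Y x => {n} [|p q l IHl r IHr] x; first by rewrite yproj0 linear0.
rewrite -yevE; move: x; apply: (Node_ext (f := fun z => psi (yproj z))) => [||x1 u x2].
- by lin.
- by lin.
rewrite yproj_graft yev_graft /yract /ylact /ract /lact linearD linearZ /= psiP.
by rewrite linearD linearZ /= psiS -psiV IHl IHr !yepsE !yevE.
Qed.
End Evaluation.

(** * Evaluation commutes with the braidings *)
Section ActCrossing.
Variables (k : fieldType) (D : lmodType k) (precD succD : {bilinear D -> D -> D}).
Variable tau : {linear D ⊗ D -> D ⊗ D}.
Hypotheses (crossP : crosses_product tau precD) (crossS : crosses_product tau succD).
Variables (A B : lmodType k) (g : A -> D).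
Hypothesis lg : linear g.
Variables (eps : B -> k^o) (h : B -> D).

Local Notation R b e := (ract precD (eps b) (h b) e).
Local Notation L b e := (lact succD (eps b) (h b) e).

Let lP := bilin_l precD.
Let lS := bilin_l succD.

(** Let [B] carry a map to [k ⊕ D] with components [eps] and [h], which [A]
    crosses by [c]: [c_eps] says that the scalar component is crossed
    trivially. If [A] crosses the element [e] of [D] by [T], then it crosses the
    result of acting on [e] by [B], in the order in which [e] and the element
    of [B] stand. *)
Section Right.
Variable c : A -> B -> B ⊗ A.
Hypothesis c_eps : forall a b,
  (let⊗ (b1, a1) := c a b in (eps b1 : k) *: a1) = (eps b : k) *: a.
Hypothesis c_h : forall a b,
  tau (g a ⊗ₜ h b) = let⊗ (b1, a1) := c a b in h b1 ⊗ₜ g a1.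
Variables (e : D) (T : A -> D ⊗ A).
Hypothesis T_e : forall a, tau (g a ⊗ₜ e) = let⊗ (e1, a1) := T a in e1 ⊗ₜ g a1.

Lemma ract_cross_right a b : tau (g a ⊗ₜ R b e) =
  let⊗ (e1, a1) := T a in let⊗ (b1, a2) := c a1 b in R b1 e1 ⊗ₜ g a2.
Proof.
have lt : linear (fun d => tau (g a ⊗ₜ d)) by lin.
rewrite /ract (linearD_on lt) (linearZ_on lt) T_e crossP.1 T_e.
have l2 : linear (fun d => (eps b : k) *: d : D ⊗ D).
  by apply: linear_scalef; exact: linear_id.
rewrite (tlift_comp _ _ l2) tlift_tlift; last by lin.
rewrite -tlift_add; let_congr e1 a1; rewrite tlift_pure; last by lin.
rewrite c_h tlift_tlift; last by lin.
have -> : (eps b : k) *: (e1 ⊗ₜ g a1) =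
    let⊗ (b1, a2) := c a1 b in ((eps b1 : k) *: e1) ⊗ₜ g a2.
  have l3 : linear (fun x => e1 ⊗ₜ g x) by lin.
  rewrite -(linearZ_on l3) -c_eps (tlift_comp _ _ l3); let_congr b1 a2.
  by rewrite (linearZ_on l3) (linearZ_on (tpure_l _)).
rewrite -tlift_add; let_congr b1 a2; rewrite tlift_pure; last by lin.
by rewrite -(linearD_on (tpure_l _)).
Qed.

Lemma lact_cross_right a b : tau (g a ⊗ₜ L b e) =
  let⊗ (b1, a1) := c a b in let⊗ (e1, a2) := T a1 in L b1 e1 ⊗ₜ g a2.
Proof.
have lt : linear (fun d => tau (g a ⊗ₜ d)) by lin.
rewrite /lact (linearD_on lt) (linearZ_on lt) crossS.1 c_h.
have -> : (eps b : k) *: tau (g a ⊗ₜ e) =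
    let⊗ (b1, a1) := c a b in let⊗ (e1, a2) := T a1 in ((eps b1 : k) *: e1) ⊗ₜ g a2.
  have l3 : linear (fun x => tau (g x ⊗ₜ e)) by lin.
  rewrite -(linearZ_on l3) -c_eps (tlift_comp _ _ l3); let_congr b1 a1.
  rewrite (linearZ_on l3) T_e.
  rewrite (tlift_comp (L := fun d => _ *: d)); last exact: linear_scalef (@linear_id _ _).
  by let_congr e1 a2; rewrite (linearZ_on (tpure_l _)).
rewrite tlift_tlift; last by lin.
rewrite -tlift_add; let_congr b1 a1; rewrite tlift_pure; last by lin.
rewrite T_e tlift_tlift; last by lin.
rewrite -tlift_add; let_congr e1 a2; rewrite tlift_pure; last by lin.
by rewrite -(linearD_on (tpure_l _)).
Qed.
End Right.

(** The mirror images, where [e] and [B] cross from left to right over [A]. *)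
Section Left.
Variable c : B -> A -> A ⊗ B.
Hypothesis c_eps : forall b a,
  (let⊗ (a1, b1) := c b a in (eps b1 : k) *: a1) = (eps b : k) *: a.
Hypothesis c_h : forall b a,
  tau (h b ⊗ₜ g a) = let⊗ (a1, b1) := c b a in g a1 ⊗ₜ h b1.
Variables (e : D) (T : A -> A ⊗ D).
Hypothesis T_e : forall a, tau (e ⊗ₜ g a) = let⊗ (a1, e1) := T a in g a1 ⊗ₜ e1.

Lemma lact_cross_left b a : tau (L b e ⊗ₜ g a) =
  let⊗ (a1, e1) := T a in let⊗ (a2, b1) := c b a1 in g a2 ⊗ₜ L b1 e1.
Proof.
have lt : linear (fun d => tau (d ⊗ₜ g a)) by lin.
rewrite /lact (linearD_on lt) (linearZ_on lt) T_e crossS.2 T_e.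
have l2 : linear (fun d => (eps b : k) *: d : D ⊗ D).
  by apply: linear_scalef; exact: linear_id.
rewrite (tlift_comp _ _ l2) tlift_tlift; last by lin.
rewrite -tlift_add; let_congr a1 e1; rewrite tlift_pure; last by lin.
rewrite c_h tlift_tlift; last by lin.
have -> : (eps b : k) *: (g a1 ⊗ₜ e1) =
    let⊗ (a2, b1) := c b a1 in g a2 ⊗ₜ ((eps b1 : k) *: e1).
  have l3 : linear (fun x => g x ⊗ₜ e1) by lin.
  rewrite -(linearZ_on l3) -c_eps (tlift_comp _ _ l3); let_congr a2 b1.
  by rewrite (linearZ_on l3) (linearZ_on (tpure_r _)).
rewrite -tlift_add; let_congr a2 b1; rewrite tlift_pure; last by lin.
by rewrite -(linearD_on (tpure_r _)).
Qed.

Lemma ract_cross_left b a : tau (R b e ⊗ₜ g a) =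
  let⊗ (a1, b1) := c b a in let⊗ (a2, e1) := T a1 in g a2 ⊗ₜ R b1 e1.
Proof.
have lt : linear (fun d => tau (d ⊗ₜ g a)) by lin.
rewrite /ract (linearD_on lt) (linearZ_on lt) crossP.2 c_h.
have -> : (eps b : k) *: tau (e ⊗ₜ g a) =
    let⊗ (a1, b1) := c b a in let⊗ (a2, e1) := T a1 in g a2 ⊗ₜ ((eps b1 : k) *: e1).
  have l3 : linear (fun x => tau (e ⊗ₜ g x)) by lin.
  rewrite -(linearZ_on l3) -c_eps (tlift_comp _ _ l3); let_congr a1 b1.
  rewrite (linearZ_on l3) T_e.
  rewrite (tlift_comp (L := fun d => _ *: d)); last exact: linear_scalef (@linear_id _ _).
  by let_congr a2 e1; rewrite (linearZ_on (tpure_r _)).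
rewrite tlift_tlift; last by lin.
rewrite -tlift_add; let_congr a1 b1; rewrite tlift_pure; last by lin.
rewrite T_e tlift_tlift; last by lin.
rewrite -tlift_add; let_congr a2 e1; rewrite tlift_pure; last by lin.
by rewrite -(linearD_on (tpure_r _)).
Qed.
End Left.
End ActCrossing.

Section BraidedEvaluation.
Variables (k : fieldType) (V D : lmodType k) (s : {linear V ⊗ V -> V ⊗ V}).
Variables (precD succD : {bilinear D -> D -> D}) (tau : {linear D ⊗ D -> D ⊗ D}).
Variable phi : {linear V -> D}.
Hypotheses (crossP : crosses_product tau precD) (crossS : crosses_product tau succD).
Hypothesis phi_hom : is_braided_hom s tau phi.
Local Notation tpow := (@tpow k V).
Local Notation ev := (ev_tree precD succD phi).
Local Notation eps := (@eps_tree k V _).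

Let lphi : linear phi. Proof. exact: linear_on. Qed.
Let levT n (Y : bt n) : linear (ev Y). Proof. exact: ev_tree_linear. Qed.
Let leps n (Y : bt n) : linear (eps Y). Proof. exact: eps_tree_linear. Qed.

Lemma phi_cross u v : tau (phi u ⊗ₜ phi v) =
  let⊗ (v1, u1) := s (u ⊗ₜ v) in phi v1 ⊗ₜ phi u1.
Proof. by rewrite -tmapE // -phi_hom. Qed.

(** A tree is either trivial, and then crossing it moves nothing, or its scalar
    component is zero. *)
Lemma eps_cross1 n (Y : bt n) v y :
  (let⊗ (y1, v1) := cross1 s v y in (eps Y y1 : k) *: v1) = (eps Y y : k) *: v.
Proof.
case: Y y => [|p q l r] y.
  rewrite cross1_nil tlift_pure //; apply: bilinI => [x|c].
    by apply: linear_scalel; exact: tscal_linear.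
  exact: linear_scalef (@linear_id _ _).
rewrite scale0r (eq_tlift (g := fun _ _ => 0)); last by move=> *; rewrite scale0r.
by rewrite tliftD big1 // => i _; rewrite scaler0.
Qed.

Lemma eps_cross m (X : bt m) x n (y : tpow n) :
  (let⊗ (y1, x1) := cross s x y in (eps X x1 : k) *: y1) = (eps X x : k) *: y.
Proof.
case: X x => [|p q l r] x.
  rewrite cross_nil tlift_pure //; apply: bilinI => [c|z].
    exact: linear_scalef (@linear_id _ _).
  by apply: linear_scalel; exact: tscal_linear.
rewrite scale0r (eq_tlift (g := fun _ _ => 0)); last by move=> *; rewrite scale0r.
by rewrite tliftD big1 // => i _; rewrite scaler0.
Qed.

(** [phi v] has to cross the left branch, the root and the right branch of the
    tree, in this order; [Tu] is the crossing of the root and [TL] that of the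
    left branch acting on the root. *)
Lemma ev_cross1 n (Y : bt n) v y : tau (phi v ⊗ₜ ev Y y) =
  let⊗ (y1, v1) := cross1 s v y in ev Y y1 ⊗ₜ phi v1.
Proof.
elim: Y v y => {n} [|p q l IHl r IHr] v y.
  rewrite /= (linear0_on (tpure_r _)) linear0 (eq_tlift (g := fun _ _ => 0)).
    by rewrite tliftD big1 // => i _; rewrite scaler0.
  by move=> *; rewrite (linear0_on (tpure_l _)).
have lN := levT (Node l r).
move: y; apply: tcat2_cons_ext; [lin|lin|move=> x1 u x2].
rewrite ev_tree_node.
pose Tu v := let⊗ (u1, v1) := s (v ⊗ₜ u) in phi u1 ⊗ₜ v1.
have lTu : linear Tu by rewrite /Tu; lin.
have Tu_e w : tau (phi w ⊗ₜ phi u) = let⊗ (e1, a1) := Tu w in e1 ⊗ₜ phi a1.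
  by rewrite phi_cross /Tu tlift_tlift; [let_congr a b; rewrite tlift_pure //; lin|lin].
have HL := lact_cross_right crossS lphi (eps_cross1 l) IHl Tu_e.
pose TL v := let⊗ (y1, v1) := cross1 s v x1 in let⊗ (e1, v2) := Tu v1 in
  lact succD (eps l y1) (ev l y1) e1 ⊗ₜ v2.
have lS (e : D) : linear (fun y => lact succD (eps l y) (ev l y) e).
  exact: lact_linear_param.
have lS' y : linear (lact succD (eps l y) (ev l y)) by exact: lact_linear.
have lP (e : D) : linear (fun y => ract precD (eps r y) (ev r y) e).
  exact: ract_linear_param.
have lP' y : linear (ract precD (eps r y) (ev r y)) by exact: ract_linear.
have lTL : linear TL by rewrite /TL; lin.
have TL_e w : tau (phi w ⊗ₜ lact succD (eps l x1) (ev l x1) (phi u)) =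
    let⊗ (e1, a1) := TL w in e1 ⊗ₜ phi a1.
  rewrite HL /TL tlift_tlift; last by lin.
  let_congr y1 v1; rewrite tlift_tlift; last by lin.
  by let_congr e1 v2; rewrite tlift_pure //; lin.
rewrite (ract_cross_right crossP lphi (eps_cross1 r) IHr TL_e).
rewrite (cross1_cat s v x1 (tcons u x2)) /TL tlift_tlift; last by lin.
rewrite tlift_tlift; last by lin.
let_congr y1 v1; rewrite cross1_cons /Tu; do 2!(rewrite tlift_tlift; last by lin).
rewrite tlift_tlift; last by lin.
rewrite tlift_tlift; last by lin.
let_congr u1 v2.
rewrite tlift_pure; last by lin.
rewrite tlift_pure; last by lin.
rewrite tlift_tlift; last by lin.
let_congr y2 v3.
rewrite tlift_pure; last by lin.
rewrite tlift_pure; last by lin.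
by rewrite ev_tree_node.
Qed.

(** Now the right branch, the root and the left branch of [X] cross the tree [Y]
    one after the other. *)
Lemma ev_cross m (X : bt m) x n (Y : bt n) y : tau (ev X x ⊗ₜ ev Y y) =
  let⊗ (y1, x1) := cross s x y in ev Y y1 ⊗ₜ ev X x1.
Proof.
elim: X x y => {m} [|p q l IHl r IHr] x y.
  rewrite /= (linear0_on (tpure_l _)) linear0 (eq_tlift (g := fun _ _ => 0)).
    by rewrite tliftD big1 // => i _; rewrite scaler0.
  by move=> *; rewrite (linear0_on (tpure_r _)).
have lN := levT (Node l r).
move: x; apply: tcat2_cons_ext; [lin|lin|move=> x1 u x2].
rewrite ev_tree_node.
pose g := ev Y; have lg : linear g := levT Y.
pose Tu (y : tpow n) := let⊗ (y1, u1) := cross1 s u y in y1 ⊗ₜ phi u1.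
have lTu : linear Tu by rewrite /Tu; lin.
have Tu_e y0 : tau (phi u ⊗ₜ g y0) = let⊗ (y1, e1) := Tu y0 in g y1 ⊗ₜ e1.
  rewrite [LHS]ev_cross1 /Tu tlift_tlift; last by lin.
  by let_congr a b; rewrite tlift_pure //; lin.
have HL := lact_cross_left crossS lg (fun x y => @eps_cross _ l x n y)
  (fun x y => IHl x y) Tu_e.
pose TL (y : tpow n) := let⊗ (y1, e1) := Tu y in let⊗ (y2, z1) := cross s x1 y1 in
  y2 ⊗ₜ lact succD (eps l z1) (ev l z1) e1.
have lS (e : D) : linear (fun y => lact succD (eps l y) (ev l y) e).
  exact: lact_linear_param.
have lS' z : linear (lact succD (eps l z) (ev l z)) by exact: lact_linear.
have lP (e : D) : linear (fun y => ract precD (eps r y) (ev r y) e).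
  exact: ract_linear_param.
have lP' z : linear (ract precD (eps r z) (ev r z)) by exact: ract_linear.
have lTL : linear TL by rewrite /TL; lin.
have TL_e y0 : tau (lact succD (eps l x1) (ev l x1) (phi u) ⊗ₜ g y0) =
    let⊗ (y1, e1) := TL y0 in g y1 ⊗ₜ e1.
  rewrite HL /TL tlift_tlift; last by lin.
  let_congr y1 e1; rewrite tlift_tlift; last by lin.
  by let_congr y2 z1; rewrite tlift_pure //; lin.
rewrite (ract_cross_left crossP lg (fun x y => @eps_cross _ r x n y)
  (fun x y => IHr x y) TL_e).
rewrite (cross_catl s x1 (tcons u x2) y) tlift_tlift; last by lin.
rewrite cross_cons tlift_tlift; last by lin.
let_congr y1 z2; rewrite /TL /Tu.
rewrite [in LHS]tlift_tlift; last by lin.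
rewrite [in LHS]tlift_tlift; last by lin.
rewrite [in RHS]tlift_tlift; last by lin.
let_congr y2 u1; do ?let_simp; let_congr y3 z1; do ?let_simp.
by rewrite ev_tree_node.
Qed.

Lemma ev_bar_braided : is_braided_hom (sigmaBT s) tau (ev_bar precD succD phi).
Proof.
have lE : linear (ev_bar precD succD phi) by exact: ev_bar_linear.
have ls := sigmaBT_lin s; have lt := tmap_linear lE lE.
apply: tensor_ext => [||a b]; [lin|lin|].
rewrite tmapE //.
move: a; apply: ybar_ext => [||m X x]; [lin|lin|].
move: b; apply: ybar_ext => [||n Y y]; [lin|lin|].
rewrite sigmaBT_tree (tlift_comp _ _ lt) !ev_bar_tree ev_cross.
by let_congr y1 x1; rewrite tmapE // !ev_bar_tree.
Qed.
End BraidedEvaluation.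

Theorem theorem2p8 (k : fieldType) (char0 : [pchar k] =i pred0)
    (V : lmodType k) (sigma : {linear V ⊗ V -> V ⊗ V})
    (sigma_braiding : is_braiding sigma) :
  [/\ is_braided_dendriform (@bprec k V) (@bsucc k V) (sigmaBT sigma),
      is_braided_hom sigma (sigmaBT sigma) (@iV k V)
    & forall (D : lmodType k) (precD succD : {bilinear D -> D -> D})
        (tau : {linear D ⊗ D -> D ⊗ D}),
        is_braided_dendriform precD succD tau ->
      forall phi : {linear V -> D}, is_braided_hom sigma tau phi ->
      exists phibar : {linear ybar V -> D},
        [/\ is_braided_dendriform_hom (@bprec k V) (@bsucc k V) (sigmaBT sigma)
              precD succD tau phibar,
            (forall v, phi v = phibar (iV v))
          & forall psi : {linear ybar V -> D},
              is_braided_dendriform_hom (@bprec k V) (@bsucc k V) (sigmaBT sigma)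
                precD succD tau psi ->
              (forall v, phi v = psi (iV v)) -> psi =1 phibar]].
Proof.
have yb_sigma := (is_braidingP sigma).1 sigma_braiding.
split; first split.
- exact: ybar_dendriform.
- exact/is_braidingP/sigmaBT_yb.
- by apply/braid_compatP/crosses_tree_sum => m Y n Y'; exact: bprec_sum.
- by apply/braid_compatP/crosses_tree_sum => m Y n Y'; exact: bsucc_sum.
- exact: sigmaBT_iV.
move=> D precD succD tau [dend _ /braid_compatP crossP /braid_compatP crossS] phi phi_hom.
pose phibar : {linear ybar V -> D} := HB.pack (ev_bar precD succD phi)
  (GRing.isLinear.Build k _ _ _ _ (ev_bar_linear precD succD phi)).
exists phibar; split; first split.
- by move=> a b; exact: ev_bar_prec.
- by move=> a b; exact: ev_bar_succ.
- exact: ev_bar_braided.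
- by move=> v; rewrite [RHS]ev_bar_iV.
- by move=> psi [psiP psiS _] psiV; exact: ev_bar_unique.
Qed.
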